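(* Let $\mu$ be a nonnegative Radon measure on $\mathbb R^d$, let $\sigma\in(L^1_\mu)^d$, and denote $\sigma_T=P_\mu\sigma$, $\sigma_N=P_\mu^\perp\sigma$. Set $$f_T:=-\operatorname{div}(\sigma_T\mu),\qquad r:=\int|\sigma_N|\,d\mu.$$ (i) $f_T\in\mathrm{AE}(\mathbb R^d)$ and $$r\le H(\sigma,g)\le r+\|g-f_T\|_{\mathrm{KR}}\qquad\text{for every }g\in\mathrm{AE}(\mathbb R^d).$$ (ii) $\{D_h^\sigma\mu\}$ is Cauchy in $\mathrm{AE}(\mathbb R^d)$ (as $h\to0^+$) if and only if $\sigma\in\mathcal T_\mu$. In this case, $$\lim_{h\to0}\big\|D_h^\sigma\mu+\operatorname{div}(\sigma\mu)\big\|_{\mathrm{KR}}=0.$$ (iii) If $\sigma\notin\mathcal T_\mu$, then $\{D_h^\sigma\mu\}$ has positive asymptotic radius $\rho=r=\int|\sigma_N|\,d\mu$ and its asymptotic center is the singleton $\{f_T\}$. In particular, $$\lim_{h\to0}\big\|D_h^\sigma\mu+\operatorname{div}(\sigma_T\mu)\big\|_{\mathrm{KR}}=\int|\sigma_N|\,d\mu.$$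
   Context: $\mathcal D(\mathbb R^d)$ is the space of smooth compactly supported functions, $\operatorname{Lip}(\mathbb R^d)$ the space of real Lipschitz functions, $\operatorname{Lip}_1$ those with Lipschitz constant at most $1$. Let $\mathcal M_{0,1}(\mathbb R^d)$ be the finite signed Borel measures $f$ with $\int df=0$ and $\int|x|\,d|f|<\infty$, with norm $\|f\|_{\mathrm{KR}}=\sup\{\int u\,df: u\in\operatorname{Lip}_1(\mathbb R^d)\}$. The Arens-Eells space $\mathrm{AE}(\mathbb R^d)$ is the completion of $\mathcal M_{0,1}(\mathbb R^d)$ for this norm, identified with a subspace of distributions: $f\in\mathcal D'(\mathbb R^d)$ belongs to $\mathrm{AE}(\mathbb R^d)$ iff $\langle f,\varphi_n\rangle\to0$ for every sequence $(\varphi_n)\subset\mathcal D(\mathbb R^d)$ with $\sup_n\|\nabla\varphi_n\|_\infty<\infty$ and $\varphi_n\to c$ pointwise for some constant $c\in\mathbb R$. Elements of $\mathrm{AE}(\mathbb R^d)$ extend by completion (density of $\mathcal M_{0,1}$) to linear forms on $\operatorname{Lip}(\mathbb R^d)$ vanishing on constants, and $\|f\|_{\mathrm{KR}}=\sup\{\langle f,u\rangle: u\in\operatorname{Lip}_1(\mathbb R^d)\}$. For a nonnegative Radon measure $\mu$, set $\mathcal T_\mu:=\{\sigma\in(L^1_\mu(\mathbb R^d))^d: -\operatorname{div}(\sigma\mu)\in\mathrm{AE}(\mathbb R^d)\}$. There is a $\mu$-measurable map $x\mapsto T_\mu(x)$ valued in the linear subspaces of $\mathbb R^d$, unique up to $\mu$-null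 sets, such that for $\sigma\in(L^1_\mu)^d$: $\sigma\in\mathcal T_\mu\iff\sigma(x)\in T_\mu(x)$ $\mu$-a.e. (the MK tangent bundle). $P_\mu(x)$ and $P_\mu^\perp(x)$ are the orthogonal projections onto $T_\mu(x)$ and $T_\mu(x)^\perp$. For $h>0$ and $\sigma\in(L^1_\mu)^d$, $D_h^\sigma\mu:=\frac{(\mathrm{id}+h\sigma)_\#\mu-\mu}{h}$, i.e. $\langle D_h^\sigma\mu,u\rangle=\int\frac{u(x+h\sigma(x))-u(x)}{h}\,d\mu(x)$ for $u \in \operatorname{Lip}(\mathbb R^d)$; it is an element of $\mathrm{AE}(\mathbb R^d)$ with $\|D_h^\sigma\mu\|_{\mathrm{KR}}\le\int|\sigma|\,d\mu$. For $g\in\mathrm{AE}(\mathbb R^d)$, $$H(\sigma,g):=\limsup_{h\to0^+}\|D_h^\sigma\mu-g\|_{\mathrm{KR}}.$$ The asymptotic radius of $\{D_h^\sigma\mu\}$ is $\rho:=\inf_{f\in\mathrm{AE}(\mathbb R^d)}H(\sigma,f)$, and its asymptotic center is the (possibly empty) set $\{g\in\mathrm{AE}(\mathbb R^d): H(\sigma,g)=\rho\}$. *)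

(* Defs.v *)
From HB Require Import structures.
From mathcomp Require Import all_boot all_order all_algebra.
From mathcomp Require Import all_classical all_reals all_analysis.

Set Implicit Arguments.
Unset Strict Implicit.
Unset Printing Implicit Defensive.

Import Order.TTheory GRing.Theory Num.Theory.
Import numFieldNormedType.Exports.

Local Open Scope classical_set_scope.
Local Open Scope ring_scope.

(* R^d is 'rV[R]_d.  Its library norm is the sup norm, which only matters here
   through the topology; the Euclidean structure is [dot] and [enorm]. *)

Definition borel (R : realType) (d : nat) :=
  g_sigma_algebraType (@open 'rV[R]_d).

Section euclidean.
Context (R : realType) (d : nat).
Local Notation V := 'rV[R]_d.

Definition dot (u v : V) : R := \sum_i u 0 i * v 0 i.
Definition enorm (u : V) : R := Num.sqrt (dot u u).

(* A linear subspace of R^d is represented by the row space of a square matrix,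
   and an operator P acts on row vectors by v |-> v *m P. *)
Definition orthc (U : 'M[R]_d) : 'M[R]_d := kermx U^T.
Definition orthoproj (U : 'M[R]_d) : 'M[R]_d := proj_mx U (orthc U).

Definition partial (i : 'I_d) (u : V -> R) : V -> R :=
  fun x => 'D_(delta_mx 0 i) u x.
Definition grad (u : V -> R) (x : V) : V := \row_i partial i u x.

Definition smooth (u : V -> R) : Prop :=
  forall (s : seq 'I_d) (x : V), differentiable (foldr partial u s) x.

Definition test_function (u : V -> R) : Prop :=
  smooth u /\ compact (closure [set x | u x != 0]).

Definition k_lipschitz (k : R) (u : V -> R) : Prop :=
  forall x y, `|u x - u y| <= k * enorm (x - y).

Record Lip := MkLip {
  lip_fun :> V -> R ;
  lip_funP : exists k, k_lipschitz k lip_fun }.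

Definition linear_form (f : Lip -> R) : Prop :=
  forall (a b : R) (u v w : Lip),
    (forall x, w x = a * u x + b * v x) -> f w = a * f u + b * f v.

End euclidean.

Section arens_eells.
Context (R : realType) (d : nat).
Local Notation V := 'rV[R]_d.
Local Notation Lip := (Lip R d).

(* The Hahn decomposition is carried along to form the Jordan decomposition;
   it exists for every charge and is unique up to null sets. *)
Record M01 := MkM01 {
  M01_charge :> {charge set (borel R d) -> \bar R} ;
  M01_P : set (borel R d) ;
  M01_N : set (borel R d) ;
  M01_hahn : hahn_decomposition M01_charge M01_P M01_N ;
  M01_mass : M01_charge setT = 0%E ;
  M01_moment :
    (\int[charge_variation M01_hahn]_x (enorm (x : V))%:E < +oo)%E }.

Definition M01_pairing (m : M01) (u : Lip) : R :=
  \int[jordan_pos (M01_hahn m)]_x u x - \int[jordan_neg (M01_hahn m)]_x u x.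

Definition KRnorm (f : Lip -> R) : \bar R :=
  ereal_sup [set (f u)%:E | u in [set u : Lip | k_lipschitz 1 u]].

Definition KRdist (f g : Lip -> R) : \bar R := KRnorm (fun u => f u - g u).

(* The completion of M01, realized as its closure in the space of linear forms
   on Lip, where M01 embeds isometrically by the definition of the KR norm.
   Linearity has to be required since KRnorm only sees 1-Lipschitz functions. *)
Definition AE : set (Lip -> R) :=
  [set f | linear_form f /\ forall e : R, 0 < e ->
    exists m : M01, (KRdist f (M01_pairing m) < e%:E)%E].

(* A distribution is given by its action on test functions (its values
   elsewhere are irrelevant); elements of AE are identified with distributions
   by restriction to test functions. *)
Definition restricts_to (f : Lip -> R) (L : (V -> R) -> R) : Prop :=
  forall u : Lip, test_function u -> f u = L u.

Definition distr_in_AE (L : (V -> R) -> R) : Prop :=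
  exists2 f, AE f & restricts_to f L.

(* The element of AE identified with the distribution L (the zero form when L
   is not in AE). *)
Definition AE_of_distr (L : (V -> R) -> R) : Lip -> R :=
  xget (fun=> 0) [set f | AE f /\ restricts_to f L].

End arens_eells.

Section mk_tangent.
Context (R : realType) (d : nat).
Local Notation V := 'rV[R]_d.
Local Notation Lip := (Lip R d).
Variable mu : {measure set (borel R d) -> \bar R}.

(* On R^d, local finiteness implies regularity of a Borel measure. *)
Definition radon : Prop := forall K : set V, compact K -> (mu K < +oo)%E.

Definition L1vec (sigma : V -> V) : Prop :=
  forall i, mu.-integrable setT (fun x : borel R d => (sigma x 0 i)%:E).

(* - div (sigma mu) *)
Definition mdiv (sigma : V -> V) : (V -> R) -> R :=
  fun u => \int[mu]_x dot (grad u x) (sigma x).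

Definition MKfields : set (V -> V) :=
  [set sigma | L1vec sigma /\ distr_in_AE (mdiv sigma)].

(* mu-measurable: mu-a.e. equal to a Borel function. *)
Definition mu_measurable (f : V -> R) : Prop :=
  exists2 g : borel R d -> R, measurable_fun setT g &
    {ae mu, forall x, f x = g x}.

Definition mu_measurable_subspaces (T : V -> 'M[R]_d) : Prop :=
  forall i j, mu_measurable (fun x => orthoproj (T x) i j).

Definition MK_tangent_bundle (T : V -> 'M[R]_d) : Prop :=
  mu_measurable_subspaces T /\
  forall sigma, L1vec sigma ->
    (MKfields sigma <-> {ae mu, forall x, (sigma x <= T x)%MS}).

Definition Dh (sigma : V -> V) (h : R) : Lip -> R :=
  fun u => \int[mu]_x ((u (x + h *: sigma x) - u x) / h).

Definition Hsup (sigma : V -> V) (g : Lip -> R) : \bar R :=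
  limf_esup (fun h => KRdist (Dh sigma h) g) 0^'+.

Definition asymptotic_radius (sigma : V -> V) : \bar R :=
  ereal_inf [set Hsup sigma f | f in @AE R d].

Definition asymptotic_center (sigma : V -> V) : set (Lip -> R) :=
  [set g | AE g /\ Hsup sigma g = asymptotic_radius sigma].

Definition Dh_cauchy (sigma : V -> V) : Prop :=
  forall e : R, 0 < e -> \forall p \near (0^'+, 0^'+),
    (KRdist (Dh sigma p.1) (Dh sigma p.2) < e%:E)%E.

End mk_tangent.

(* Main.v *)
Require Import Defs.
From HB Require Import structures.
From mathcomp Require Import all_boot all_order all_algebra.
From mathcomp Require Import all_classical all_reals all_analysis.
From mathcomp Require Import measurable_realfun.
From mathcomp Require Import ring lra.
Set Implicit Arguments.
Unset Strict Implicit.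
Unset Printing Implicit Defensive.
Import Order.TTheory GRing.Theory Num.Theory.
Import numFieldNormedType.Exports.
Local Open Scope classical_set_scope.
Local Open Scope ring_scope.

(** Write [tau] for the tangential part of [sigma], [nu] for its normal part and
    [r] for the integral of [|nu|].

    The upper bound is soft.  Replacing [sigma] by [tau] changes the difference
    quotients by at most [r] in the KR norm ([Dh_diff]), and the quotients of a
    field whose divergence is in AE converge to [- div] of that field.  This
    convergence rests on a criterion ([div_continuousP]): a field is tangent if
    and only if its pairing with a 1-Lipschitz test function [v] is small as soon
    as [v] is uniformly small.  Indeed, after an L1 approximation of the field by
    a smooth one, the difference quotient of [u] is a derivative along the flow at
    an intermediate time, hence almost a pairing with a function uniformly close
    to [u] ([flow_smoothing]); under the criterion, the quotients are Cauchy.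

    The lower bound needs 1-Lipschitz functions that are invisible to AE but see
    the normal part.  By completion, elements of AE do not see test functions [z]
    that are uniformly small ([AE_small]); so it is enough to find, for [s ^+ 2 + t ^+ 2 <= 1]
    and a 1-Lipschitz test function [u0], such a [z] for which [t u0 + z] is almost
    1-Lipschitz and has a gradient close to [s nu / |nu| + t (tangential part of
    grad u0)] on a large set.  Pairing [t u0 + z] with [sigma] then gives
    [s r + t < f_T, u0 >] up to an error ([lower_witness]), hence the bound
    [s r + t < f_T - g, u0 >] for the limit of the KR distance to [g].  With
    [s = 1] and [t = 0] this is the lower bound [r]; with [s = 1 - t ^+ 2] and small
    [t] it excludes every center [g] other than [f_T].

    The function [z] is built in two stages.
    - Any bounded field [xi] normal to the bundle is the limit in measure, on
      balls, of gradients of equi-Lipschitz functions tending uniformly to 0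
      ([approx_by_small_gradients]).  These functions come from minimizing the L2
      distance between [xi] and such gradients.  By the parallelogram identity,
      [xi - grad v] converges along almost minimizers [v], and by the vanishing of
      the first variation the limit pairs to 0 with small gradients: it satisfies
      the criterion, so it is tangent, hence orthogonal to [xi], and the infimum
      is 0.
    - The Lipschitz constant [k] of these functions is not controlled.  Averaging
      [N] of them, with [N] much larger than [k], repairs this
      ([corrector_exists]): each new function is multiplied by a cutoff that
      vanishes where the gradient of one of the preceding functions was too large,
      so that each point suffers at most one gradient of size [k], which
      contributes [k / N] to the mean.  The functions are chosen successively,
      each so small that the derivatives of the cutoffs do not matter. *)

(** * Euclidean geometry and orthogonal projections *)

Section euclid.
Context (R : realType) (d : nat).
Local Notation V := 'rV[R]_d.
Implicit Types (u v w x y : V) (U : 'M[R]_d).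

Lemma dotC u v : dot u v = dot v u.
Proof. by apply: eq_bigr => i _; rewrite mulrC. Qed.

Lemma dotDl u v w : dot (u + v) w = dot u w + dot v w.
Proof. by rewrite -big_split; apply: eq_bigr => i _; rewrite !mxE mulrDl. Qed.

Lemma dotZl a u w : dot (a *: u) w = a * dot u w.
Proof. by rewrite mulr_sumr; apply: eq_bigr => i _; rewrite !mxE mulrA. Qed.

Lemma dotNl u w : dot (- u) w = - dot u w.
Proof. by rewrite -scaleN1r dotZl mulN1r. Qed.

Lemma dotBl u v w : dot (u - v) w = dot u w - dot v w.
Proof. by rewrite dotDl dotNl. Qed.

Lemma dotDr u v w : dot w (u + v) = dot w u + dot w v.
Proof. by rewrite dotC dotDl !(dotC w). Qed.

Lemma dotZr a u w : dot w (a *: u) = a * dot w u.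
Proof. by rewrite dotC dotZl dotC. Qed.

Lemma dotBr u v w : dot w (u - v) = dot w u - dot w v.
Proof. by rewrite dotC dotBl !(dotC w). Qed.

Lemma dot0l w : dot 0 w = 0 :> R.
Proof. by rewrite -(scale0r w) dotZl mul0r. Qed.

Lemma dot0r w : dot w 0 = 0 :> R.
Proof. by rewrite dotC dot0l. Qed.

Lemma dot_ge0 u : 0 <= dot u u.
Proof. by apply: sumr_ge0 => i _; rewrite -expr2 sqr_ge0. Qed.

Lemma dot_eq0 u : dot u u = 0 -> u = 0.
Proof.
move=> /eqP; rewrite psumr_eq0 => [/allP h|i _]; last by rewrite -expr2 sqr_ge0.
apply/rowP => i; rewrite mxE.
by have := h i (mem_index_enum _) => /=; rewrite mulf_eq0 orbb => /eqP.
Qed.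

Lemma dot_delta u i : dot u (delta_mx 0 i) = u 0 i.
Proof.
rewrite /dot (bigD1 i)//= big1 ?addr0 ?mxE ?eqxx ?mulr1// => j ji.
by rewrite mxE eqxx (negbTE ji) mulr0.
Qed.

Lemma enorm_ge0 u : 0 <= enorm u. Proof. exact: sqrtr_ge0. Qed.
Hint Resolve enorm_ge0 : core.

Lemma sqr_enorm u : enorm u ^+ 2 = dot u u.
Proof. by rewrite sqr_sqrtr// dot_ge0. Qed.

Lemma enorm0 : enorm (0 : V) = 0.
Proof. by rewrite /enorm dot0l sqrtr0. Qed.

Lemma enorm_eq0 u : enorm u = 0 -> u = 0.
Proof. by move=> h; apply: dot_eq0; rewrite -sqr_enorm h expr0n. Qed.

Lemma enormZ a u : enorm (a *: u) = `|a| * enorm u.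
Proof. by rewrite /enorm dotZl dotZr mulrA -expr2 sqrtrM ?sqr_ge0// sqrtr_sqr. Qed.

Lemma enormN u : enorm (- u) = enorm u.
Proof. by rewrite -scaleN1r enormZ normrN1 mul1r. Qed.

Lemma enormBC u v : enorm (u - v) = enorm (v - u).
Proof. by rewrite -opprB enormN. Qed.

Lemma dot_le_enorm u v : dot u v <= enorm u * enorm v.
Proof.
have [v0|v0] := eqVneq (enorm v) 0.
  by rewrite (enorm_eq0 v0) dot0r enorm0 mulr0.
have vp : 0 < enorm v by rewrite lt_def v0 enorm_ge0.
have [u0|u0] := eqVneq (enorm u) 0.
  by rewrite (enorm_eq0 u0) dot0l enorm0 mul0r.
have up : 0 < enorm u by rewrite lt_def u0 enorm_ge0.
have := dot_ge0 (enorm v *: u - enorm u *: v).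
rewrite dotBl !dotBr !dotZl !dotZr (dotC v u) -!sqr_enorm => h.
have : 0 <= (2 * enorm u * enorm v) * (enorm u * enorm v - dot u v) by nra.
by rewrite pmulr_rge0 ?subr_ge0// !mulr_gt0.
Qed.

Lemma norm_dot_le u v : `|dot u v| <= enorm u * enorm v.
Proof.
by rewrite ler_norml dot_le_enorm andbT lerNl -dotNl -(enormN u) dot_le_enorm.
Qed.

Lemma enormD u v : enorm (u + v) <= enorm u + enorm v.
Proof.
rewrite -(@ler_pXn2r _ 2)// ?nnegrE ?addr_ge0//.
rewrite sqr_enorm dotDl !dotDr (dotC v u) -!sqr_enorm sqrrD.
have := dot_le_enorm u v; lra.
Qed.

Lemma enormB u v : enorm (u - v) <= enorm u + enorm v.
Proof. by rewrite -(enormN v) enormD. Qed.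

Lemma enorm_triangle u v w : enorm (u - w) <= enorm (u - v) + enorm (v - w).
Proof. by have := enormD (u - v) (v - w); rewrite addrA subrK. Qed.

Lemma enorm_sum (I : Type) (r : seq I) (F : I -> V) :
  enorm (\sum_(i <- r) F i) <= \sum_(i <- r) enorm (F i).
Proof.
elim/big_rec2: _ => [|i y x _ h]; first by rewrite enorm0.
by apply: le_trans (enormD _ _) _; rewrite lerD2l.
Qed.

Lemma enorm_delta i : enorm (delta_mx 0 i : V) = 1.
Proof. by rewrite /enorm dot_delta mxE !eqxx sqrtr1. Qed.

Lemma coord_le_enorm u i : `|u 0 i| <= enorm u.
Proof.
by have := norm_dot_le u (delta_mx 0 i); rewrite dot_delta enorm_delta mulr1.
Qed.

Lemma enorm_le_sum u : enorm u <= \sum_i `|u 0 i|.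
Proof.
rewrite {1}(row_sum_delta u); apply: le_trans (enorm_sum _ _) _.
by apply: ler_sum => i _; rewrite enormZ enorm_delta mulr1.
Qed.

Lemma norm_le_enorm u : `|u| <= enorm u.
Proof.
rewrite /Num.norm/= mx_normrE; apply/bigmax_leP; split => // -[i j] _ /=.
by rewrite ord1 coord_le_enorm.
Qed.

Lemma coord_le_norm u i : `|u 0 i| <= `|u|.
Proof.
by rewrite [in leRHS]/Num.norm/= mx_normrE;
  apply: (@le_bigmax _ _ _ _ (fun ij => `|u ij.1 ij.2|) (0, i)).
Qed.

Lemma enorm_le_norm u : enorm u <= d%:R * `|u|.
Proof.
apply: le_trans (enorm_le_sum u) _.
apply: (@le_trans _ _ (\sum_(i < d) `|u|)).
  by apply: ler_sum => i _; exact: coord_le_norm.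
by rewrite sumr_const card_ord mulr_natl.
Qed.

Lemma enorm_dist u v : `|enorm u - enorm v| <= enorm (u - v).
Proof.
rewrite ler_norml; apply/andP; split.
  rewrite lerNl opprB lerBlDr; have := enormD (v - u) u.
  by rewrite subrK enormBC.
by rewrite lerBlDr; have := enormD (u - v) v; rewrite subrK.
Qed.

Lemma k_lipschitz_continuous k (u : V -> R) : k_lipschitz k u -> continuous u.
Proof.
move=> ku x; have FF : Filter (nbhs x) by exact: nbhs_filter.
apply/(@cvgrPdist_le _ _ _ (nbhs x)) => e e0.
have K0 : 0 < `|k| * d%:R + 1 by rewrite ltr_wpDl// mulr_ge0.
apply/nbhs_ballP; exists (e / (`|k| * d%:R + 1)) => /=; first by rewrite divr_gt0.
move=> y; rewrite -ball_normE /= => xy.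
apply: le_trans (ku x y) _.
apply: (@le_trans _ _ (`|k| * (d%:R * `|x - y|))).
  apply: (le_trans (ler_wpM2r (enorm_ge0 _) (ler_norm k))).
  by rewrite ler_wpM2l// enorm_le_norm.
apply: (@le_trans _ _ ((`|k| * d%:R + 1) * `|x - y|)).
  by rewrite mulrA ler_wpM2r// lerDl.
by rewrite mulrC -ler_pdivlMr// ltW.
Qed.

Lemma continuous_enorm : continuous (@enorm R d).
Proof.
by apply: (@k_lipschitz_continuous 1) => x y; rewrite mul1r enorm_dist.
Qed.

Lemma dotE u v : dot u v = (u *m v^T) 0 0.
Proof. by rewrite mxE; apply: eq_bigr => i _; rewrite mxE. Qed.

Lemma orthc_dot U u v : (u <= U)%MS -> (v <= orthc U)%MS -> dot v u = 0.
Proof.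
move=> /submxP[a ->] /sub_kermxP h.
by rewrite dotE trmx_mul mulmxA h mul0mx mxE.
Qed.

Lemma capmx_orthc U : (U :&: orthc U)%MS = 0.
Proof.
apply/eqP/rowV0P => v; rewrite sub_capmx => /andP[vU vo].
by apply: dot_eq0; apply: orthc_dot vU vo.
Qed.

Lemma addsmx_orthc U (v : V) : (v <= U + orthc U)%MS.
Proof.
suff : row_full (U + orthc U)%MS by move=> /submx_full ->.
rewrite /row_full mxrank_disjoint_sum ?capmx_orthc//.
by rewrite /orthc mxrank_ker mxrank_tr subnKC// rank_leq_row.
Qed.

Lemma orthoproj_sub U v : (v *m orthoproj U <= U)%MS.
Proof. exact: proj_mx_sub. Qed.

Lemma orthoproj_compl U v : (v - v *m orthoproj U <= orthc U)%MS.
Proof. by apply: proj_mx_compl_sub; exact: addsmx_orthc. Qed.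

Lemma orthoproj_orth U v w : (w <= U)%MS -> dot (v - v *m orthoproj U) w = 0.
Proof. by move=> wU; apply: orthc_dot wU (orthoproj_compl _ _). Qed.

Lemma orthoproj_orthc U v : v *m orthoproj (orthc U) = v - v *m orthoproj U.
Proof.
set b := RHS; set y := LHS.
apply/eqP; rewrite eq_sym -subr_eq0; apply/eqP/dot_eq0.
have bU : (b <= orthc U)%MS by exact: orthoproj_compl.
have yU : (y <= orthc U)%MS by exact: orthoproj_sub.
have byU : (b - y <= orthc U)%MS by rewrite addmx_sub// -scaleN1r scalemx_sub.
have -> : dot (b - y) (b - y) = dot (v - y) (b - y) - dot (v *m orthoproj U) (b - y).
  by rewrite -dotBl /b addrAC.
rewrite orthoproj_orth// dotC (orthc_dot (orthoproj_sub U v) byU).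
by rewrite subrr.
Qed.

Lemma orthoproj_pythagoras U v :
  dot v v = dot (v *m orthoproj U) (v *m orthoproj U)
          + dot (v - v *m orthoproj U) (v - v *m orthoproj U).
Proof.
set a := v *m _; set b := v - a.
have h : dot b a = 0 by apply: orthoproj_orth; exact: orthoproj_sub.
have h' : dot a b = 0 by rewrite dotC.
have {1 2}-> : v = a + b by rewrite /b addrC subrK.
clearbody a b.
by rewrite dotDl !dotDr h h' addr0 add0r.
Qed.

Lemma enorm_orthoproj U v : enorm (v *m orthoproj U) <= enorm v.
Proof.
by rewrite ler_sqrt ?dot_ge0// (orthoproj_pythagoras U v) lerDl dot_ge0.
Qed.

Lemma orthoproj0 : orthoproj (0 : 'M[R]_d) = 0.
Proof.
by apply/row_matrixP => i; rewrite !rowE mulmx0; apply/eqP;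
   rewrite -submx0; exact: orthoproj_sub.
Qed.

End euclid.
#[global] Hint Resolve enorm_ge0 : core.

(** * Calculus of smooth functions *)

Section smooth_calculus.
Context (R : realType) (d : nat).
Local Notation V := 'rV[R]_d.
Implicit Types (u v w : V -> R) (x y : V).

(** Smoothness graded by the number of derivatives: closure properties are proved
    by induction on n. *)
Fixpoint Cn (n : nat) (u : V -> R) : Prop :=
  (forall x, differentiable u x) /\
  if n is m.+1 then forall i, Cn m (partial i u) else True.

Lemma Cn_diff n u x : Cn n u -> differentiable u x.
Proof. by case: n => [|n] []. Qed.

Lemma CnW n u : Cn n.+1 u -> Cn n u.
Proof.
elim: n u => [|n IH] u [du h]; first by split.
by split => // i; apply: IH; exact: h.
Qed.

Lemma smoothP u : smooth u <-> forall n, Cn n u.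
Proof.
split=> [su n|h s].
  elim: n u su => [|n IH] u su; split=> //; try exact: (su [::]).
  move=> i; apply: IH => s x; have := su (rcons s i) x.
  by rewrite foldr_rcons.
have {h} := h (size s); elim/last_ind: s u => [|s i IH] u; first by case.
rewrite size_rcons foldr_rcons => -[_ h]; exact: IH (h i).
Qed.

Lemma smooth_diff u x : smooth u -> differentiable u x.
Proof. by move=> /(_ [::]); apply. Qed.

Lemma smooth_partial i u : smooth u -> smooth (partial i u).
Proof. by move=> su; apply: (smoothP _).2 => n; have [_ h] := (smoothP _).1 su n.+1; exact: h. Qed.

Lemma partialE i u x : differentiable u x -> partial i u x = 'd u x (delta_mx 0 i).
Proof. exact: deriveE. Qed.

Lemma diff_grad u x h : differentiable u x -> 'd u x h = dot (grad u x) h.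
Proof.
move=> du; rewrite [h in LHS]row_sum_delta linear_sum; apply: eq_bigr => i _.
by rewrite linearZ/= mxE partialE// mulrC.
Qed.

Lemma partial_cst i a : partial i (fun=> a : R) = (fun _ : V => 0).
Proof. by apply/funext => x; rewrite /partial (derive_cst a). Qed.

Lemma Cn_cst n a : Cn n (fun=> a).
Proof.
elim: n a => [|n IH] a; split => //; try by move=> x; exact: (differentiable_cst a).
by move=> i; rewrite partial_cst.
Qed.

Lemma partialD i u v : (forall x, differentiable u x) -> (forall x, differentiable v x) ->
  partial i (fun x => u x + v x) = (fun x => partial i u x + partial i v x).
Proof.
move=> du dv; apply/funext => x.
by rewrite /partial -[LHS]/('D_(delta_mx 0 i) (u + v) x) deriveD//; exact: diff_derivable.
Qed.

Lemma CnD n u v : Cn n u -> Cn n v -> Cn n (fun x => u x + v x).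
Proof.
elim: n u v => [|n IH] u v [du hu] [dv hv]; split=> //;
  try by move=> x; exact: differentiableD.
by move=> i; rewrite partialD//; apply: IH; [exact: hu|exact: hv].
Qed.

Lemma partialM i u v : (forall x, differentiable u x) -> (forall x, differentiable v x) ->
  partial i (fun x => u x * v x) = (fun x => u x * partial i v x + v x * partial i u x).
Proof.
move=> du dv; apply/funext => x.
by rewrite /partial -[LHS]/('D_(delta_mx 0 i) (u * v) x) deriveM//; exact: diff_derivable.
Qed.

Lemma CnM n u v : Cn n u -> Cn n v -> Cn n (fun x => u x * v x).
Proof.
elim: n u v => [|n IH] u v hu hv; case: (hu) => du hu'; case: (hv) => dv hv'; split=> //;
  try by move=> x; exact: differentiableM.
by move=> i; rewrite partialM//; apply: CnD; apply: IH; (try exact: CnW); (try exact: hu'); exact: hv'.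
Qed.

Lemma CnZ n a u : Cn n u -> Cn n (fun x => a * u x).
Proof. by move=> h; apply: CnM => //; exact: Cn_cst. Qed.

Lemma CnN n u : Cn n u -> Cn n (fun x => - u x).
Proof.
move=> h; rewrite (_ : (fun x => _) = (fun x => -1 * u x)); first exact: CnZ.
by apply/funext => x; rewrite mulN1r.
Qed.

Lemma CnB n u v : Cn n u -> Cn n v -> Cn n (fun x => u x - v x).
Proof. by move=> hu hv; apply: CnD => //; exact: CnN. Qed.

Lemma Cn_sum n (I : Type) (r : seq I) (F : I -> V -> R) :
  (forall i, Cn n (F i)) -> Cn n (fun x => \sum_(i <- r) F i x).
Proof.
move=> h; elim: r => [|i r IH].
  rewrite (_ : (fun x => _) = fun=> 0); first exact: Cn_cst.
  by apply/funext => x; rewrite big_nil.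
rewrite (_ : (fun x => _) = fun x => F i x + \sum_(i <- r) F i x); first exact: CnD.
by apply/funext => x; rewrite big_cons.
Qed.

Lemma Cn_prod n (I : Type) (r : seq I) (F : I -> V -> R) :
  (forall i, Cn n (F i)) -> Cn n (fun x => \prod_(i <- r) F i x).
Proof.
move=> h; elim: r => [|i r IH].
  rewrite (_ : (fun x => _) = fun=> 1); first exact: Cn_cst.
  by apply/funext => x; rewrite big_nil.
rewrite (_ : (fun x => _) = fun x => F i x * \prod_(i <- r) F i x); first exact: CnM.
by apply/funext => x; rewrite big_cons.
Qed.

Lemma chain1 (F : R -> R) u x (a : R) i : differentiable u x -> is_derive (u x) 1 F a ->
  differentiable (F \o u) x /\ partial i (F \o u) x = a * partial i u x.
Proof.
move=> du dF; have dF' : differentiable F (u x).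
  by apply/derivable1_diffP; exact: ex_derive.
have dc : differentiable (F \o u) x by exact: differentiable_comp.
split=> //; rewrite !partialE// diff_comp//= deriv1E; last exact: ex_derive.
by rewrite derive1E derive_val mulrC.
Qed.

Lemma chain1_diff (F : R -> R) u x (a : R) : differentiable u x -> is_derive (u x) 1 F a ->
  differentiable (F \o u) x.
Proof.
move=> du dF; apply: differentiable_comp => //; apply/derivable1_diffP; exact: ex_derive.
Qed.

Lemma partial_coord i j : partial i (fun x : V => x 0 j) = fun=> (i == j)%:R.
Proof.
apply/funext => x; rewrite partialE; last exact: differentiable_coord.
have @f : {linear V -> R}.
  by exists (fun N : V => N 0 j); do 2![eexists]; do ?[constructor];
     rewrite ?mxE// => ? *; rewrite ?mxE//; move=> ?; rewrite !mxE.
rewrite (_ : (fun _ => _) = f) // diff_lin /f/= ?mxE ?eqxx/= 1?eq_sym//.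
exact: coord_continuous.
Qed.

Lemma Cn_coord n j : Cn n (fun x => x 0 j).
Proof.
case: n => [|n]; split; try by move=> x; exact: differentiable_coord.
  by [].
by move=> i; rewrite partial_coord; exact: Cn_cst.
Qed.

Lemma CnV n u : (forall x, u x != 0) -> Cn n u -> Cn n (fun x => (u x)^-1).
Proof.
move=> u0; have dV (du : forall x, differentiable u x) x : differentiable (fun x => (u x)^-1) x.
  exact: differentiableV.
elim: n u u0 dV => [|n IH] u u0 dV hu; case: (hu) => du hu'; split => //; try exact: dV.
move=> i; rewrite (_ : partial i _ = fun x => - ((u x)^-1 * (u x)^-1 * partial i u x)).
  have hn := CnW hu; have h' : Cn n (fun x => (u x)^-1) by apply: IH.
  by apply: CnN; apply: CnM; [exact: CnM|exact: hu'].
apply/funext => x; rewrite /partial deriveV//; last exact: diff_derivable.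
by rewrite -[LHS]/(_ * _) expr2 invfM mulNr.
Qed.

Lemma Cn_exp n u : Cn n u -> Cn n (fun x => expR (u x)).
Proof.
elim: n u => [|n IH] u hu; case: (hu) => du hu'; split => //;
  try by move=> x; exact: chain1_diff.
move=> i; rewrite (_ : partial i _ = fun x => expR (u x) * partial i u x).
  by apply: CnM; [apply: IH; exact: CnW|exact: hu'].
by apply/funext => x; have [] := chain1 i (du x) (is_derive_expR (u x)).
Qed.

Lemma Cn_ln n u : (forall x, 0 < u x) -> Cn n u -> Cn n (fun x => ln (u x)).
Proof.
move=> u0; elim: n u u0 => [|n IH] u u0 hu; case: (hu) => du hu'; split => //;
  try by move=> x; apply: chain1_diff => //; exact: is_derive1_ln.
move=> i; rewrite (_ : partial i _ = fun x => (u x)^-1 * partial i u x).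
  apply: CnM; last exact: hu'.
  apply: CnV; last exact: CnW.
  by move=> x; rewrite gt_eqF.
by apply/funext => x; have [] := chain1 i (du x) (is_derive1_ln (u0 x)).
Qed.

Lemma Cn_sqrt n u : (forall x, 0 < u x) -> Cn n u -> Cn n (fun x => Num.sqrt (u x)).
Proof.
move=> u0; elim: n u u0 => [|n IH] u u0 hu; case: (hu) => du hu'; split => //;
  try by move=> x; apply: chain1_diff => //; exact: is_derive1_sqrt.
move=> i; rewrite (_ : partial i _ = fun x => (2 * Num.sqrt (u x))^-1 * partial i u x).
  apply: CnM; last exact: hu'.
  apply: CnV.
    by move=> x; rewrite gt_eqF// mulr_gt0// sqrtr_gt0.
  by apply: CnZ; apply: IH => //; exact: CnW.
by apply/funext => x; have [] := chain1 i (du x) (is_derive1_sqrt (u0 x)).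
Qed.

Lemma Cn_dot n (F G : V -> V) : (forall i, Cn n (fun x => F x 0 i)) ->
  (forall i, Cn n (fun x => G x 0 i)) -> Cn n (fun x => dot (F x) (G x)).
Proof. by move=> hF hG; apply: Cn_sum => i; apply: CnM. Qed.

Lemma Cn_grad n u i : Cn n.+1 u -> Cn n (fun x => grad u x 0 i).
Proof.
move=> [_ h]; rewrite (_ : (fun x => _) = partial i u); first exact: h.
by apply/funext => x; rewrite mxE.
Qed.

Lemma differentiable_rV (psi : 'I_d -> V -> R) x : (forall j, differentiable (psi j) x) ->
  differentiable (fun y => \row_j psi j y) x /\
  forall h, 'd (fun y => \row_j psi j y : V) x h = \row_j 'd (psi j) x h.
Proof.
move=> dpsi.
have e : (fun y => \row_j psi j y : V) = \sum_(j < d) (fun y => psi j y *: delta_mx 0 j).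
  rewrite funeqE => y; rewrite fct_sumE [LHS]row_sum_delta.
  by apply: eq_bigr => j _; rewrite mxE.
have dP : differentiable (fun y => \row_j psi j y : V) x.
  by rewrite e; apply: differentiable_sum => j; exact: differentiableZl.
split => // h; apply/rowP => j; rewrite mxE.
have -> : psi j = (fun z : V => z 0 j) \o (fun y => \row_j psi j y).
  by apply/funext => y /=; rewrite mxE.
rewrite diff_comp//=; last exact: differentiable_coord.
have @f : {linear V -> R}.
  by exists (fun N : V => N 0 j); do 2![eexists]; do ?[constructor];
     rewrite ?mxE// => ? *; rewrite ?mxE//; move=> ?; rewrite !mxE.
rewrite (_ : (fun _ => _) = f) // diff_lin//.
exact: coord_continuous.
Qed.

(** Induction on n: a partial derivative of the composite is a sum of products of
    partial derivatives of u, composed with psi, and partial derivatives of psi. *)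
Lemma Cn_comp n u (psi : 'I_d -> V -> R) : Cn n u -> (forall j, Cn n (psi j)) ->
  Cn n (fun x => u (\row_j psi j x)).
Proof.
elim: n u psi => [|n IH] u psi hu hp; case: (hu) => du hu';
  have dp j x := Cn_diff x (hp j);
  have dP x := differentiable_rV (dp^~ x); split => //;
  try by move=> x; apply: (@differentiable_comp _ _ _ _ (fun x => \row_j psi j x)) => //;
         case: (dP x).
move=> i.
rewrite (_ : partial i _ = fun x => \sum_j
    (partial j u (\row_j psi j x)) * partial i (psi j) x).
  apply: Cn_sum => j; apply: CnM; last by have [_ h] := hp j; exact: h.
  by apply: IH => [|k]; [exact: hu'|exact: CnW].
apply/funext => x; have [dPx dPE] := dP x.
rewrite partialE; last exact: (@differentiable_comp _ _ _ _ (fun x => \row_j psi j x)).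
rewrite -[(fun x : V => _)]/(u \o (fun x => \row_j psi j x)) diff_comp//= dPE diff_grad//.
by apply: eq_bigr => j _; rewrite !mxE [partial i _ _]partialE.
Qed.

End smooth_calculus.

(** * Test functions and cutoffs *)

Section flat_exp.
Context (R : realType).

(** t ^- k * exp (- 1 / t), extended by 0: the derivative of one of these functions
    is a combination of two others, so that exp (- 1 / t) is smooth at 0. *)
Definition flat (k : nat) (t : R) : R :=
  if 0 < t then t^-1 ^+ k * expR (- t^-1) else 0.

Lemma flat_bound k (t : R) : 0 <= flat k t <= (k.+2`!%:R) * t ^+ 2.
Proof.
rewrite /flat; case: ifPn => [t0|_]; last first.
  by rewrite lexx mulr_ge0 ?sqr_ge0.
have s0 : 0 < t^-1 by rewrite invr_gt0.
apply/andP; split; first by rewrite mulr_ge0 ?expR_ge0// exprn_ge0// ltW.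
rewrite expRN ler_pdivrMr ?expR_gt0//.
have := expR_ge1Dxn k.+1 (ltW s0); rewrite -lerBrDl ler_pdivrMr ?ltr0n ?fact_gt0// => h.
have {}h : t^-1 ^+ k.+2 <= expR t^-1 * (k.+2`!)%:R.
  by apply: le_trans h _; rewrite ler_wpM2r// gerBl.
have t2 : 0 < t ^+ 2 by rewrite exprn_gt0.
rewrite mulrAC [leRHS]mulrC [X in _ * X]mulrC.
rewrite -ler_pdivrMl// -exprVn -exprD; exact: h.
Qed.

Lemma is_derive_sq (F : R -> R) (x a C : R) :
  (forall h, `|F (x + h) - F x - a * h| <= C * h ^+ 2) -> is_derive x 1 F a.
Proof.
move=> hF.
have C0 : 0 <= C by have := le_trans (normr_ge0 _) (hF 1); rewrite expr1n mulr1.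
have cv : h^-1 *: ((F \o shift x) (h *: (1 : R)) - F x) @[h --> (0:R)^'] --> a.
  apply/cvgrPdist_le => e e0; near=> h.
  have h0 : h != 0 by near: h; exact: nbhs_dnbhs_neq.
  have -> : a - h^-1 *: ((F \o shift x) (h *: (1 : R)) - F x) =
     - h^-1 * (F (x + h) - F x - a * h).
    rewrite /shift/= (_ : h *: (1:R) + x = x + h); last by rewrite addrC [_ *: _]mulr1.
    by rewrite -[h^-1 *: _]/(h^-1 * _); field.
  rewrite normrM normrN normfV ler_pdivrMl ?normr_gt0//.
  apply: le_trans (hF h) _.
  rewrite -(real_normK (num_real h)).
  suff : C * `|h| <= e by have := normr_ge0 h; nra.
  apply: (@le_trans _ _ (`|h| * (C + 1))); first by have := normr_ge0 h; nra.
  rewrite -ler_pdivlMr; last by rewrite ltr_wpDl.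
  near: h; apply: (@dnbhs0_le R R^o); by rewrite divr_gt0// ltr_wpDl.
by apply: DeriveDef; [apply/cvg_ex; exists a|apply: cvg_lim].
Unshelve. all: by end_near. Qed.

Lemma is_derive_flat k (t : R) :
  is_derive t 1 (flat k) (flat k.+2 t - k%:R * flat k.+1 t).
Proof.
have [t0|t0|->] := ltgtP t 0.
- have -> : flat k.+2 t - k%:R * flat k.+1 t = 0.
    by rewrite /flat !ifF ?mulr0 ?subr0//; apply/negbTE; rewrite -leNgt ltW.
  apply: (@near_eq_is_derive _ _ _ (cst 0)) => //.
    by near=> s; rewrite /flat ifF//; apply/negbTE; rewrite -leNgt ltW//; near: s; exact: (open_nbhs_nbhs (conj (@open_lt _ 0) t0)).
- apply: (@near_eq_is_derive _ _ _ (fun s : R => s^-1 ^+ k * expR (- s^-1) : R)) => //.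
    by near=> s; rewrite /flat ifT//; near: s; exact: (open_nbhs_nbhs (conj (@open_gt _ 0) t0)).
  have t1 : t != 0 by rewrite gt_eqF.
  have dV : is_derive t 1 (fun s : R => s^-1) (- t ^- 2).
    apply: DeriveDef; first exact: derivableV.
    by rewrite deriveV// derive_id /GRing.scale/= mulr1.
  have dN := is_deriveN dV.
  have dE : is_derive t 1 (expR \o (- (fun s : R => s^-1))) (t ^- 2 * expR (- t^-1)).
    by apply: is_derive_eq; rewrite /GRing.scale/= opprK mulrC.
  have dX := is_deriveX k dV.
  rewrite (_ : (fun s => _) = (fun s : R => s^-1) ^+ k * (expR \o (- (fun s : R => s^-1)))); last first.
    by apply/funext => s; rewrite [RHS]/GRing.mul/= exprfctE.
  have := is_deriveM dX dE.
  move=> h; apply: (is_derive_eq h) => {h}.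
  rewrite /flat t0 /GRing.scale/= {dX dE dN dV}.
  case: k => [|k]; first by rewrite /= !mul0r !mulr0 subr0 addr0; rewrite expr0 mul1r exprVn.
  rewrite /=; rewrite -[in RHS]natr1.
  rewrite !exprfctE !exprVn !exprS. by field; rewrite t1 expf_neq0.
- have -> : flat k.+2 0 - k%:R * flat k.+1 0 = 0.
    by rewrite /flat ltxx mulr0 subr0.
  apply: (@is_derive_sq _ _ _ (k.+2`!%:R)) => h.
  rewrite add0r mul0r subr0 [flat k 0]/flat ltxx subr0.
  by have /andP[h0 h1] := flat_bound k h; rewrite ger0_norm.
Unshelve. all: by end_near. Qed.

Definition sstep (t : R) : R := flat 0 t / (flat 0 t + flat 0 (1 - t)).

Lemma flat0_gt0 t : 0 < t -> 0 < flat 0 t.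
Proof. by move=> t0; rewrite /flat t0 expr0 mul1r expR_gt0. Qed.

Lemma flat0_ge0 t : 0 <= flat 0 t.
Proof. by case/andP: (flat_bound 0 t). Qed.

Lemma sstep_den_gt0 t : 0 < flat 0 t + flat 0 (1 - t).
Proof.
have [t0|t0] := ltP 0 t; first by rewrite ltr_pwDl ?flat0_ge0 ?flat0_gt0.
by rewrite ltr_wpDl ?flat0_ge0// flat0_gt0//; lra.
Qed.

Lemma sstep_le0 t : t <= 0 -> sstep t = 0.
Proof. by move=> t0; rewrite /sstep {1}/flat ltNge t0 mul0r. Qed.

Lemma sstep_ge1 t : 1 <= t -> sstep t = 1.
Proof.
move=> t1; have t0 : 0 < flat 0 t by apply: flat0_gt0; lra.
rewrite /sstep [X in _ + X]/flat ltNge (_ : 1 - t <= 0) /=; last lra.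
by rewrite addr0 divff// gt_eqF.
Qed.

Lemma sstep_ge0 t : 0 <= sstep t.
Proof. by rewrite divr_ge0 ?flat0_ge0// ltW// sstep_den_gt0. Qed.

Lemma sstep_le1 t : sstep t <= 1.
Proof. by rewrite ler_pdivrMr ?sstep_den_gt0// mul1r lerDl flat0_ge0. Qed.

End flat_exp.

Section test_functions.
Context (R : realType) (d : nat).
Local Notation V := 'rV[R]_d.
Implicit Types (u v w : V -> R) (x y : V).

Lemma Cn_flat n k u : Cn n u -> Cn n (fun x => flat k (u x)).
Proof.
elim: n k u => [|n IH] k u hu; case: (hu) => du hu'; split => //;
  try by move=> x; apply: chain1_diff => //; exact: is_derive_flat.
move=> i; rewrite (_ : partial i _ = fun x =>
   (flat k.+2 (u x) - k%:R * flat k.+1 (u x)) * partial i u x).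
  apply: CnM; last exact: hu'.
  have h := CnW hu; apply: CnB; first exact: IH.
  by apply: CnZ; exact: IH.
by apply/funext => x; have [] := chain1 i (du x) (is_derive_flat k (u x)).
Qed.

Lemma Cn_sstep n u : Cn n u -> Cn n (fun x => sstep (u x)).
Proof.
move=> hu; apply: CnM; first exact: Cn_flat.
apply: CnV => [x|]; first by rewrite gt_eqF// sstep_den_gt0.
apply: CnD; apply: Cn_flat => //; apply: CnB => //; exact: Cn_cst.
Qed.

Lemma continuous_grad_coord u i : smooth u -> continuous (fun x => grad u x 0 i).
Proof.
move=> su; rewrite (_ : (fun x => _) = partial i u).
  by move=> x; apply/differentiable_continuous/smooth_diff/smooth_partial.
by apply/funext => x; rewrite mxE.
Qed.

Lemma derive_line u y (w : V) (t : R) : differentiable u (t *: w + y) ->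
  is_derive t 1 (fun s : R => u (s *: w + y)) (dot (grad u (t *: w + y)) w).
Proof.
move=> du; have dw : derivable u (t *: w + y) w by exact: diff_derivable.
have e : (fun h : R => h^-1 *: (((fun s : R => u (s *: w + y)) \o shift t) (h *: (1:R)) - u (t *: w + y)))
   = (fun h : R => h^-1 *: ((u \o shift (t *: w + y)) (h *: w) - u (t *: w + y))).
  by apply/funext => h /=; rewrite /shift/= addrA -scalerDl [h *: (1:R)]mulr1.
apply: DeriveDef; first by rewrite /derivable e.
by rewrite /derive e -/(derive _ _ _) deriveE// diff_grad.
Qed.

Lemma grad_lipschitz k u : (forall x, differentiable u x) ->
  (forall x, enorm (grad u x) <= k) -> k_lipschitz k u.
Proof.
move=> du hk x y; pose w := x - y.
have hd (t : R) : is_derive t 1 (fun s : R => u (s *: w + y)) (dot (grad u (t *: w + y)) w).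
  exact: derive_line.
have [|c _] := @MVT R (fun s : R => u (s *: w + y)) _ 0 1 ltr01 (fun t _ => hd t).
  apply: continuous_subspaceT => t; apply/differentiable_continuous/derivable1_diffP.
  exact: ex_derive.
rewrite scale1r scale0r add0r subrK subr0 mulr1 => ->.
by apply: le_trans (norm_dot_le _ _) _; apply: ler_wpM2r; [exact: enorm_ge0|exact: hk].
Qed.

Lemma dirderiv u x (w : V) : differentiable u x ->
  (u (x + h *: w) - u x) / h @[h --> (0:R)^'] --> dot (grad u x) w.
Proof.
move=> du; rewrite -diff_grad// -deriveE//.
rewrite (_ : (fun h => _) = (fun h : R => h^-1 *: ((u \o shift x) (h *: w) - u x))).
  by have dw : derivable u x w by exact: diff_derivable.
by apply/funext => h; rewrite /= /shift/= (addrC x) mulrC.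
Qed.

Lemma lipschitz_grad k u x : 0 <= k -> differentiable u x -> k_lipschitz k u ->
  enorm (grad u x) <= k.
Proof.
move=> k0 du ku; set g := grad u x.
have h : dot g g <= k * enorm g.
  apply: (cvgr_to_le (dirderiv (w := g) du)); near=> h.
  have h0 : h != 0 by near: h; exact: nbhs_dnbhs_neq.
  apply: le_trans (ler_norm _) _; rewrite normrM normfV ler_pdivrMr ?normr_gt0//.
  by apply: le_trans (ku _ _) _; rewrite addrAC subrr add0r enormZ mulrCA mulrC.
have [->//|g0] := eqVneq (enorm g) 0.
have gp : 0 < enorm g by rewrite lt_def g0 enorm_ge0.
by move: h; rewrite -sqr_enorm expr2 ler_pM2r.
Unshelve. all: by end_near. Qed.

Definition eball (r : R) : set V := [set x | enorm x <= r].

Lemma closed_eball r : closed (eball r).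
Proof.
have := @closed_comp _ _ (@enorm R d) [set t : R | t <= r] (fun x _ => @continuous_enorm R d x).
by apply; exact: closed_le.
Qed.

Lemma compact_eball r : compact (eball r).
Proof.
apply: bounded_closed_compact; last exact: closed_eball.
exists r; split; first exact: num_real.
by move=> M rM x /= xr; apply: le_trans (norm_le_enorm _) (le_trans xr (ltW rM)).
Qed.

Lemma bounded_eball u r : continuous u -> exists2 M, 0 < M & forall x, enorm x <= r -> `|u x| <= M.
Proof.
move=> cu; have : compact (u @` eball r).
  by apply: continuous_compact (@compact_eball r); exact: continuous_subspaceT.
move=> /(@compact_bounded R R^o) [M [_ hM]].
exists (`|M| + 1); first by rewrite ltr_wpDl.
move=> x xr; apply: (hM (`|M| + 1)); first by rewrite ltr_pwDr// ler_norm.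
by exists x.
Qed.

Definition supp_in (r : R) u := forall x, r < enorm x -> u x = 0.

Lemma test_functionP u : test_function u <-> smooth u /\ exists2 r, 0 < r & supp_in r u.
Proof.
split=> -[su]; last first.
  move=> [r r0 hr]; split => //.
  apply: (@subclosed_compact _ _ (eball r)); [exact: closed_closure|exact: compact_eball|].
  have -> : eball r = closure (eball r) by apply/closure_id; exact: closed_eball.
  apply: closure_subset => x /= ux; rewrite /eball/= leNgt; apply/negP => /hr u0.
  by rewrite u0 eqxx in ux.
move=> /compact_bounded[M [_ hM]]; split=> //.
exists (d%:R * (`|M| + 1) + 1); first by rewrite ltr_wpDl// mulr_ge0// addr_ge0.
move=> x hx; apply/eqP/negPn/negP => ux.
have /hM h : M < `|M| + 1 by rewrite ltr_pwDr// ler_norm.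
have := h x (@subset_closure _ [set x : V | u x != 0] x ux).
apply/negP; rewrite -ltNge.
have [d0|d0] := posnP d.
  have dr0 : d%:R = 0 :> R by rewrite d0.
  have := lt_le_trans hx (enorm_le_norm x).
  by rewrite dr0 !mul0r add0r ltr10.
have dR : 0 < d%:R :> R by rewrite ltr0n.
rewrite -(ltr_pM2l dR); apply: lt_le_trans (enorm_le_norm x).
by apply: lt_trans hx; rewrite ltrDl.
Qed.

Lemma supp_grad r u : supp_in r u -> forall x, r < enorm x -> grad u x = 0.
Proof.
move=> hr x rx; apply/rowP => i; rewrite !mxE /partial.
rewrite (@near_eq_derive _ _ _ u (cst 0)) ?derive_cst//.
have o : open [set y : V | r < enorm y].
  apply: (@open_comp _ _ (@enorm R d) [set t : R | r < t]); last exact: open_gt.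
  by move=> y _; exact: continuous_enorm.
by apply: filterS (open_nbhs_nbhs (conj o rx)) => y /= /hr.
Qed.

Lemma test_bounded u : test_function u -> exists2 M, 0 < M & forall x, `|u x| <= M.
Proof.
move=> /test_functionP[su [r r0 hr]].
have [|M M0 hM] := @bounded_eball u r.
  by move=> x; apply/differentiable_continuous/smooth_diff.
exists M => // x; have [xr|xr] := leP (enorm x) r; first exact: hM.
by rewrite hr// normr0 ltW.
Qed.

Lemma test_lipschitz u : test_function u -> exists2 k, 0 < k & k_lipschitz k u.
Proof.
move=> /test_functionP[su [r r0 hr]].
have /choice[M hM] : forall i : 'I_d, exists M, 0 < M /\ forall x, enorm x <= r -> `|grad u x 0 i| <= M.
  by move=> i; have [M ? ?] := @bounded_eball (fun x => grad u x 0 i) r (continuous_grad_coord (i:=i) su); exists M.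
have S0 : 0 <= \sum_i M i by apply: sumr_ge0 => i _; rewrite ltW//; case: (hM i).
exists (1 + \sum_i M i); first by rewrite ltr_pwDl.
apply: grad_lipschitz => x; first exact: smooth_diff.
have [xr|xr] := leP (enorm x) r; last by rewrite (supp_grad hr xr) enorm0 addr_ge0.
apply: le_trans (enorm_le_sum _) _.
by apply: ler_wpDl => //; apply: ler_sum => i _; case: (hM i) => _; apply.
Qed.

Lemma smoothD u v : smooth u -> smooth v -> smooth (fun x => u x + v x).
Proof. by move=> su sv; apply: (smoothP _).2 => n; apply: CnD; apply: (smoothP _).1. Qed.

Lemma smoothM u v : smooth u -> smooth v -> smooth (fun x => u x * v x).
Proof. by move=> su sv; apply: (smoothP _).2 => n; apply: CnM; apply: (smoothP _).1. Qed.

Lemma smoothZ a u : smooth u -> smooth (fun x => a * u x).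
Proof. by move=> su; apply: (smoothP _).2 => n; apply: CnZ; apply: (smoothP _).1. Qed.

Lemma test_functionD u v : test_function u -> test_function v -> test_function (fun x => u x + v x).
Proof.
move=> /test_functionP[su [r r0 hr]] /test_functionP[sv [s s0 hs]].
apply/test_functionP; split; first exact: smoothD.
exists (Num.max r s); first by rewrite lt_max r0.
by move=> x; rewrite gt_max => /andP[/hr -> /hs ->]; rewrite addr0.
Qed.

Lemma test_functionMl u v : smooth u -> test_function v -> test_function (fun x => u x * v x).
Proof.
move=> su /test_functionP[sv [s s0 hs]].
apply/test_functionP; split; first exact: smoothM.
by exists s => // x /hs ->; rewrite mulr0.
Qed.

Lemma test_functionZ a v : test_function v -> test_function (fun x => a * v x).
Proof.
move=> /test_functionP[sv [s s0 hs]].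
apply/test_functionP; split; first exact: smoothZ.
by exists s => // x /hs ->; rewrite mulr0.
Qed.

Lemma test_function0 : test_function (fun _ : V => 0 : R).
Proof.
apply/test_functionP; split; first by apply: (smoothP _).2 => n; exact: Cn_cst.
by exists 1.
Qed.

Lemma gradD u v x : differentiable u x -> differentiable v x ->
  grad (fun x => u x + v x) x = grad u x + grad v x.
Proof.
move=> du dv; apply/rowP => i; rewrite !mxE.
by rewrite /partial -[LHS]/('D_(delta_mx 0 i) (u + v) x) deriveD//; exact: diff_derivable.
Qed.

Lemma gradM u v x : differentiable u x -> differentiable v x ->
  grad (fun x => u x * v x) x = u x *: grad v x + v x *: grad u x.
Proof.
move=> du dv; apply/rowP => i; rewrite !mxE.
by rewrite /partial -[LHS]/('D_(delta_mx 0 i) (u * v) x) deriveM//; exact: diff_derivable.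
Qed.

Lemma grad_cst (a : R) x : grad (fun _ : V => a) x = 0.
Proof. by apply/rowP => i; rewrite !mxE partial_cst. Qed.

Lemma gradZ a u x : differentiable u x -> grad (fun x => a * u x) x = a *: grad u x.
Proof.
move=> du; have dc : differentiable (fun _ : V => a) x by apply: (@Cn_diff _ _ 0); exact: Cn_cst.
rewrite (@gradM (fun=> a) u)//.
by rewrite grad_cst scaler0 addr0.
Qed.

Definition cutoff1 x := sstep (2 - dot x x).
Definition cutoff (r : R) x := cutoff1 (r^-1 *: x).

Lemma cutoff_smooth r : smooth (cutoff r).
Proof.
apply: (smoothP _).2 => n; apply: Cn_sstep; apply: CnB; first exact: Cn_cst.
have h i : Cn n (fun x : V => (r^-1 *: x) 0 i).
  rewrite (_ : (fun x : V => _) = (fun x : V => r^-1 * x 0 i)).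
    by apply: CnZ; exact: Cn_coord.
  by apply/funext => x; rewrite mxE.
exact: Cn_dot.
Qed.

Lemma cutoff_eq0 r x : 0 < r -> 2 * r <= enorm x -> cutoff r x = 0.
Proof.
move=> r0 rx; apply: sstep_le0; rewrite -sqr_enorm enormZ gtr0_norm ?invr_gt0//.
have h : 2 <= r^-1 * enorm x by rewrite ler_pdivlMl// mulrC.
by nra.
Qed.

Lemma cutoff_eq1 r x : 0 < r -> enorm x <= r -> cutoff r x = 1.
Proof.
move=> r0 rx; apply: sstep_ge1; rewrite -sqr_enorm enormZ gtr0_norm ?invr_gt0//.
suff : (r^-1 * enorm x) ^+ 2 <= 1 by lra.
have h : r^-1 * enorm x <= 1 by rewrite ler_pdivrMl// mulr1.
have : 0 <= r^-1 * enorm x by apply: mulr_ge0; rewrite ?enorm_ge0// invr_ge0 ltW.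
by nra.
Qed.

Lemma cutoff_test r : 0 < r -> test_function (cutoff r).
Proof.
move=> r0; apply/test_functionP; split; first exact: cutoff_smooth.
exists (2 * r); first by rewrite mulr_gt0.
by move=> x rx; apply: cutoff_eq0 => //; exact: ltW.
Qed.

Lemma cutoff_ge0 r x : 0 <= cutoff r x. Proof. exact: sstep_ge0. Qed.
Lemma cutoff_le1 r x : cutoff r x <= 1. Proof. exact: sstep_le1. Qed.

(** The constant decays like 1 / r: cutting off a function of linear growth costs
    only a bounded factor in its Lipschitz constant. *)
Lemma cutoff_lipschitz : exists2 k, 0 < k & forall r, 0 < r -> k_lipschitz (k / r) (cutoff r).
Proof.
have [k k0 hk] := test_lipschitz (cutoff_test ltr01).
exists k => // r r0 x y; have := hk (r^-1 *: x) (r^-1 *: y).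
by rewrite /cutoff invr1 !scale1r -scalerBr enormZ (@gtr0_norm _ r^-1) ?invr_gt0// mulrA.
Qed.

End test_functions.

(** * Borel measurability and integration of real functions *)

Section borel.
Context (R : realType) (d : nat).
Local Notation V := 'rV[R]_d.
Local Notation B := (borel R d).

Lemma open_borel (A : set V) : open A -> measurable (A : set B).
Proof. exact: sub_sigma_algebra. Qed.

Lemma closed_borel (A : set V) : closed A -> measurable (A : set B).
Proof.
move=> cA; rewrite -[A]setCK; apply: measurableC; apply: open_borel.
exact: closed_openC.
Qed.

Lemma eball_borel r : measurable (eball r : set B).
Proof. by apply: closed_borel; exact: closed_eball. Qed.

Lemma continuous_borel (u : V -> R) : continuous u -> measurable_fun setT (u : B -> R).
Proof.
move=> /continuousP cu; apply: (measurability _ (RGenOpens.measurableE R)).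
move=> _ [_ [a [b ->] <-]]; rewrite setTI; apply: open_borel; apply: cu.
exact: interval_open.
Qed.

Lemma rat_dense (x : V) (e : R) : 0 < e ->
  exists q : 'rV[rat]_d, forall i, `|x 0 i - ratr (q 0 i)| < e.
Proof.
move=> e0.
have /choice[q hq] : forall i : 'I_d, exists q : rat, `|x 0 i - ratr q| < e.
  move=> i; have [|q] := @rat_in_itvoo R (x 0 i - e) (x 0 i + e).
    by rewrite ltrD2l gtrN.
  rewrite in_itv/= => /andP[h1 h2]; exists q.
  by rewrite ltr_norml; apply/andP; split; lra.
by exists (\row_i q i) => i; rewrite mxE.
Qed.

Definition rbox (p : 'rV[rat]_d * nat) : set V :=
  [set y | forall i, `|y 0 i - ratr (p.1 0 i)| < p.2.+1%:R^-1].

Lemma open_rbox (A : set V) : open A ->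
  A = \bigcup_(p in [set p | rbox p `<=` A]) rbox p.
Proof.
move=> oA; apply/seteqP; split=> [x Ax|x [p pA xp]]; last exact: pA.
have := open_nbhs_nbhs (conj oA Ax) => /nbhs_ballP[e /= e0 he].
have [n hn] : exists n : nat, n.+1%:R^-1 < e / 2.
  exists (Num.truncn (e / 2)^-1); rewrite invf_plt ?posrE ?divr_gt0//.
  exact: truncnS_gt.
have [q hq] := @rat_dense x n.+1%:R^-1 ltac:(by rewrite invr_gt0).
exists (q, n) => // y /= hy; apply: he; rewrite -ball_normE /=.
apply: (@le_lt_trans _ _ (n.+1%:R^-1 + n.+1%:R^-1)); last by rewrite [ltRHS]splitr ltrD.
rewrite /Num.norm/= mx_normrE; apply/bigmax_leP; split.
  by rewrite addr_ge0.
move=> [i j] _ /=; rewrite ord1 !mxE -(subrKA (ratr (q 0 j))).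
by apply: le_trans (ler_normD _ _) _; rewrite lerD// ?ltW// 1?distrC ?hy.
Qed.

(** The preimage of an open set is a countable union of preimages of rational
    boxes, which are described by the coordinates. *)
Lemma measurable_rV d0 (T0 : measurableType d0) (F : T0 -> V) :
  (forall i, measurable_fun setT (fun x => F x 0 i)) ->
  measurable_fun setT (F : T0 -> B).
Proof.
move=> mF; apply: (@measurability _ _ T0 B setT F (@open V)) => //.
move=> _ [A oA <-]; rewrite setTI.
rewrite (open_rbox oA) preimage_bigcup bigcup_mkcond; apply: countable_bigcupT_measurable.
  exact: countableP.
move=> [q n]; case: ifP => // _; rewrite (_ : _ @^-1` _ =
    \bigcap_(i in [set: 'I_d]) [set x | `|F x 0 i - ratr (q 0 i)| < n.+1%:R^-1]).
  apply: fin_bigcap_measurable => // i _.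
  rewrite -[X in measurable X]setTI; apply: (measurable_fun_ltr _ _ measurableT (Y := [set true])) => //.
  - apply: measurableT_comp => //; apply: measurable_funB => //.
by apply/seteqP; split=> x /= h i => [_|]; exact: h.
Qed.

End borel.

Section ae_integral.
Context d0 (T : measurableType d0) (R : realType) (mu : {measure set T -> \bar R}).
Import HBNNSimple.

(** A simple function below f, set to 0 on the null set where f and g differ, lies
    below g and keeps its integral.  This covers nonmeasurable functions, such as
    those built from a bundle that is Borel up to a null set. *)
Lemma ae_le_ge0_integral (f g : T -> \bar R) : (forall x, 0 <= f x)%E -> (forall x, 0 <= g x)%E ->
  {ae mu, forall x, f x = g x} -> (\int[mu]_x f x <= \int[mu]_x g x)%E.
Proof.
move=> f0 g0 [N [mN N0 hN]]; rewrite !ge0_integralTE//.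
apply: ge_ereal_sup => _ [h /= hf <-].
pose h' := proj_nnsfun h (measurableC mN).
apply: (@le_trans _ _ (sintegral mu h')).
  rewrite -!integralT_nnsfun; rewrite le_eqVlt; apply/orP; left; apply/eqP.
  apply: ge0_ae_eq_integral => //.
  - exact/measurable_EFinP.
  - exact/measurable_EFinP.
  - by move=> x _; rewrite lee_fin.
  - by move=> x _; rewrite lee_fin.
  exists N; split => // x /= hx; apply: contrapT => Nx; apply: hx => _.
  by rewrite mindicE mem_set// mulr1.
apply: ereal_sup_ubound; exists h' => // x /=.
rewrite mindicE; case: (pselect (N x)) => Nx.
  by rewrite memNset ?mulr0//= => /(_ Nx).
rewrite mem_set// mulr1; apply: le_trans (hf x) _.
suff -> : f x = g x by [].
by apply: contrapT => fg; apply: Nx; exact: hN.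
Qed.

Lemma ae_eqC (T' : Type) (f g : T -> T') : {ae mu, forall x, f x = g x} -> {ae mu, forall x, g x = f x}.
Proof. by apply: filterS => x ->. Qed.

Lemma ae_eq_ge0_integral (f g : T -> \bar R) : (forall x, 0 <= f x)%E -> (forall x, 0 <= g x)%E ->
  {ae mu, forall x, f x = g x} -> (\int[mu]_x f x = \int[mu]_x g x)%E.
Proof.
move=> f0 g0 fg; apply/eqP; rewrite eq_le; apply/andP; split; apply: ae_le_ge0_integral => //.
exact: ae_eqC.
Qed.

Lemma ae_eq_integral_nm (f g : T -> \bar R) :
  {ae mu, forall x, f x = g x} -> (\int[mu]_x f x = \int[mu]_x g x)%E.
Proof.
move=> fg; rewrite integralE [RHS]integralE; congr (_ - _)%E;
  apply: ae_eq_ge0_integral => //; apply: filterS fg => x fg.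
  by rewrite !funepos.unlock fg.
by rewrite !funeneg.unlock fg.
Qed.

Lemma ae_eq_Rintegral (f g : T -> R) :
  {ae mu, forall x, f x = g x} -> \int[mu]_x f x = \int[mu]_x g x.
Proof.
by move=> fg; congr fine; apply: ae_eq_integral_nm; apply: filterS fg => x ->.
Qed.

End ae_integral.

Section real_integral.
Context d0 (T : measurableType d0) (R : realType) (mu : {measure set T -> \bar R}).
Implicit Types f g : T -> R.

Definition L1 f := mu.-integrable setT (EFin \o f).

Lemma L1_measurable f : L1 f -> measurable_fun setT f.
Proof. by move=> /measurable_int /measurable_EFinP. Qed.

Lemma L1_dom f g : measurable_fun setT f -> (forall x, `|f x| <= g x) -> L1 g -> L1 f.
Proof.
move=> mf fg; apply: le_integrable => //; first exact/measurable_EFinP.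
move=> x _ /=; rewrite lee_fin; exact: le_trans (fg x) (ler_norm _).
Qed.

Lemma L1D f g : L1 f -> L1 g -> L1 (fun x => f x + g x).
Proof. by move=> hf hg; exact: (integrableD measurableT hf hg). Qed.

Lemma L1Z a f : L1 f -> L1 (fun x => a * f x).
Proof. by move=> hf; exact: (integrableZl measurableT a hf). Qed.

Lemma L1B f g : L1 f -> L1 g -> L1 (fun x => f x - g x).
Proof. by move=> hf hg; exact: (integrableB measurableT hf hg). Qed.

Lemma L1_norm f : L1 f -> L1 (fun x => `|f x|).
Proof. by move=> hf; exact: (integrable_norm hf). Qed.

Lemma L1_0 : L1 (fun=> 0).
Proof. exact: integrable0. Qed.

Lemma L1_sum (I : Type) (r : seq I) (F : I -> T -> R) : (forall i, L1 (F i)) ->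
  L1 (fun x => \sum_(i <- r) F i x).
Proof.
move=> h; elim: r => [|i r IH].
  by rewrite (_ : (fun x => _) = fun=> 0); [exact: L1_0|apply/funext => x; rewrite big_nil].
rewrite (_ : (fun x => _) = fun x => F i x + \sum_(i <- r) F i x); first exact: L1D.
by apply/funext => x; rewrite big_cons.
Qed.

Lemma IntD f g : L1 f -> L1 g -> \int[mu]_x (f x + g x) = \int[mu]_x f x + \int[mu]_x g x.
Proof. exact: RintegralD. Qed.

Lemma IntB f g : L1 f -> L1 g -> \int[mu]_x (f x - g x) = \int[mu]_x f x - \int[mu]_x g x.
Proof. exact: RintegralB. Qed.

Lemma IntZ a f : L1 f -> \int[mu]_x (a * f x) = a * \int[mu]_x f x.
Proof. exact: RintegralZl. Qed.

Lemma le_Int f g : L1 f -> L1 g -> (forall x, f x <= g x) -> \int[mu]_x f x <= \int[mu]_x g x.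
Proof. by move=> hf hg fg; apply: le_Rintegral. Qed.

Lemma Int_ge0 f : (forall x, 0 <= f x) -> 0 <= \int[mu]_x f x.
Proof. by move=> f0; apply: Rintegral_ge0. Qed.

Lemma norm_Int f : L1 f -> `|\int[mu]_x f x| <= \int[mu]_x `|f x|.
Proof. exact: le_normr_Rintegral. Qed.

Lemma norm_Int_le f g : L1 f -> L1 g -> (forall x, `|f x| <= g x) -> `|\int[mu]_x f x| <= \int[mu]_x g x.
Proof.
by move=> hf hg fg; apply: le_trans (norm_Int hf) _; apply: le_Int => //; exact: L1_norm.
Qed.

Lemma EFin_Int f : L1 f -> (\int[mu]_x (f x)%:E)%E = (\int[mu]_x f x)%:E.
Proof. by move=> hf; rewrite /Rintegral fineK//; exact: integrable_fin_num. Qed.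

Lemma Int_cvg (f_ : nat -> T -> R) f g : (forall n, measurable_fun setT (f_ n)) ->
  (forall x, f_ n x @[n --> \oo] --> f x) -> L1 g -> (forall n x, `|f_ n x| <= g x) ->
  \int[mu]_x f_ n x @[n --> \oo] --> \int[mu]_x f x.
Proof.
move=> mf cf g1 fg.
have mf' : measurable_fun setT f by apply: (measurable_fun_cvg mf) => x _; exact: cf.
have fg' x : `|f x| <= g x.
  apply: (cvgr_to_le (cvg_norm (cf x))); near=> n; exact: fg.
have Lf n : L1 (f_ n) by apply: L1_dom g1.
have Lf' : L1 f by apply: L1_dom g1.
have : (\int[mu]_x (f_ n x)%:E)%E @[n --> \oo] --> (\int[mu]_x (f x)%:E)%E.
  apply: (@dominated_cvg _ _ _ mu setT measurableT (fun n x => (f_ n x)%:E) _ (EFin \o g)) => //.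
  - by move=> n; exact/measurable_EFinP.
  - by move=> x _; apply: cvg_EFin; [near=> n|exact: cf].
  - by move=> n x _; rewrite lee_fin.
rewrite EFin_Int//; under eq_fun do rewrite EFin_Int//.
by move/fine_cvg.
Unshelve. all: by end_near. Qed.

End real_integral.

(** * Integrable vector fields and difference quotients *)

Section fields.
Context (R : realType) (d : nat).
Local Notation V := 'rV[R]_d.
Local Notation B := (borel R d).
Variable mu : {measure set B -> \bar R}.
Implicit Types (sigma tau F G : V -> V) (u v : V -> R).
Local Notation L1 := (L1 mu).

Definition mvec F := forall i, measurable_fun setT (fun x : B => F x 0 i).

Lemma mvec_comp F u : mvec F -> continuous u -> measurable_fun setT (fun x : B => u (F x)).
Proof.
move=> mF cu; apply: (@measurableT_comp _ _ _ B B R (u : B -> R) setT (F : B -> B)).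
  exact: continuous_borel.
exact: measurable_rV.
Qed.

Lemma mvec_id : mvec id.
Proof.
move=> i; apply: continuous_borel => x; exact: coord_continuous.
Qed.

Lemma mvecD F G : mvec F -> mvec G -> mvec (fun x => F x + G x).
Proof.
move=> mF mG i; under eq_fun do rewrite mxE; exact: measurable_funD.
Qed.

Lemma mvecMZ (f : V -> R) F : measurable_fun setT (f : B -> R) -> mvec F -> mvec (fun x => f x *: F x).
Proof.
by move=> mf mF i; under eq_fun do rewrite mxE; exact: measurable_funM.
Qed.

Lemma mvecZ a F : mvec F -> mvec (fun x => a *: F x).
Proof. by move=> mF; apply: mvecMZ. Qed.

Lemma mvecB F G : mvec F -> mvec G -> mvec (fun x => F x - G x).
Proof.
move=> mF mG; under eq_fun do rewrite -scaleN1r; apply: mvecD => //; exact: mvecZ.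
Qed.

Lemma measurable_dot F G : mvec F -> mvec G -> measurable_fun setT (fun x : B => dot (F x) (G x)).
Proof.
move=> mF mG; rewrite /dot; apply: measurable_sum => i.
exact: measurable_funM.
Qed.

Lemma measurable_enorm F : mvec F -> measurable_fun setT (fun x : B => enorm (F x)).
Proof. by move=> mF; apply: mvec_comp => //; exact: continuous_enorm. Qed.

Lemma mvec_grad u : smooth u -> mvec (grad u).
Proof. by move=> su i; apply: continuous_borel; exact: continuous_grad_coord. Qed.

Lemma mvec_gradc u F : smooth u -> mvec F -> mvec (fun x => grad u (F x)).
Proof.
by move=> su mF i; apply: (mvec_comp mF (u := fun x => grad u x 0 i)); exact: continuous_grad_coord.
Qed.

Lemma L1vec_mvec sigma : L1vec mu sigma -> mvec sigma.
Proof. by move=> h i; apply: (L1_measurable (h i)). Qed.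

Lemma L1vec_enorm sigma : L1vec mu sigma -> L1 (fun x => enorm (sigma x)).
Proof.
move=> h; apply: (@L1_dom _ B R mu _ (fun x => \sum_i `|sigma x 0 i|)).
- by apply: measurable_enorm; exact: L1vec_mvec.
- by move=> x; rewrite (ger0_norm (enorm_ge0 _)) enorm_le_sum.
- by apply: L1_sum => i; apply: L1_norm; exact: h.
Qed.

Lemma L1vec_dom sigma g : mvec sigma -> (forall x, enorm (sigma x) <= g x) -> L1 g -> L1vec mu sigma.
Proof.
move=> ms sg Lg i; apply: (@L1_dom _ B R mu _ g) => // x.
exact: le_trans (coord_le_enorm _ _) (sg x).
Qed.

Lemma L1_dot k F sigma : mvec F -> (forall x, enorm (F x) <= k) -> L1vec mu sigma ->
  L1 (fun x => dot (F x) (sigma x)).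
Proof.
move=> mF Fk Ls; apply: (@L1_dom _ B R mu _ (fun x => k * enorm (sigma x))).
- by apply: measurable_dot => //; exact: L1vec_mvec.
- by move=> x; apply: le_trans (norm_dot_le _ _) _; apply: ler_wpM2r; [exact: enorm_ge0|exact: Fk].
- by apply: L1Z; exact: L1vec_enorm.
Qed.

Lemma Int_dot_le k F sigma : mvec F -> (forall x, enorm (F x) <= k) -> L1vec mu sigma ->
  `|\int[mu]_x dot (F x) (sigma x)| <= k * \int[mu]_x enorm (sigma x).
Proof.
move=> mF Fk Ls; rewrite -IntZ; last exact: L1vec_enorm.
apply: norm_Int_le; first exact: L1_dot Ls.
  by apply: L1Z; exact: L1vec_enorm.
by move=> x; apply: le_trans (norm_dot_le _ _) _; apply: ler_wpM2r; [exact: enorm_ge0|exact: Fk].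
Qed.

Definition vI sigma := \int[mu]_x enorm (sigma x).

Lemma vI_ge0 sigma : 0 <= vI sigma.
Proof. by apply: Int_ge0 => x. Qed.

Lemma mdiv_le k u sigma : 0 <= k -> smooth u -> k_lipschitz k u -> L1vec mu sigma ->
  `|mdiv mu sigma u| <= k * vI sigma.
Proof.
move=> k0 su ku Ls; apply: Int_dot_le => //; first exact: mvec_grad.
by move=> x; apply: lipschitz_grad => //; exact: smooth_diff.
Qed.

Lemma L1_mdiv k u sigma : 0 <= k -> smooth u -> k_lipschitz k u -> L1vec mu sigma ->
  L1 (fun x => dot (grad u x) (sigma x)).
Proof.
move=> k0 su ku Ls; apply: (@L1_dot k) => //; first exact: mvec_grad.
by move=> x; apply: lipschitz_grad => //; exact: smooth_diff.
Qed.

Lemma mdivD k u v sigma : 0 <= k -> smooth u -> smooth v -> k_lipschitz k u -> k_lipschitz k v ->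
  L1vec mu sigma -> mdiv mu sigma (fun x => u x + v x) = mdiv mu sigma u + mdiv mu sigma v.
Proof.
move=> k0 su sv ku kv Ls; rewrite /mdiv -IntD; [|exact: (L1_mdiv k0 su ku Ls)|exact: (L1_mdiv k0 sv kv Ls)].
apply: eq_Rintegral => x _.
by rewrite gradD ?dotDl//; exact: smooth_diff.
Qed.

Lemma mdivZ k a u sigma : 0 <= k -> smooth u -> k_lipschitz k u ->
  L1vec mu sigma -> mdiv mu sigma (fun x => a * u x) = a * mdiv mu sigma u.
Proof.
move=> k0 su ku Ls; rewrite /mdiv -IntZ; last exact: (L1_mdiv k0 su ku Ls).
apply: eq_Rintegral => x _.
by rewrite gradZ ?dotZl//; exact: smooth_diff.
Qed.

Lemma L1vecB sigma tau : L1vec mu sigma -> L1vec mu tau -> L1vec mu (fun x => sigma x - tau x).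
Proof.
move=> hs ht; apply: (@L1vec_dom _ (fun x => enorm (sigma x) + enorm (tau x))).
- by apply: mvecB; exact: L1vec_mvec.
- by move=> x; exact: enormB.
- by apply: L1D; exact: L1vec_enorm.
Qed.

Lemma mdiv_diff k u sigma tau : 0 <= k -> smooth u -> k_lipschitz k u ->
  L1vec mu sigma -> L1vec mu tau ->
  `|mdiv mu sigma u - mdiv mu tau u| <= k * vI (fun x => sigma x - tau x).
Proof.
move=> k0 su ku Ls Lt; rewrite /mdiv -IntB; [|exact: (L1_mdiv k0 su ku Ls)|exact: (L1_mdiv k0 su ku Lt)].
have := mdiv_le k0 su ku (L1vecB Ls Lt); rewrite /mdiv.
by under eq_Rintegral do rewrite dotBr.
Qed.

Lemma quot_le k u (y w : V) h : k_lipschitz k u -> `|(u (y + h *: w) - u y) / h| <= k * enorm w.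
Proof.
move=> ku; have [->|h0] := eqVneq h 0.
  rewrite invr0 mulr0 normr0.
  have := le_trans (normr_ge0 _) (ku w 0); by rewrite subr0.
rewrite normrM normfV ler_pdivrMr ?normr_gt0//.
by apply: le_trans (ku _ _) _; rewrite addrAC subrr add0r enormZ mulrCA mulrC.
Qed.

Lemma measurable_quot u Psi sigma h : continuous u -> mvec Psi -> mvec sigma ->
  measurable_fun setT (fun x : B => (u (Psi x + h *: sigma x) - u (Psi x)) / h).
Proof.
move=> cu mP ms; apply: measurable_funM => //; apply: measurable_funB.
  by apply: (@mvec_comp (fun x => Psi x + h *: sigma x)) => //; apply: mvecD => //; exact: mvecZ.
exact: mvec_comp.
Qed.

Lemma L1_quot k u Psi sigma h : k_lipschitz k u -> mvec Psi -> L1vec mu sigma ->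
  L1 (fun x => (u (Psi x + h *: sigma x) - u (Psi x)) / h).
Proof.
move=> ku mP Ls; apply: (@L1_dom _ B R mu _ (fun x => k * enorm (sigma x))).
- by apply: measurable_quot => //; [exact: k_lipschitz_continuous ku|exact: L1vec_mvec].
- by move=> x; exact: quot_le.
- by apply: L1Z; exact: L1vec_enorm.
Qed.

(** Dominated convergence, as the quotients are bounded by k |sigma|. *)
Lemma diffquot_cvg k u Psi sigma : k_lipschitz k u -> (forall x, differentiable u x) ->
  mvec Psi -> L1vec mu sigma ->
  \int[mu]_x ((u (Psi x + h *: sigma x) - u (Psi x)) / h) @[h --> (0:R)^'] -->
  \int[mu]_x dot (grad u (Psi x)) (sigma x).
Proof.
move=> ku du mP Ls.
suff H (s : nat -> R) : (forall n, s n != 0) -> s n @[n --> \oo] --> 0 ->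
    \int[mu]_x ((u (Psi x + s n *: sigma x) - u (Psi x)) / s n) @[n --> \oo] -->
    \int[mu]_x dot (grad u (Psi x)) (sigma x).
  apply: (@cvg_at_right_left_dnbhs _ R^o).
    by apply/cvg_at_rightP => s [s0 cs]; apply: H => // n; rewrite gt_eqF.
  by apply/cvg_at_leftP => s [s0 cs]; apply: H => // n; rewrite lt_eqF.
move=> s0 cs.
apply: (@Int_cvg _ B R mu _ _ (fun x => k * enorm (sigma x))).
- by move=> n; apply: measurable_quot => //; [exact: k_lipschitz_continuous ku|exact: L1vec_mvec].
- move=> x; have := @dirderiv _ _ u (Psi x) (sigma x) (du _).
  move=> /(@cvg_comp _ _ _ s (fun h => (u (Psi x + h *: sigma x) - u (Psi x)) / h) \oo); apply.
  move=> A [e /= e0 hA]; have := cs _ (nbhsx_ballx 0 e e0) => -[N _ hN].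
  by exists N => // n /= Nn; apply: hA; [exact: hN|exact: s0].
- by apply: L1Z; exact: L1vec_enorm.
- by move=> n x; exact: quot_le.
Qed.

Lemma Dh_cvg k (u : Lip R d) sigma : k_lipschitz k u -> (forall x, differentiable u x) ->
  L1vec mu sigma -> Dh mu sigma h u @[h --> (0:R)^'+] --> mdiv mu sigma u.
Proof.
move=> ku du Ls; have := diffquot_cvg ku du mvec_id Ls.
exact: cvg_dnbhs_at_right.
Qed.

Lemma Dh_linear sigma h : L1vec mu sigma -> linear_form (Dh mu sigma h).
Proof.
move=> Ls a b u v w e; rewrite /Dh.
have [[k ku] [l lv]] := (lip_funP u, lip_funP v).
have Lu := L1_quot h ku mvec_id Ls; have Lv := L1_quot h lv mvec_id Ls.
rewrite -[a * _]IntZ// -[b * _]IntZ// -IntD; try exact: L1Z.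
by apply: eq_Rintegral => x _; rewrite !e; ring.
Qed.

Lemma Dh_diff k (u : Lip R d) sigma tau h : 0 < h -> k_lipschitz k u ->
  L1vec mu sigma -> L1vec mu tau ->
  `|Dh mu sigma h u - Dh mu tau h u| <= k * vI (fun x => sigma x - tau x).
Proof.
move=> h0 ku Ls Lt; have k0 := 0.
rewrite /Dh -IntB; [|exact: (L1_quot h ku mvec_id Ls)|exact: (L1_quot h ku mvec_id Lt)].
rewrite -IntZ; last by apply: L1vec_enorm; exact: L1vecB.
apply: norm_Int_le.
- by apply: L1B; [exact: (L1_quot h ku mvec_id Ls)|exact: (L1_quot h ku mvec_id Lt)].
- by apply: L1Z; apply: L1vec_enorm; exact: L1vecB.
move=> x.
have -> : (u (x + h *: sigma x) - u x) / h - (u (x + h *: tau x) - u x) / h =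
  (u (x + h *: sigma x) - u (x + h *: tau x)) / h by ring.
rewrite normrM normfV ler_pdivrMr ?normr_gt0 ?gt_eqF//.
apply: le_trans (ku _ _) _.
rewrite opprD addrACA subrr add0r -scalerBr enormZ.
by rewrite mulrCA mulrC.
Qed.

End fields.

(** * Approximation of Lipschitz functions by test functions *)

Section softmin.
Context (R : realType) (d : nat).
Local Notation V := 'rV[R]_d.
Implicit Types (u v : V -> R) (x y : V).

(** An enumeration of the rational points that starts at 0, so that the point 0
    takes part in all the soft minima below. *)
Definition ratpt (n : nat) : V :=
  if n is m.+1 then
    if unpickle m is Some q then \row_i ratr ((q : 'rV[rat]_d) 0 i) else 0
  else 0.

Lemma ratpt_dense x e : 0 < e -> exists n, enorm (x - ratpt n) < e.
Proof.
move=> e0; have D0 : 0 < d%:R + 1 :> R by rewrite ltr_wpDl.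
have [q hq] := @rat_dense R d x (e / (d%:R + 1)) ltac:(by rewrite divr_gt0).
exists (pickle q).+1; rewrite /ratpt pickleK.
apply: le_lt_trans (enorm_le_sum _) _.
apply: (@le_lt_trans _ _ (\sum_(i < d) (e / (d%:R + 1)))).
  by apply: ler_sum => i _; rewrite !mxE ltW.
rewrite sumr_const card_ord -[X in X < _]mulr_natr mulrAC ltr_pdivrMr// ltr_pM2l//.
by rewrite ltrDl.
Qed.

(** A smooth substitute for the Euclidean norm. *)
Definition scone (th : R) (x : V) : R := Num.sqrt (th ^+ 2 + dot x x).

Lemma scone_ge th x : enorm x <= scone th x.
Proof. by rewrite ler_sqrt ?addr_ge0 ?sqr_ge0 ?dot_ge0// lerDr sqr_ge0. Qed.

Lemma scone_le th x : 0 <= th -> scone th x <= th + enorm x.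
Proof.
move=> t0; rewrite -(@ler_pXn2r _ 2)// ?nnegrE ?addr_ge0 ?sqrtr_ge0//.
rewrite sqr_sqrtr ?addr_ge0 ?sqr_ge0 ?dot_ge0// -sqr_enorm.
by have := enorm_ge0 x; nra.
Qed.

Lemma scone_lip th x y : scone th x <= scone th y + enorm (x - y).
Proof.
have hx := enorm_ge0 x; have hy := enorm_ge0 y; have hxy := enorm_ge0 (x - y).
have h1 : enorm x <= enorm y + enorm (x - y).
  by rewrite -{1}(subrK y x) addrC enormD.
rewrite -(@ler_pXn2r _ 2)// ?nnegrE ?addr_ge0 ?sqrtr_ge0//.
rewrite sqrrD !sqr_sqrtr ?addr_ge0 ?sqr_ge0 ?dot_ge0// -!sqr_enorm.
have := scone_ge th y; rewrite /scone -sqr_enorm; set s := Num.sqrt _; nra.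
Qed.

Section approximant.
Variable (u : V -> R).
Hypothesis ku : k_lipschitz 1 u.

(** A soft minimum of n + 1 values with parameter th is th * ln (n + 1) close to
    their minimum: this tends to 0 for th = (n + 1) ^- 2. *)
Definition smth (n : nat) : R := n.+1%:R ^- 2.
Definition cone n i x := u (ratpt i) + scone (smth n) (x - ratpt i).
Definition smsum n x := \sum_(i < n.+1) expR (- (cone n i x / smth n)).
(** Soft minimum of the first cones.  It is smooth, 1-Lipschitz as the cones are,
    and close to u since the infimum over q of u q + |x - q| is u x. *)
Definition smin n x := - (smth n * ln (smsum n x)).

Lemma smth_gt0 n : 0 < smth n. Proof. by rewrite invr_gt0 exprn_gt0. Qed.

Lemma smsum_gt0 n x : 0 < smsum n x.
Proof.
rewrite /smsum big_ord_recl ltr_pwDl ?expR_gt0// sumr_ge0// => i _; exact: expR_ge0.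
Qed.

Lemma smin_smooth n : smooth (smin n).
Proof.
apply: (smoothP _).2 => m; apply: CnN; apply: CnZ; apply: Cn_ln.
  by move=> x; exact: smsum_gt0.
apply: Cn_sum => i; apply: Cn_exp; apply: CnN.
rewrite (_ : (fun x => _) = (fun x => (smth n)^-1 * cone n i x)); last first.
  by apply/funext => x; rewrite mulrC.
apply: CnZ; apply: CnD; first exact: Cn_cst.
apply: Cn_sqrt => [x|].
  by rewrite ltr_pwDl ?dot_ge0// exprn_gt0// smth_gt0.
apply: CnD; first exact: Cn_cst.
have h j : Cn m (fun x : V => (x - ratpt i) 0 j).
  rewrite (_ : (fun x : V => _) = (fun x : V => x 0 j - ratpt i 0 j)).
    by apply: CnB; [exact: Cn_coord|exact: Cn_cst].
  by apply/funext => x; rewrite !mxE.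
exact: Cn_dot.
Qed.

Lemma smin_lip n : k_lipschitz 1 (smin n).
Proof.
have t0 := smth_gt0 n.
suff H x y : smin n y <= smin n x + enorm (x - y).
  move=> x y; rewrite mul1r ler_norml; apply/andP; split.
    by rewrite lerNl opprB lerBlDl H.
  by rewrite lerBlDl enormBC H.
rewrite /smin lerNl opprD opprK lerBlDr.
have -> : smth n * ln (smsum n y) + enorm (x - y) =
    smth n * ln (smsum n y * expR (enorm (x - y) / smth n)).
  rewrite lnM ?posrE ?smsum_gt0 ?expR_gt0// expRK mulrDr; congr (_ + _).
  by rewrite mulrC divfK// gt_eqF.
rewrite ler_pM2l// ler_ln ?posrE ?smsum_gt0 ?mulr_gt0 ?expR_gt0 ?smsum_gt0//.
rewrite mulr_suml; apply: ler_sum => i _; rewrite -expRD ler_expR.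
rewrite -!mulNr -mulrDl ler_pM2r ?invr_gt0// /cone !opprD -addrA lerD2l.
have := scone_lip (smth n) (y - ratpt i) (x - ratpt i).
by rewrite opprB addrA subrK enormBC; lra.
Qed.

Lemma cone_ge n i x : u x <= cone n i x.
Proof.
apply: le_trans (_ : u (ratpt i) + enorm (x - ratpt i) <= _); last first.
  by rewrite lerD2l scone_ge.
by have := ku x (ratpt i); rewrite mul1r => /(le_trans (ler_norm _)); lra.
Qed.

Lemma cone_le n i x : cone n i x <= u x + 2 * enorm (x - ratpt i) + smth n.
Proof.
have := scone_le (x - ratpt i) (ltW (smth_gt0 n)).
have := ku (ratpt i) x; rewrite mul1r enormBC => /(le_trans (ler_norm _)).
by rewrite /cone; lra.
Qed.

Lemma smin_ge n x : u x - n.+1%:R^-1 <= smin n x.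
Proof.
have t0 := smth_gt0 n.
rewrite /smin lerNr opprB.
have -> : n.+1%:R^-1 - u x = smth n * ln (expR (n.+1%:R) * expR (- (u x / smth n))).
  rewrite lnM ?posrE ?expR_gt0// !expRK mulrDr mulrN; congr (_ - _).
    by rewrite /smth expr2 invfM -mulrA mulVf// mulr1.
  by rewrite mulrC divfK// gt_eqF.
rewrite ler_pM2l// ler_ln ?posrE ?smsum_gt0 ?mulr_gt0 ?expR_gt0//.
apply: (@le_trans _ _ (\sum_(i < n.+1) expR (- (u x / smth n)))).
  apply: ler_sum => i _; rewrite ler_expR lerN2 ler_pM2r ?invr_gt0//.
  exact: cone_ge.
rewrite sumr_const card_ord -[leLHS]mulr_natl ler_wpM2r ?expR_ge0//.
by apply: le_trans (expR_ge1Dx _); rewrite lerDr.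
Qed.

Lemma smin_le n i x : (i <= n)%N -> smin n x <= u x + 2 * enorm (x - ratpt i) + smth n.
Proof.
move=> ni; have t0 := smth_gt0 n; apply: le_trans (cone_le n i x).
rewrite /smin lerNl.
have -> : - cone n i x = smth n * ln (expR (- (cone n i x / smth n))).
  by rewrite expRK mulrN mulrC divfK// gt_eqF.
rewrite ler_pM2l// ler_ln ?posrE ?smsum_gt0 ?expR_gt0//.
rewrite /smsum (bigD1 (Ordinal (ni : (i < n.+1)%N)))//= lerDl.
by apply: sumr_ge0 => j _; exact: expR_ge0.
Qed.

Lemma smth_le n : smth n <= n.+1%:R^-1.
Proof.
by rewrite /smth lef_pV2 ?posrE ?exprn_gt0// expr2 ler_peMl// ler1n.
Qed.

Lemma smin_bound n x : `|smin n x| <= `|u 0| + 1 + enorm x.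
Proof.
have h0 : `|smin n 0| <= `|u 0| + 1.
  have h1 := smin_ge n 0; have h2 := @smin_le n 0 0 (leq0n n).
  have h3 := smth_le n.
  have h4 : n.+1%:R^-1 <= 1 :> R by rewrite invf_le1 ?ler1n.
  move: h2; rewrite /= subr0 enorm0 mulr0 addr0 => h2.
  have a1 := ler_norm (u 0); have a2 := ler_norm (- u 0); rewrite normrN in a2.
  move: (_ n 0) (n.+1%:R^-1) (u 0) (smth n) h1 h2 h3 h4 a1 a2 => s c w t h1 h2 h3 h4 a1 a2.
  by rewrite ler_norml; apply/andP; split; lra.
have := smin_lip n x 0; rewrite mul1r subr0 => h.
rewrite -(subrK (smin n 0) (smin n x)); apply: le_trans (ler_normD _ _) _.
by rewrite addrC lerD.
Qed.

Lemma smin_cvg x : smin n x @[n --> \oo] --> u x.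
Proof.
apply/cvgrPdist_le => e e0.
have [i hi] := @ratpt_dense x (e / 3) ltac:(by rewrite divr_gt0).
have e3 : 0 < e / 3 by rewrite divr_gt0.
near=> n.
have ni : (i <= n)%N by near: n; exact: nbhs_infty_ge.
have hn : n.+1%:R^-1 <= e / 3.
  by near: n; apply: filterS (near_infty_natSinv_lt (PosNum e3)) => m /ltW.
have h1 := smin_ge n x; have h2 := smin_le x ni; have h3 := smth_le n.
move: (n.+1%:R^-1) hn h1 h3 => c hn h1 h3.
by rewrite ler_norml; apply/andP; split; lra.
Unshelve. all: by end_near. Qed.

End approximant.

(** Soft minima of cones, cut off at a radius r: they are at most 3 r on the ball of
    radius 2 r, where the cutoff is K / r-Lipschitz, so that the product is
    (1 + 3 K)-Lipschitz whatever r. *)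
Lemma test_dense : exists2 C : R, 1 <= C & forall u, k_lipschitz 1 u ->
  exists v : nat -> V -> R, [/\ forall n, test_function (v n),
    forall n, k_lipschitz C (v n), forall x, v n x @[n --> \oo] --> u x &
    forall n x, `|v n x| <= `|u 0| + 1 + enorm x].
Proof.
have [K K0 hK] := cutoff_lipschitz R d.
exists (1 + 3 * K); first by rewrite lerDl mulr_ge0// ltW.
(* with this radius |u 0| + 1 + |x| is at most 3 r n on the ball of radius 2 r n *)
move=> u ku; pose r n : R := n%:R + 1 + `|u 0|.
have r0 n : 0 < r n by rewrite ltr_wpDr// ltr_wpDl.
pose v n x := cutoff (r n) x * smin u n x.
exists v; split.
- move=> n; rewrite /v.
  have -> : (fun x => cutoff (r n) x * smin u n x) = (fun x => smin u n x * cutoff (r n) x).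
    by apply/funext => x; rewrite mulrC.
  by apply: test_functionMl; [exact: smin_smooth|exact: cutoff_test].
- move=> n.
  have H x y : enorm y <= 2 * r n -> `|v n x - v n y| <= (1 + 3 * K) * enorm (x - y).
    move=> yr; have -> : v n x - v n y = cutoff (r n) x * (smin u n x - smin u n y) +
      (cutoff (r n) x - cutoff (r n) y) * smin u n y by rewrite /v mulrBr mulrBl addrA subrK.
    apply: le_trans (ler_normD _ _) _; rewrite [leRHS]mulrDl [1 * _ in leRHS]mul1r lerD// normrM.
      rewrite -[leRHS]mul1r ler_pM// ?(ger0_norm (cutoff_ge0 _ _)) ?cutoff_le1//.
      by have := @smin_lip u n x y; rewrite mul1r.
    apply: (@le_trans _ _ ((K / r n * enorm (x - y)) * (3 * r n))).
      apply: ler_pM => //; first exact: hK.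
      apply: le_trans (smin_bound ku n y) _.
      have : `|u 0| + 1 <= r n by rewrite /r addrC lerD// lerDr.
      by lra.
    by rewrite le_eqVlt; apply/orP; left; apply/eqP; field; rewrite gt_eqF.
  move=> x y; have [yr|yr] := leP (enorm y) (2 * r n); first exact: H.
  have [xr|xr] := leP (enorm x) (2 * r n); first by rewrite distrC enormBC H.
  have cx : cutoff (r n) x = 0 by apply: cutoff_eq0 => //; exact: ltW.
  have cy : cutoff (r n) y = 0 by apply: cutoff_eq0 => //; exact: ltW.
  rewrite /v cx cy !mul0r subrr normr0; apply: mulr_ge0; last exact: enorm_ge0.
  by apply: addr_ge0 => //; apply: mulr_ge0 => //; exact: ltW.
- move=> x; have := @smin_cvg u ku x; apply: cvg_trans; apply: near_eq_cvg.
  near=> n; rewrite /v cutoff_eq1 ?mul1r//.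
  apply: (@le_trans _ _ n%:R); last by rewrite /r -addrA lerDl addr_ge0.
  near: n; exact: nbhs_infty_ger.
- move=> n x; rewrite /v normrM; apply: le_trans (smin_bound ku n x).
  by rewrite -[leRHS]mul1r ler_wpM2r// (ger0_norm (cutoff_ge0 _ _)) cutoff_le1.
Unshelve. all: by end_near. Qed.

End softmin.

(** * Density of test functions in L1 *)

Section L1_density.
Context (R : realType) (d : nat).
Local Notation V := 'rV[R]_d.
Local Notation B := (borel R d).
Variable mu : {measure set B -> \bar R}.
Hypothesis mu_radon : radon mu.
Local Notation L1 := (L1 mu).
Implicit Types (u v f phi : V -> R).

Lemma eball_fin r : (mu (eball r) < +oo)%E.
Proof. by apply: mu_radon; exact: compact_eball. Qed.

Lemma L1_indic (A : set B) : measurable A -> (mu A < +oo)%E -> L1 \1_A.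
Proof. by move=> mA fA; apply/integrableP; split;
  [exact/measurable_EFinP|under eq_integral do rewrite /= ger0_norm//; rewrite integral_indic// setIT]. Qed.

Lemma L1_supp M r f : measurable_fun setT (f : B -> R) -> (forall x, `|f x| <= M) -> supp_in r f -> L1 f.
Proof.
move=> mf fM sf; apply: (@L1_dom _ B R mu _ (fun x => M * \1_(eball r : set B) x)) => //.
  move=> x; rewrite indicE; have [xr|xr] := leP (enorm x) r.
    by rewrite mem_set// mulr1.
  rewrite memNset ?mulr0 ?sf ?normr0//=; apply/negP; by rewrite -ltNge.
apply: L1Z; apply: L1_indic; [exact: eball_borel|exact: eball_fin].
Qed.

Lemma smooth_measurable u : smooth u -> measurable_fun setT (u : B -> R).
Proof. by move=> su; apply: continuous_borel => x; apply/differentiable_continuous/smooth_diff. Qed.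

Lemma test_L1 u : test_function u -> L1 u.
Proof.
move=> tu; have [M M0 hM] := test_bounded tu.
have /test_functionP[su [r r0 hr]] := tu.
by apply: (@L1_supp M r) => //; exact: smooth_measurable.
Qed.

Section weight.
Variable W : V -> R.
Hypothesis W_test : test_function W.
Hypothesis W01 : forall x, 0 <= W x <= 1.

Let mW : measurable_fun setT (W : B -> R).
Proof. by case: W_test => sW _; exact: smooth_measurable. Qed.

Let L1W M f : measurable_fun setT (f : B -> R) -> (forall x, `|f x| <= M) -> L1 (fun x => W x * f x).
Proof.
move=> mf fM; apply: (@L1_dom _ B R mu _ (fun x => M * W x)).
- exact: measurable_funM.
- by move=> x; rewrite normrM ger0_norm ?(andP (W01 x)).1// mulrC ler_wpM2r// (andP (W01 x)).1.
- by apply: L1Z; exact: test_L1.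
Qed.

Definition dst f phi : R := \int[mu]_x (W x * `|f x - phi x|).

(** Approximation in L1 for the finite measure W mu.  These sets form a
    sigma-algebra that contains the rational boxes. *)
Definition smoothly_approx (A : set B) := measurable A /\
  forall e, 0 < e -> exists phi, [/\ smooth phi, forall x, 0 <= phi x <= 1 & dst \1_A phi <= e].

Let dist1 (a b : R) : 0 <= a <= 1 -> 0 <= b <= 1 -> `|a - b| <= 1.
Proof. by move=> /andP[? ?] /andP[? ?]; rewrite ler_norml; apply/andP; split; lra. Qed.

Let indic01 (A : set B) x : 0 <= (\1_A x : R) <= 1.
Proof. by rewrite indicE; case: (_ \in _); rewrite ?lexx ?ler01. Qed.

Let L1_dst f phi : measurable_fun setT (f : B -> R) -> measurable_fun setT (phi : B -> R) ->
  (forall x, 0 <= f x <= 1) -> (forall x, 0 <= phi x <= 1) ->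
  L1 (fun x => W x * `|f x - phi x|).
Proof.
move=> mf mp f01 p01; apply: (@L1W 1).
  by apply: measurableT_comp => //; exact: measurable_funB.
by move=> x; rewrite normr_id dist1.
Qed.

Lemma approx_set0 : smoothly_approx set0.
Proof.
split => // e e0; exists (fun=> 0); split.
- by apply: (smoothP _).2 => n; exact: Cn_cst.
- by move=> x; rewrite lexx ler01.
rewrite /dst; under eq_Rintegral do rewrite indic0 subrr normr0 mulr0.
by rewrite /Rintegral integral0 /= ltW.
Qed.

Lemma approx_setC (A : set B) : smoothly_approx A -> smoothly_approx (~` A).
Proof.
move=> [mA h]; split; first exact: measurableC.
move=> e /h[phi [sp p01 hp]]; exists (fun x => 1 - phi x); split.
- by apply: (smoothP _).2 => n; apply: CnB; [exact: Cn_cst|exact: (smoothP _).1].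
- by move=> x; have := p01 x; lra.
apply: le_trans hp; rewrite le_eqVlt; apply/orP; left; apply/eqP.
apply: eq_Rintegral => x _; congr (_ * _).
rewrite !indicE in_setC; case: (x \in A) => /=.
  by rewrite sub0r opprB distrC.
by rewrite sub0r normrN opprB addrC subrK.
Qed.

(** The expression 1 - (1 - a) (1 - b), which is the union for indicators, preserves
    smoothness and the bounds 0 and 1. *)
Lemma approx_setU (A1 A2 : set B) : smoothly_approx A1 -> smoothly_approx A2 -> smoothly_approx (A1 `|` A2).
Proof.
move=> [mA1 h1] [mA2 h2]; split; first exact: measurableU.
move=> e e0; have e2 : 0 < e / 2 by rewrite divr_gt0.
have [p1 [sp1 p101 hp1]] := h1 _ e2; have [p2 [sp2 p201 hp2]] := h2 _ e2.
pose p x := 1 - (1 - p1 x) * (1 - p2 x).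
have sp : smooth p.
  apply: (smoothP _).2 => n; apply: CnB; first exact: Cn_cst.
  by apply: CnM; apply: CnB; (try exact: Cn_cst); apply: (smoothP _).1.
have p01 x : 0 <= p x <= 1.
  have := p101 x; have := p201 x; rewrite /p => /andP[? ?] /andP[? ?]; apply/andP; split; nra.
exists p; split => //.
have m1 := smooth_measurable sp1; have m2 := smooth_measurable sp2.
have L1a : L1 (fun x => W x * `|\1_A1 x - p1 x|) by apply: L1_dst => //.
have L2a : L1 (fun x => W x * `|\1_A2 x - p2 x|) by apply: L1_dst => //.
rewrite [e]splitr; apply: le_trans (lerD hp1 hp2); rewrite /dst -IntD//.
apply: le_Int.
- apply: L1_dst => //; [|exact: smooth_measurable].
  by apply: measurable_indic; exact: measurableU.
- exact: L1D.
move=> x; rewrite -mulrDr ler_wpM2l//; first by case/andP: (W01 x).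
have -> : \1_(A1 `|` A2) x = 1 - (1 - \1_A1 x) * (1 - \1_A2 x) :> R.
  by rewrite !indicE in_setU; case: (x \in A1); case: (x \in A2) => /=; ring.
rewrite /p; have := p201 x; have := indic01 A1 x.
move: (\1_A1 x : R) (\1_A2 x : R) (p1 x) (p2 x) => a b c f /andP[a0 a1] /andP[f0 f1].
have -> : 1 - (1 - a) * (1 - b) - (1 - (1 - c) * (1 - f)) =
  (1 - f) * (a - c) + (1 - a) * (b - f) by ring.
apply: le_trans (ler_normD _ _) _; rewrite !normrM.
by apply: lerD; rewrite ger0_norm ?subr_ge0// ler_piMl// gerBl.
Qed.

Let bigU (A : nat -> set B) N := \big[setU/set0]_(i < N) A i.

Lemma approx_bigcup (A : nat -> set B) : (forall n, smoothly_approx (A n)) ->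
  smoothly_approx (\bigcup_n A n).
Proof.
move=> hA.
have mA : measurable (\bigcup_n A n) by apply: bigcupT_measurable => n; case: (hA n).
have hU N : smoothly_approx (bigU A N).
  rewrite /bigU; elim: N => [|N IH]; first by rewrite big_ord0; exact: approx_set0.
  by rewrite big_ord_recr; exact: approx_setU.
split => // e e0.
have e2 : 0 < e / 2 by rewrite divr_gt0.
have cv : dst \1_(\bigcup_n A n) \1_(bigU A N) @[N --> \oo] --> (0 : R).
  rewrite [X in _ --> X](_ : _ = \int[mu]_x (fun=> 0) x); last first.
    by rewrite /Rintegral integral0.
  apply: (@Int_cvg _ B R mu _ _ W).
  - move=> N; apply: measurable_funM => //; apply: measurableT_comp => //.
    by apply: measurable_funB; apply: measurable_indic => //; case: (hU N).
  - move=> x; rewrite (_ : 0 = W x * 0); last by rewrite mulr0.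
    apply: cvgMl_tmp; apply: cvg_near_cst.
    have [xA|xA] := pselect ((\bigcup_n A n) x).
      have [n _ xAn] := xA; near=> N; rewrite !indicE !mem_set// ?subrr ?normr0//.
      rewrite /bigU -bigcup_mkord; exists n => //=; near: N; exact: nbhs_infty_gt.
    near=> N; rewrite !indicE !memNset// ?subrr ?normr0// /bigU -bigcup_mkord.
    by move=> [n _ xAn]; apply: xA; exists n.
  - exact: test_L1.
  - move=> N x; rewrite normrM normr_id (ger0_norm (andP (W01 x)).1).
    by rewrite ler_piMr ?(andP (W01 x)).1// dist1.
have [N _ /(_ N (leqnn N)) hN] := (cvgrPdist_le _ _).1 cv _ e2.
have [mU /(_ _ e2) [phi [sp p01 hp]]] := hU N; exists phi; split => //.
have mp := smooth_measurable sp.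
rewrite [e]splitr; have {}hN : dst \1_(\bigcup_n A n) \1_(bigU A N) <= e / 2.
  by apply: le_trans hN; rewrite sub0r normrN ler_norm.
apply: le_trans (lerD hN hp); rewrite /dst.
have L1a : L1 (fun x => W x * `|\1_(\bigcup_n A n) x - \1_(bigU A N) x|).
  by apply: L1_dst => //; exact: measurable_indic.
have L1b : L1 (fun x => W x * `|\1_(bigU A N) x - phi x|).
  by apply: L1_dst => //; exact: measurable_indic.
rewrite -IntD//; apply: le_Int.
- by apply: L1_dst => //; exact: measurable_indic.
- exact: L1D.
move=> x; rewrite -mulrDr ler_wpM2l//; first by case/andP: (W01 x).
exact: ler_distD.
Unshelve. all: by end_near. Qed.

Lemma approx_rbox p : smoothly_approx (rbox p : set B).
Proof.
case: p => q n; set w : R := n.+1%:R^-1.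
pose P (x : V) : R := \prod_(i < d) (flat 0 (w - (x 0 i - ratr (q 0 i))) * flat 0 (w + (x 0 i - ratr (q 0 i)))).
have sP : smooth P.
  apply: (smoothP _).2 => m; apply: Cn_prod => i; apply: CnM; apply: Cn_flat.
    by apply: CnB; [exact: Cn_cst|apply: CnB; [exact: Cn_coord|exact: Cn_cst]].
  by apply: CnD; [exact: Cn_cst|apply: CnB; [exact: Cn_coord|exact: Cn_cst]].
have Pin (x : V) : rbox (q, n) x -> 0 < P x.
  move=> hx; apply: prodr_gt0 => i _; have := hx i; rewrite /= -/w ltr_norml => /andP[h1 h2].
  by rewrite mulr_gt0// flat0_gt0//; lra.
have Pout (x : V) : ~ rbox (q, n) x -> P x = 0.
  move=> /existsNP[i /negP]; rewrite -leNgt /= -/w => hi.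
  rewrite /P (bigD1 i)//= [X in X * _](_ : _ = 0) ?mul0r//.
  move: hi; rewrite ler_normr => /orP[h|h].
    by rewrite {1}/flat ltNge (_ : _ <= 0) ?mul0r// subr_le0.
  rewrite [X in _ * X](_ : _ = 0) ?mulr0// /flat ltNge (_ : _ <= 0)//.
  by lra.
pose phi (N : nat) (x : V) : R := sstep (N%:R * P x).
have sphi N : smooth (phi N).
  by apply: (smoothP _).2 => m; apply: Cn_sstep; apply: CnZ; apply: (smoothP _).1.
have phi01 N x : 0 <= phi N x <= 1 by rewrite /phi sstep_ge0 sstep_le1.
have mb : measurable (rbox (q, n) : set B).
  rewrite (_ : rbox (q, n) = [set x | 0 < P x]).
    rewrite -[X in measurable X]setTI.
    have mP := smooth_measurable sP.
    by apply: (measurable_fun_ltr _ mP measurableT (Y := [set true])).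
  by apply/seteqP; split => x /=; [exact: Pin|move=> Px; apply: contrapT => /Pout P0; rewrite P0 ltxx in Px].
split => // e e0.
have cv : dst \1_(rbox (q, n)) (phi N) @[N --> \oo] --> (0 : R).
  rewrite [X in _ --> X](_ : _ = \int[mu]_x (fun=> 0) x); last first.
    by rewrite /Rintegral integral0.
  apply: (@Int_cvg _ B R mu _ _ W).
  - move=> N; apply: measurable_funM => //; apply: measurableT_comp => //.
    by apply: measurable_funB; [exact: measurable_indic|exact: smooth_measurable].
  - move=> x; rewrite (_ : 0 = W x * 0); last by rewrite mulr0.
    apply: cvgMl_tmp; apply: cvg_near_cst.
    have [xA|xA] := pselect (rbox (q, n) x).
      near=> N; rewrite indicE mem_set// /phi sstep_ge1 ?subrr ?normr0//.
      have Px := Pin _ xA; rewrite -ler_pdivrMr// mul1r.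
      near: N; exact: nbhs_infty_ger.
    by near=> N; rewrite indicE memNset// /phi Pout// mulr0 sstep_le0// subrr normr0.
  - exact: test_L1.
  - move=> N x; rewrite normrM normr_id (ger0_norm (andP (W01 x)).1).
    by rewrite ler_piMr ?(andP (W01 x)).1// dist1.
have [N _ /(_ N (leqnn N)) hN] := (cvgrPdist_le _ _).1 cv _ e0.
exists (phi N); split => //.
by apply: le_trans hN; rewrite sub0r normrN ler_norm.
Unshelve. all: by end_near. Qed.

Lemma approx_borel (A : set B) : measurable A -> smoothly_approx A.
Proof.
apply: smallest_sub; first split.
- exact: approx_set0.
- by move=> A' hA; rewrite setTD; exact: approx_setC.
- exact: approx_bigcup.
move=> O oO; rewrite (open_rbox oO).
have -> : \bigcup_(p in [set p | rbox p `<=` O]) rbox p =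
   \bigcup_n (if unpickle n is Some p then if `[< rbox p `<=` O >] then rbox p else set0 else set0) :> set B.
  apply/seteqP; split => x.
    by move=> [p /= pO xp]; exists (pickle p) => //; rewrite pickleK; case: asboolP.
  move=> [n _]; case: (unpickle n) => // p; case: asboolP => // pO xp; by exists p.
apply: approx_bigcup => n; case: unpickle => [p|]; last exact: approx_set0.
by case: asboolP => _; [exact: approx_rbox|exact: approx_set0].
Qed.

Definition bounded_smooth phi := smooth phi /\ exists M, forall x, `|phi x| <= M.

Lemma approx_simple (s : seq R) (A : R -> set B) : (forall r, measurable (A r)) ->
  forall e, 0 < e -> exists2 phi, bounded_smooth phi &
    \int[mu]_x (W x * `|\sum_(r <- s) r * \1_(A r) x - phi x|) <= e.
Proof.
move=> mA; elim: s => [|r s IH] e e0.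
  exists (fun=> 0); first (split; last by exists 0 => x; rewrite normr0).
    by apply: (smoothP _).2 => n; exact: Cn_cst.
  under eq_Rintegral do rewrite big_nil subrr normr0 mulr0.
  by rewrite /Rintegral integral0 /= ltW.
have e2 : 0 < e / 2 by rewrite divr_gt0.
have [p [sp [M pM]] hp] := IH _ e2.
have e3 : 0 < e / 2 / (`|r| + 1) by rewrite divr_gt0// ltr_wpDl.
have [q [sq q01 hq]] := (approx_borel (mA r)).2 _ e3.
have mp := smooth_measurable sp; have mq := smooth_measurable sq.
exists (fun x => r * q x + p x).
  split; first by apply: smoothD => //; exact: smoothZ.
  exists (`|r| + M) => x; apply: le_trans (ler_normD _ _) _; rewrite lerD//.
  rewrite normrM ler_piMr// ger0_norm; by case/andP: (q01 x).
have mS : measurable_fun setT (fun x : B => \sum_(r <- s) r * \1_(A r) x : R).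
  by apply: measurable_sum => j; apply: measurable_funM => //; exact: measurable_indic.
have bS x : `|\sum_(r <- s) r * \1_(A r) x| <= \sum_(r <- s) `|r|.
  apply: le_trans (ler_norm_sum _ _ _) _; apply: ler_sum => j _.
  by rewrite normrM ler_piMr// ger0_norm; case/andP: (indic01 (A j) x).
have La : L1 (fun x => W x * `|\sum_(r <- s) r * \1_(A r) x - p x|).
  apply: (@L1W (\sum_(r <- s) `|r| + M)).
    by apply: measurableT_comp => //; exact: measurable_funB.
  by move=> x; rewrite normr_id; apply: le_trans (ler_normB _ _) _; rewrite lerD.
have Lb : L1 (fun x => W x * `|\1_(A r) x - q x|).
  by apply: L1_dst => //; exact: measurable_indic.
apply: (@le_trans _ _ (`|r| * dst \1_(A r) q + e / 2)); last first.
  rewrite [leRHS]splitr lerD2r.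
  apply: (@le_trans _ _ (`|r| * (e / 2 / (`|r| + 1)))); first by rewrite ler_wpM2l.
  by rewrite mulrCA ler_piMr ?(ltW e2)// ler_pdivrMr ?mul1r ?lerDl// ltr_wpDl.
apply: le_trans (lerD (lexx _) hp); rewrite /dst -IntZ// -IntD//; last exact: L1Z.
apply: le_Int => //.
- apply: (@L1W (\sum_(r <- (r :: s)) `|r| + (`|r| + M))).
    apply: measurableT_comp => //; apply: measurable_funB.
      under eq_fun do rewrite big_cons.
      apply: measurable_funD => //; apply: measurable_funM => //; exact: measurable_indic.
    by apply: measurable_funD => //; exact: measurable_funM.
  move=> x; rewrite normr_id !big_cons; apply: le_trans (ler_normB _ _) _.
  apply: lerD; apply: le_trans (ler_normD _ _) _; apply: lerD => //.
    by rewrite normrM ler_piMr// ger0_norm; case/andP: (indic01 (A r) x).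
  by rewrite normrM ler_piMr// ger0_norm; case/andP: (q01 x).
- by apply: L1D => //; exact: L1Z.
move=> x; rewrite mulrCA -mulrDr ler_wpM2l//; first by case/andP: (W01 x).
rewrite big_cons -normrM mulrBr opprD addrACA; exact: ler_normD.
Qed.

Import HBSimple.

Lemma approx_L1 f : L1 f -> forall e, 0 < e -> exists2 phi, bounded_smooth phi &
  \int[mu]_x (W x * `|f x - phi x|) <= e.
Proof.
move=> Lf e e0; have e2 : 0 < e / 2 by rewrite divr_gt0.
have [g [Lg _ cg]] := approximation_sfun_integrable measurableT Lf.
have LB n : L1 (fun x => f x - g n x) by apply: L1B => //; exact: Lg.
have cg' : \int[mu]_x `|f x - g n x| @[n --> \oo] --> (0 : R).
  exact: (fine_cvg cg).
have [N _ /(_ N (leqnn N)) hN] := (cvgrPdist_le _ _).1 cg' _ e2.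
have {}hN : \int[mu]_x `|f x - g N x| <= e / 2.
  by apply: le_trans hN; rewrite sub0r normrN ler_norm.
pose A r := g N @^-1` [set r] : set B.
have mA r : measurable (A r) by exact: measurable_funPTI.
have [phi [sp [M pM]] hp] := @approx_simple (finmap.enum_fset (fset_set (range (g N)))) A mA _ e2.
exists phi => //; first by split => //; exists M.
have gE x : g N x = \sum_(r <- finmap.enum_fset (fset_set (range (g N)))) r * \1_(A r) x.
  by rewrite fimfunE fsbig_finite.
have {}hp : \int[mu]_x (W x * `|g N x - phi x|) <= e / 2.
  by under eq_Rintegral do rewrite gE.
have mf := L1_measurable Lf; have mp := smooth_measurable sp; have mg := L1_measurable (Lg N).
have LW f' M' : L1 f' -> L1 (fun x => W x * (`|f' x| + M')).
  move=> Lf'; have mf' := L1_measurable Lf'.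
  rewrite (_ : (fun x => _) = fun x => W x * `|f' x| + M' * W x); last first.
    by apply/funext => x; rewrite mulrDr [W x * M']mulrC.
  apply: L1D; last by apply: L1Z; exact: test_L1.
  apply: (@L1_dom _ B R mu _ (fun x => `|f' x|)); last exact: L1_norm.
    by apply: measurable_funM => //; exact: measurableT_comp.
  by move=> x; rewrite normrM normr_id (ger0_norm (andP (W01 x)).1) ler_piMl// (andP (W01 x)).2.
have LWp f' : L1 f' -> L1 (fun x => W x * `|f' x - phi x|).
  move=> Lf'; have mf' := L1_measurable Lf'; apply: (L1_dom _ _ (LW f' M Lf')).
    by apply: measurable_funM => //; apply: measurableT_comp => //; exact: measurable_funB.
  move=> x; rewrite normrM normr_id (ger0_norm (andP (W01 x)).1) ler_wpM2l ?(andP (W01 x)).1//.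
  by apply: le_trans (ler_normB _ _) _; rewrite lerD2l.
rewrite [e]splitr; apply: le_trans (lerD hN hp); rewrite -IntD; last 2 first.
- exact: L1_norm.
- by apply: LWp; exact: Lg.
apply: le_Int; first exact: LWp.
- by apply: L1D; [exact: L1_norm|apply: LWp; exact: Lg].
move=> x; have /andP[W0 W1] := W01 x.
apply: (@le_trans _ _ (W x * `|f x - g N x| + W x * `|g N x - phi x|)).
  by rewrite -mulrDr ler_wpM2l// ler_distD.
by rewrite lerD2r ler_piMl.
Unshelve. all: by end_near. Qed.

End weight.

(** Cut f off at a large radius, then approximate f by a bounded smooth function
    in L1 for the weight given by the same cutoff. *)
Lemma test_dense_L1 f : L1 f -> forall e, 0 < e -> exists2 phi, test_function phi &
  \int[mu]_x `|f x - phi x| <= e.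
Proof.
move=> Lf e e0; have e2 : 0 < e / 2 by rewrite divr_gt0.
have mf := L1_measurable Lf.
have mc r : measurable_fun setT (@cutoff R d r : B -> R) by apply: smooth_measurable; exact: cutoff_smooth.
have cv : \int[mu]_x `|f x - cutoff n.+1%:R x * f x| @[n --> \oo] --> (0 : R).
  rewrite [X in _ --> X](_ : _ = \int[mu]_x (fun=> 0) x); last first.
    by rewrite /Rintegral integral0.
  apply: (@Int_cvg _ B R mu _ _ (fun x => `|f x|)).
  - move=> n; apply: measurableT_comp => //; apply: measurable_funB => //; exact: measurable_funM.
  - move=> x; apply: cvg_near_cst; near=> n; rewrite cutoff_eq1 ?mul1r ?subrr ?normr0//.
    apply: (@le_trans _ _ n%:R); last by rewrite ler_nat.
    near: n; exact: nbhs_infty_ger.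
  - exact: L1_norm.
  - move=> n x; rewrite normr_id -{1}(mul1r (f x)) -mulrBl normrM ler_piMl//.
    by rewrite ger0_norm ?subr_ge0 ?cutoff_le1// gerBl cutoff_ge0.
have [N _ /(_ N (leqnn N)) hN] := (cvgrPdist_le _ _).1 cv _ e2.
have {}hN : \int[mu]_x `|f x - cutoff N.+1%:R x * f x| <= e / 2.
  by apply: le_trans hN; rewrite sub0r normrN ler_norm.
pose W := @cutoff R d N.+1%:R.
have tW : test_function W by exact: cutoff_test.
have W01 x : 0 <= W x <= 1 by rewrite cutoff_ge0 cutoff_le1.
have [phi [sp [M pM]] hp] := approx_L1 tW W01 Lf e2.
have tp : test_function (fun x => phi x * W x) by exact: test_functionMl.
exists (fun x => phi x * W x) => //.
have La : L1 (fun x => `|f x - W x * f x|).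
  apply: L1_norm; apply: L1B => //; apply: (L1_dom _ _ (L1_norm Lf)); first by apply: measurable_funM => //; exact: mc.
  by move=> x; rewrite normrM (ger0_norm (andP (W01 x)).1) ler_piMl// (andP (W01 x)).2.
have Lb : L1 (fun x => W x * f x - phi x * W x).
  apply: L1B; last exact: test_L1.
  apply: (L1_dom _ _ (L1_norm Lf)); first by apply: measurable_funM => //; exact: mc.
  by move=> x; rewrite normrM (ger0_norm (andP (W01 x)).1) ler_piMl// (andP (W01 x)).2.
have {}hp : \int[mu]_x `|W x * f x - phi x * W x| <= e / 2.
  apply: le_trans hp; rewrite le_eqVlt; apply/orP; left; apply/eqP.
  apply: eq_Rintegral => x _; rewrite [phi x * _]mulrC -mulrBr normrM.
  by rewrite (ger0_norm (andP (W01 x)).1).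
rewrite [e]splitr; apply: le_trans (lerD hN hp); rewrite -IntD//; last exact: L1_norm.
apply: le_Int; first by apply: L1_norm; apply: L1B => //; exact: test_L1.
  by apply: L1D => //; exact: L1_norm.
by move=> x; exact: ler_distD.
Unshelve. all: by end_near. Qed.

Lemma test_dense_L1vec (sigma : V -> V) : L1vec mu sigma -> forall e, 0 < e ->
  exists2 tau : V -> V, forall i, test_function (fun x => tau x 0 i) &
    vI mu (fun x => sigma x - tau x) <= e.
Proof.
move=> Ls e e0.
have D0 : 0 < d%:R + 1 :> R by rewrite ltr_wpDl.
have ed : 0 < e / (d%:R + 1) by rewrite divr_gt0.
have /choice[phi hphi] : forall i : 'I_d, exists phi, test_function phi /\
    \int[mu]_x `|sigma x 0 i - phi x| <= e / (d%:R + 1).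
  by move=> i; have [phi ? ?] := test_dense_L1 (Ls i) ed; exists phi.
pose tau x : V := \row_i phi i x.
have tE i : (fun x => tau x 0 i) = phi i by apply/funext => x; rewrite mxE.
exists tau => [i|]; first by rewrite tE; case: (hphi i).
have Li i : L1 (fun x => `|sigma x 0 i - phi i x|).
  by apply: L1_norm; apply: L1B; [exact: Ls|apply: test_L1; case: (hphi i)].
have Lt : L1vec mu tau.
  move=> i; have := test_L1 (hphi i).1; rewrite -tE; exact.
apply: (@le_trans _ _ (\int[mu]_x (\sum_i `|sigma x 0 i - phi i x|))).
  apply: le_Int; first by apply: L1vec_enorm; exact: L1vecB.
    by apply: L1_sum => i; exact: Li.
  move=> x; apply: le_trans (enorm_le_sum _) _; apply: ler_sum => i _.
  by rewrite !mxE.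
have : forall s : seq 'I_d, \int[mu]_x (\sum_(i <- s) `|sigma x 0 i - phi i x|) <=
    (size s)%:R * (e / (d%:R + 1)).
  elim=> [|i s IH].
    under eq_Rintegral do rewrite big_nil.
    by rewrite /Rintegral integral0 mul0r.
  under eq_Rintegral do rewrite big_cons.
  rewrite IntD; [|exact: Li|by apply: L1_sum => j; exact: Li].
  by rewrite /= -natr1 mulrDl mul1r addrC lerD//; case: (hphi i).
move=> /(_ (index_enum _)) /le_trans; apply.
rewrite -[size _]/(size (index_enum _)) (_ : size _ = d); last first.
  by rewrite -[RHS]card_ord cardT enumT.
rewrite mulrCA ler_piMr ?(ltW e0)// ler_pdivrMr ?mul1r ?lerDl//.
Qed.

End L1_density.

(** * Change of measure *)

Section change_of_measure.
Context d0 (T : measurableType d0) (R : realType).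
Implicit Types (m : {measure set T -> \bar R}) (f : T -> R).

Lemma L1E m f : L1 m f <-> measurable_fun setT f /\ (\int[m]_x (`|f x|)%:E < +oo)%E.
Proof.
split=> [Lf|[mf h]]; first by split; [exact: L1_measurable Lf|move/integrableP: Lf => []].
by apply/integrableP; split; [exact/measurable_EFinP|].
Qed.

Lemma L1_measure_le m1 m2 f : (forall S, measurable S -> m1 S <= m2 S)%E -> L1 m2 f -> L1 m1 f.
Proof.
move=> m12 /L1E[mf h]; apply/L1E; split => //; apply: le_lt_trans h.
apply: ge0_le_measure_integral => //.
by apply/measurable_EFinP; exact: measurableT_comp.
Qed.

Lemma Int_measure_add m1 m2 m3 f : (forall S, measurable S -> m3 S = m1 S + m2 S)%E ->
  L1 m1 f -> L1 m2 f -> \int[m3]_x f x = \int[m1]_x f x + \int[m2]_x f x.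
Proof.
move=> e L1f L2f; rewrite /Rintegral (@eq_measure_integral _ _ _ _ (measure_add m1 m2)).
  by rewrite integral_measure_add// fineD//; exact: integrable_fin_num.
by move=> A mA _; rewrite (e _ mA); apply/esym; exact: measure_addE.
Qed.

Lemma Int_mscale m (k : {nonneg R}) f : L1 m f ->
  L1 (mscale k m) f /\ \int[mscale k m]_x f x = k%:num * \int[m]_x f x.
Proof.
have H0 (g : T -> R) : (forall x, 0 <= g x) -> L1 m g -> L1 (mscale k m) g /\
    \int[mscale k m]_x g x = k%:num * \int[m]_x g x.
  move=> g0 Lg; have /L1E[mg hg] := Lg.
  have e : (\int[mscale k m]_x (g x)%:E = k%:num%:E * \int[m]_x (g x)%:E)%E.
    by apply: ge0_integral_mscale => //; [exact/measurable_EFinP|move=> x _; rewrite lee_fin].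
  split; last by rewrite /Rintegral e EFin_Int.
  apply/L1E; split => //; under eq_integral do rewrite ger0_norm//.
  by rewrite e EFin_Int// -EFinM ltry.
move=> Lf; have [L1a ea] := H0 _ (fun x => normr_ge0 (f x)) (L1_norm Lf).
have [x|L1b eb] := H0 (fun x => `|f x| + f x) _ (L1D (L1_norm Lf) Lf).
  by have := lerNnormlW (lexx `|f x|); lra.
have e : f = fun x => (`|f x| + f x) - `|f x| by apply/funext => x; rewrite addrC addKr.
split; first by rewrite e; exact: L1B.
rewrite [LHS](_ : _ = \int[mscale k m]_x ((`|f x| + f x) - `|f x|)); last by rewrite -e.
rewrite (IntB L1b L1a) ea eb (IntD (L1_norm Lf) Lf); ring.
Qed.

Lemma Int_null m (A : set T) f : measurable A -> m (~` A) = 0%E -> 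
  \int[m]_x f x = \int[m]_x (f x * \1_A x).
Proof.
move=> mA mA0; apply: ae_eq_Rintegral; exists (~` A); split => //; first exact: measurableC.
by move=> x /=; apply: contra_not => Ax; rewrite indicE mem_set// mulr1.
Qed.

Lemma Int_mrestr m (E : set T) (mE : measurable E) f : measurable_fun setT f ->
  L1 m (fun x => f x * \1_E x) ->
  L1 (mrestr m mE) f /\ \int[mrestr m mE]_x f x = \int[m]_x (f x * \1_E x).
Proof.
move=> mf Lg; set g := fun x => f x * \1_E x.
have mE' : measurable (~` E) by exact: measurableC.
have le1 S : measurable S -> (mrestr m mE S <= m S)%E.
  by move=> mS; rewrite /mrestr le_measure// ?inE//; exact: measurableI.
have le2 S : measurable S -> (mrestr m mE' S <= m S)%E.
  by move=> mS; rewrite /mrestr le_measure// ?inE//; exact: measurableI.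
have z1 : mrestr m mE (~` E) = 0%E by rewrite /mrestr setICl measure0.
have z2 : mrestr m mE' (~` ~` E) = 0%E by rewrite /mrestr setCK setICr measure0.
have La := L1_measure_le le1 Lg; have Lb := L1_measure_le le2 Lg.
split.
  apply/L1E; split => //.
  move/L1E : La => [_]; apply: le_lt_trans; rewrite le_eqVlt; apply/orP; left; apply/eqP.
  apply: ae_eq_integral_nm; exists (~` E); split => //.
  by move=> x /=; apply: contra_not => Ax; rewrite /g indicE mem_set// mulr1.
rewrite (Int_null _ mE z1) (@Int_measure_add (mrestr m mE) (mrestr m mE') m)//.
  rewrite [X in _ + X](_ : _ = 0) ?addr0// (Int_null _ mE' z2).
    under eq_Rintegral => x _.
      rewrite -mulrA (_ : \1_E x * _ = 0) ?mulr0; last first.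
        by rewrite !indicE in_setC; case: (x \in E) => /=; rewrite ?mulr0 ?mul0r.
      over.
    by rewrite /Rintegral integral0.
move=> S mS; have := @measureU _ _ _ m (S `&` E) (S `&` ~` E).
rewrite -setIUr setUv setIT; apply.
- exact: measurableI.
- exact: measurableI.
- by rewrite setIACA setICr setI0.
Qed.

End change_of_measure.

(** * The Kantorovich-Rubinstein distance and the Arens-Eells space *)

Section KR.
Context (R : realType) (d : nat).
Local Notation V := 'rV[R]_d.
Local Notation B := (borel R d).
Local Notation Lip := (Lip R d).
Implicit Types (f g : Lip -> R) (u v w : Lip).

Lemma k_lipschitz_scale (k a : R) (u : V -> R) : k_lipschitz k u -> k_lipschitz (`|a| * k) (fun x => a * u x).
Proof. by move=> ku x y; rewrite -mulrBr normrM -mulrA ler_wpM2l// ku. Qed.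

Lemma k_lipschitzD (k l : R) (u v : V -> R) : k_lipschitz k u -> k_lipschitz l v ->
  k_lipschitz (k + l) (fun x => u x + v x).
Proof.
move=> ku lv x y; rewrite opprD addrACA mulrDl.
by apply: le_trans (ler_normD _ _) _; rewrite lerD.
Qed.

Lemma k_lipschitzW (k l : R) (u : V -> R) : k <= l -> k_lipschitz k u -> k_lipschitz l u.
Proof. by move=> kl ku x y; apply: le_trans (ku x y) _; apply: ler_wpM2r => //; exact: enorm_ge0. Qed.

Definition mkLip k (u : V -> R) (ku : k_lipschitz k u) : Lip := MkLip (ex_intro _ k ku).

Definition lipZ (a : R) u : Lip.
Proof. by exists (fun x => a * u x); case: (lip_funP u) => k ku; exists (`|a| * k); exact: k_lipschitz_scale. Defined.

Lemma lip_opp k u : k_lipschitz k u -> k_lipschitz k (lipZ (-1) u).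
Proof. by move=> ku; have := k_lipschitz_scale (-1) ku; rewrite normrN1 mul1r. Qed.

Definition lip0 : Lip.
Proof. by exists (fun=> 0); exists 0 => x y; rewrite subrr normr0 mul0r. Defined.

Lemma linZ f a u v : linear_form f -> (forall x, v x = a * u x) -> f v = a * f u.
Proof. by move=> lf uv; rewrite (lf a 0 u u v) ?mul0r ?addr0// => x; rewrite uv mul0r addr0. Qed.

Lemma lin0 f : linear_form f -> f lip0 = 0.
Proof. by move=> lf; rewrite (linZ (a := 0) (u := lip0) lf) ?mul0r// => x; rewrite mul0r. Qed.

Lemma KRdist_le f g (e : \bar R) : (forall u, k_lipschitz 1 u -> (f u - g u)%:E <= e)%E -> (KRdist f g <= e)%E.
Proof. by move=> h; apply: ge_ereal_sup => _ [u /= ku <-]; exact: h. Qed.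

Lemma KRdist_ge f g u : k_lipschitz 1 u -> ((f u - g u)%:E <= KRdist f g)%E.
Proof. by move=> ku; apply: ereal_sup_ubound; exists u. Qed.

Lemma KRdist_ge0 f g : linear_form f -> linear_form g -> (0 <= KRdist f g)%E.
Proof.
move=> lf lg; apply: le_trans (@KRdist_ge f g lip0 _); first by rewrite !lin0// subrr.
by move=> x y; rewrite subrr normr0 mul1r; exact: enorm_ge0.
Qed.

Lemma KRdist_triangle f g (k : Lip -> R) : (KRdist f k <= KRdist f g + KRdist g k)%E.
Proof.
apply: KRdist_le => u ku; rewrite -(subrKA (g u)) EFinD.
by apply: leeD; exact: KRdist_ge.
Qed.

Lemma KRdistC f g : linear_form f -> linear_form g -> KRdist f g = KRdist g f.
Proof.
suff H f' g' : linear_form f' -> linear_form g' -> (KRdist f' g' <= KRdist g' f')%E.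
  by move=> lf lg; apply/eqP; rewrite eq_le !H.
move=> lf lg; apply: KRdist_le => u ku.
have ku' : k_lipschitz 1 (lipZ (-1) u).
  exact: lip_opp.
have := @KRdist_ge g' f' _ ku'.
rewrite (@linZ f' (-1) u)// (@linZ g' (-1) u)//; apply: le_trans.
by rewrite lee_fin !mulN1r opprK addrC.
Qed.

Lemma KR_scale f g (e C : R) : linear_form f -> linear_form g -> 0 < C ->
  (forall u, k_lipschitz 1 u -> f u - g u <= e) ->
  forall u, k_lipschitz C u -> `|f u - g u| <= C * e.
Proof.
move=> lf lg C0 h.
have H u : k_lipschitz C u -> f u - g u <= C * e.
  move=> Cu; have ku' : k_lipschitz 1 (lipZ C^-1 u).
    by have := k_lipschitz_scale C^-1 Cu; rewrite gtr0_norm ?invr_gt0// mulVf ?gt_eqF.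
  have := h _ ku'; rewrite (@linZ f C^-1 u)// (@linZ g C^-1 u)// -mulrBr.
  by rewrite ler_pdivrMl.
move=> u Cu; rewrite ler_norml (H _ Cu) andbT lerNl.
have Cu' : k_lipschitz C (lipZ (-1) u).
  exact: lip_opp.
have := H _ Cu'; rewrite (@linZ f (-1) u)// (@linZ g (-1) u)//.
by rewrite !mulN1r opprB opprK addrC.
Qed.

Lemma KRdist_lt f g (e : R) u : (KRdist f g < e%:E)%E -> k_lipschitz 1 u -> f u - g u <= e.
Proof. by move=> h ku; rewrite -lee_fin; apply: le_trans (KRdist_ge _ _ ku) (ltW h). Qed.

Lemma M01_L1 (m : M01 R d) (u : V -> R) (A C : R) : measurable_fun setT (u : B -> R) ->
  (forall x, `|u x| <= A + C * enorm x) ->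
  L1 (jordan_pos (M01_hahn m)) u /\ L1 (jordan_neg (M01_hahn m)) u.
Proof.
move=> mu ub.
have me : measurable_fun setT (@enorm R d : B -> R) by apply: continuous_borel; exact: continuous_enorm.
have H (n : {finite_measure set B -> \bar R}) :
   (forall S, measurable S -> n S <= charge_variation (M01_hahn m) S)%E -> L1 n u.
  move=> nle.
  have Le : L1 n (@enorm R d).
    apply: (L1_measure_le nle); apply/L1E; split => //.
    under eq_integral do rewrite (ger0_norm (enorm_ge0 _)).
    exact: M01_moment.
  apply: (@L1_dom _ B R n _ (fun x => A + C * enorm x)) => //.
  apply: L1D; last exact: L1Z.
  exact: finite_measure_integrable_cst.
split; apply: H => S mS; rewrite /charge_variation.
  by rewrite leeDl.
by rewrite leeDr.
Qed.

Lemma lip_bound k u x : k_lipschitz k u -> `|u x| <= `|u 0| + k * enorm x.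
Proof.
move=> ku; rewrite -{1}(subrK (u 0) (u x)); apply: le_trans (ler_normD _ _) _.
by rewrite addrC lerD2l; have := ku x 0; rewrite subr0.
Qed.

Lemma lip_measurable u : measurable_fun setT (u : B -> R).
Proof. by case: (lip_funP u) => k ku; apply: continuous_borel; exact: k_lipschitz_continuous ku. Qed.

Lemma M01_L1lip (m : M01 R d) u : L1 (jordan_pos (M01_hahn m)) u /\ L1 (jordan_neg (M01_hahn m)) u.
Proof.
case: (lip_funP u) => k ku; apply: (@M01_L1 _ _ `|u 0| k); first exact: lip_measurable.
by move=> x; exact: lip_bound.
Qed.

Lemma M01_linear (m : M01 R d) : linear_form (M01_pairing m).
Proof.
move=> a b u v w e; have [pu nu] := M01_L1lip m u; have [pv nv] := M01_L1lip m v.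
rewrite /M01_pairing; under eq_Rintegral do rewrite e.
under [X in _ - X]eq_Rintegral do rewrite e.
by rewrite !IntD ?IntZ//; [ring| | | |]; exact: L1Z.
Qed.

Lemma M01_cvg (m : M01 R d) (u_ : nat -> Lip) u (A C : R) :
  (forall n x, `|u_ n x| <= A + C * enorm x) -> (forall x, u_ n x @[n --> \oo] --> u x) ->
  M01_pairing m (u_ n) @[n --> \oo] --> M01_pairing m u.
Proof.
move=> ub cu.
have [p n] := @M01_L1 m (fun x => A + C * enorm x) A C
  ltac:(by apply: measurable_funD => //; apply: measurable_funM => //; apply: continuous_borel; exact: continuous_enorm)
  ltac:(by move=> x; rewrite ger0_norm//; exact: le_trans (ub 0 x)).
by apply: cvgB; apply: (@Int_cvg _ B R _ _ _ (fun x => A + C * enorm x)) => // k;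
  exact: lip_measurable.
Qed.

(** For an element of M01 this is dominated convergence; elements of AE are
    approximated by elements of M01 uniformly on C-Lipschitz functions. *)
Lemma AE_cvg f (u_ : nat -> Lip) u (A C : R) : 0 < C -> AE f ->
  (forall n, k_lipschitz C (u_ n)) -> k_lipschitz C u ->
  (forall n x, `|u_ n x| <= A + C * enorm x) -> (forall x, u_ n x @[n --> \oo] --> u x) ->
  f (u_ n) @[n --> \oo] --> f u.
Proof.
move=> C0 [lf hf] Cu_ Cu ub cu; apply/cvgrPdist_le => e e0.
have e3 : 0 < e / (3 * C) by rewrite divr_gt0// mulr_gt0.
have [m hm] := hf _ e3.
have lm := @M01_linear m.
have H := KR_scale lf lm C0 (fun u ku => KRdist_lt hm ku).
have eC : C * (e / (3 * C)) = e / 3 by field; rewrite gt_eqF.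
have e33 : 0 < e / 3 by rewrite divr_gt0.
near=> n.
have h1 := H _ Cu; have h2 := H _ (Cu_ n).
have h3 : `|M01_pairing m u - M01_pairing m (u_ n)| <= e / 3.
  by near: n; apply: (cvgrPdist_le _ _).1 e33; exact: M01_cvg ub cu.
rewrite eC in h1 h2.
have -> : f u - f (u_ n) = (f u - M01_pairing m u) + (M01_pairing m u - M01_pairing m (u_ n))
   - (f (u_ n) - M01_pairing m (u_ n)) by ring.
apply: le_trans (ler_normB _ _) _; have := ler_normD (f u - M01_pairing m u) (M01_pairing m u - M01_pairing m (u_ n)).
by move: h1 h2 h3; lra.
Unshelve. all: by end_near. Qed.

(** A sequence of counterexamples would consist of equi-Lipschitz functions
    tending to 0, against AE_cvg. *)
Lemma AE_small f (C e : R) : AE f -> 0 < C -> 0 < e -> exists2 dl, 0 < dl &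
  forall z : Lip, k_lipschitz C z -> (forall x, `|z x| <= dl) -> `|f z| <= e.
Proof.
move=> Af C0 e0; apply: contrapT => H.
have /choice[vs hvs] : forall n : nat, exists v : Lip, [/\ k_lipschitz C v,
    forall x, `|v x| <= n.+1%:R^-1 & e < `|f v|].
  move=> n; apply: contrapT => H'; apply: H; exists n.+1%:R^-1; first by rewrite invr_gt0.
  by move=> v kv vb; rewrite leNgt; apply/negP => ev; apply: H'; exists v.
have vb n x : `|vs n x| <= n.+1%:R^-1 by case: (hvs n) => _ hb _; exact: hb.
have k0 : k_lipschitz C lip0.
  by move=> x y; rewrite subrr normr0 mulr_ge0 ?enorm_ge0// ltW.
have cv : f (vs n) @[n --> \oo] --> f lip0.
  apply: (@AE_cvg f vs lip0 1 C) => //.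
  - by move=> n; case: (hvs n).
  - move=> n x; apply: le_trans (vb n x) _; apply: (@le_trans _ _ 1).
      by rewrite invf_le1 ?ler1n.
    by rewrite lerDl mulr_ge0 ?enorm_ge0// ltW.
  - move=> x; apply/cvgrPdist_le => e' e'0; near=> n.
    rewrite sub0r normrN; apply: le_trans (vb n x) _.
    by near: n; apply: filterS (near_infty_natSinv_lt (PosNum e'0)) => m /ltW.
have [lf _] := Af; rewrite lin0// in cv.
have [N _ /(_ N (leqnn N))] := (cvgrPdist_le _ _).1 cv _ e0.
by rewrite sub0r normrN leNgt; case: (hvs N) => _ _ ->.
Unshelve. all: by end_near. Qed.

(** By test_dense, every Lipschitz function is a limit of test functions in the
    sense of AE_cvg. *)
Lemma AE_unique f g : AE f -> AE g -> (forall u, test_function u -> f u = g u) -> f = g.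
Proof.
move=> Af Ag fg; have [lf _] := Af; have [lg _] := Ag.
have [C C1 dens] := test_dense R d; have C0 : 0 < C by exact: lt_le_trans C1.
suff H u : k_lipschitz 1 u -> f u = g u.
  apply/funext => u; case: (lip_funP u) => k ku.
  have K0 : 0 < `|k| + 1 by rewrite ltr_wpDl.
  have ku' : k_lipschitz 1 (lipZ (`|k| + 1)^-1 u).
    apply: (@k_lipschitzW (`|(`|k| + 1)^-1| * k)); last exact: k_lipschitz_scale.
    rewrite gtr0_norm ?invr_gt0// ler_pdivrMl// mulr1.
    by apply: le_trans (ler_norm _) _; rewrite lerDl.
  have := H _ ku'; rewrite (@linZ f (`|k| + 1)^-1 u)// (@linZ g (`|k| + 1)^-1 u)//.
  by move=> /(mulfI _); apply; rewrite invr_eq0 gt_eqF.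
move=> ku; have [v [tv Cv cv bv]] := dens _ ku.
pose v_ n := mkLip (Cv n).
have Cu : k_lipschitz C u by exact: k_lipschitzW ku.
have bv' n x : `|v_ n x| <= `|u 0| + 1 + C * enorm x.
  by apply: le_trans (bv n x) _; rewrite lerD2l; apply: ler_peMl => //; exact: enorm_ge0.
have cf := @AE_cvg f v_ u _ C C0 Af Cv Cu bv' cv; have cg := @AE_cvg g v_ u _ C C0 Ag Cv Cu bv' cv.
have e : (fun n => f (v_ n)) = (fun n => g (v_ n)) by apply/funext => n; apply: fg; exact: tv.
rewrite e in cf; rewrite -(cvg_lim (@Rhausdorff R) cf) -(cvg_lim (@Rhausdorff R) cg)//.
Qed.

Lemma AE_limit f : linear_form f ->
  (forall e : R, 0 < e -> exists2 g, AE g & forall u, k_lipschitz 1 u -> f u - g u <= e) -> AE f.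
Proof.
move=> lf h; split => // e e0; have e3 : 0 < e / 3 by rewrite divr_gt0.
have [g [lg Ag] fg] := h _ e3; have [m hm] := Ag _ e3; exists m.
apply: (@le_lt_trans _ _ (e / 3 + e / 3)%:E); last by rewrite lte_fin; lra.
apply: KRdist_le => u ku; rewrite lee_fin -(subrKA (g u)) lerD ?fg//.
exact: KRdist_lt ku.
Qed.

(** The Jordan parts of n1 - n2 lie below n1 and n2, which gives the moment; the
    pairing follows from the identity n1 + neg = n2 + pos between measures. *)
Lemma M01_diff (n1 n2 : {finite_measure set B -> \bar R}) :
  n1 setT = n2 setT -> L1 n1 (@enorm R d) -> L1 n2 (@enorm R d) ->
  exists m : M01 R d, forall u, M01_pairing m u = \int[n1]_x u x - \int[n2]_x u x.
Proof.
move=> n12 L1e L2e.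
pose c1 : {charge set B -> \bar R} := charge_of_finite_measure n1.
pose c2 : {charge set B -> \bar R} := copp (charge_of_finite_measure n2).
pose c : {charge set B -> \bar R} := cadd c1 c2.
have cE A : c A = (n1 A - n2 A)%E by [].
have [P [N hPN]] := Hahn_decomposition c.
have [[mP _] [mN _] _ _] := hPN.
have fin1 A : measurable A -> n1 A \is a fin_num by move=> mA; exact: fin_num_measure.
have fin2 A : measurable A -> n2 A \is a fin_num by move=> mA; exact: fin_num_measure.
have le1 S : measurable S -> (jordan_pos hPN S <= n1 S)%E.
  move=> mS; rewrite jordan_posE cjordan_posE /crestr0 mem_set// /crestr cE.
  apply: (@le_trans _ _ (n1 (S `&` P))).
    by rewrite leeBlDr ?fin2//; [rewrite leeDl|exact: measurableI].
  by apply: le_measure; rewrite ?inE//; exact: measurableI.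
have le2 S : measurable S -> (jordan_neg hPN S <= n2 S)%E.
  move=> mS; rewrite jordan_negE cjordan_negE /crestr0 mem_set// /crestr cE.
  have mSN : measurable (S `&` N) by exact: measurableI.
  apply: (@le_trans _ _ (n2 (S `&` N))).
    have : (0 <= n1 (S `&` N))%E by exact: measure_ge0.
    have := fin1 _ mSN; have := fin2 _ mSN.
    move: (n1 (S `&` N)) (n2 (S `&` N)) => [a| |] [b| |] //= _ _.
    by rewrite !lee_fin => a0; lra.
  by apply: le_measure; rewrite ?inE.
have mass0 : c setT = 0%E by rewrite cE n12 subee// fin2.
have me : measurable_fun setT (@enorm R d : B -> R) by apply: continuous_borel; exact: continuous_enorm.
have moment : (\int[charge_variation hPN]_x (enorm (x : V))%:E < +oo)%E.
  rewrite (@eq_measure_integral _ _ _ _ (measure_add (jordan_pos hPN) (jordan_neg hPN))); last first.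
    by move=> A mA _; apply/esym; exact: measure_addE.
  rewrite ge0_integral_measure_add//; [|by move=> x _; rewrite lee_fin enorm_ge0|exact/measurable_EFinP].
  apply: lte_add_pinfty; [have := integrable_lty measurableT (L1_measure_le le1 L1e)|
     have := integrable_lty measurableT (L1_measure_le le2 L2e)]; exact.
exists (MkM01 mass0 moment) => u; rewrite /M01_pairing /=.
case: (lip_funP u) => k ku.
have L1u (n : {finite_measure set B -> \bar R}) : L1 n (@enorm R d) -> L1 n u.
  move=> Le; apply: (@L1_dom _ B R n _ (fun x => `|u 0| + k * enorm x)).
  - exact: lip_measurable.
  - by move=> x; exact: lip_bound.
  - by apply: L1D; [exact: finite_measure_integrable_cst|exact: L1Z].
have l1 := L1u _ L1e; have l2 := L1u _ L2e.
have lp := L1_measure_le le1 l1; have ln := L1_measure_le le2 l2.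
apply/eqP; rewrite subr_eq addrAC -subr_eq opprK; apply/eqP.
rewrite -(@Int_measure_add _ _ _ _ _ (measure_add (jordan_pos hPN) n2))//; last first.
  by move=> S mS; exact: measure_addE.
rewrite -(@Int_measure_add _ _ _ _ _ (measure_add (jordan_pos hPN) n2))//.
move=> S mS; rewrite [LHS]measure_addE.
suff : (jordan_pos hPN S + n2 S = n1 S + jordan_neg hPN S)%E by [].
have : (n1 S - n2 S = jordan_pos hPN S - jordan_neg hPN S)%E.
  by rewrite -cE (jordan_decomp hPN mS) /cadd/= cscaleN1.
have := fin1 _ mS; have := fin2 _ mS.
have : jordan_pos hPN S \is a fin_num by exact: fin_num_measure.
have : jordan_neg hPN S \is a fin_num by exact: fin_num_measure.
move: (jordan_pos hPN S) (jordan_neg hPN S) (n1 S) (n2 S) => [a| |] [b| |] [p| |] [q| |] //= _ _ _ _.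
by rewrite -!EFinB => -[h]; congr (_%:E); lra.
Qed.

End KR.

(** * Difference quotients belong to the Arens-Eells space *)

Section finite_measures.
Context (R : realType).

Lemma finite_measure_of d0 (T : measurableType d0) (m : {measure set T -> \bar R}) : (m setT < +oo)%E ->
  exists n : {finite_measure set T -> \bar R}, forall A, n A = m A.
Proof.
move=> mf; exists (mfrestr measurableT mf) => A.
exact: (congr1 m (setIT A)).
Qed.

Lemma pushforward_finite d0 (T : measurableType d0) (m : {finite_measure set T -> \bar R}) d1 (T1 : measurableType d1) (F : T -> T1) :
  measurable_fun setT F ->
  exists n : {finite_measure set T1 -> \bar R}, (forall A, n A = m (F @^-1` A)) /\
   forall f : T1 -> R, measurable_fun setT f -> L1 m (f \o F) ->
     L1 n f /\ \int[n]_x f x = \int[m]_x f (F x).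
Proof.
move=> mF.
pose p : {measure set T1 -> \bar R} := pushforward m F.
have [|n nE] := @finite_measure_of _ _ (p mF).
  rewrite -[X in (X < _)%E]/(m (F @^-1` setT)) preimage_setT.
  by rewrite -ge0_fin_numE ?measure_ge0// fin_num_measure.
exists n; split => // f mf Lf.
have Le : forall g : T1 -> \bar R, (\int[n]_x g x = \int[p mF]_x g x)%E.
  by move=> g; apply: eq_measure_integral => A _ _; exact: nE.
have Lp : (p mF).-integrable setT (EFin \o f).
  apply: (integrable_pushforward mF) => //; exact/measurable_EFinP.
have Ln : L1 n f.
  apply/L1E; split => //; rewrite Le.
  by move/integrableP: Lp => [].
split => //; rewrite /Rintegral Le; congr fine.
rewrite (integral_pushforward mF)//; first by exact/measurable_EFinP.
Qed.

End finite_measures.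

Section Dh_in_AE.
Context (R : realType) (d : nat).
Local Notation V := 'rV[R]_d.
Local Notation B := (borel R d).
Variable mu : {measure set B -> \bar R}.
Hypothesis mu_radon : radon mu.
Local Notation L1 := (L1 mu).

Lemma L1_ball k (u : V -> R) (sigma : V -> V) (h r : R) : 0 <= k -> k_lipschitz k u -> L1vec mu sigma ->
  L1 (fun x => u (x + h *: sigma x) * \1_(eball r : set B) x).
Proof.
move=> k0 ku Ls; have ms := L1vec_mvec Ls.
apply: (@L1_dom _ B R mu _ (fun x => (`|u 0| + k * r) * \1_(eball r : set B) x + k * `|h| * enorm (sigma x))).
- apply: measurable_funM; last by apply: measurable_indic; exact: eball_borel.
  apply: (@mvec_comp _ _ (fun x => x + h *: sigma x)); last exact: k_lipschitz_continuous ku.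
  by apply: mvecD; [exact: mvec_id|exact: mvecZ].
- move=> x; rewrite normrM indicE; have [xr|xr] := leP (enorm x) r; last first.
    rewrite memNset; last by apply/negP; rewrite -ltNge.
    rewrite normr0 !mulr0 add0r; apply: mulr_ge0; last exact: enorm_ge0.
    exact: mulr_ge0.
  rewrite mem_set//= normr1 !mulr1.
  have -> : u (x + h *: sigma x) = u 0 + (u x - u 0) + (u (x + h *: sigma x) - u x) by ring.
  apply: le_trans (ler_normD _ _) _; apply: lerD.
    apply: le_trans (ler_normD _ _) _; rewrite lerD2l.
    apply: le_trans (ku _ _) _; rewrite subr0.
    by apply: ler_wpM2l.
  apply: le_trans (ku _ _) _; rewrite addrAC subrr add0r enormZ mulrA.
  by [].
- apply: L1D; last by apply: L1Z; exact: L1vec_enorm.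
  by apply: L1Z; apply: L1_indic; [exact: eball_borel|exact: eball_fin].
Qed.

Lemma tail_small (g : V -> R) (e : R) : L1 g -> (forall x, 0 <= g x) -> 0 < e ->
  exists2 r : R, 0 < r & \int[mu]_x (g x - g x * \1_(eball r : set B) x) <= e.
Proof.
move=> Lg g0 e0.
have cv : \int[mu]_x (g x - g x * \1_(eball n.+1%:R : set B) x) @[n --> \oo] --> (0 : R).
  rewrite [X in _ --> X](_ : _ = \int[mu]_x (fun=> 0) x); last first.
    by rewrite /Rintegral integral0.
  have mg := L1_measurable Lg.
  apply: (@Int_cvg _ B R mu _ _ g) => //.
  - move=> n; apply: measurable_funB => //; apply: measurable_funM => //.
    by apply: measurable_indic; exact: eball_borel.
  - move=> x; apply: cvg_near_cst; near=> n; rewrite indicE mem_set ?mulr1 ?subrr//=.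
    apply: (@le_trans _ _ n%:R); last by rewrite ler_nat.
    near: n; exact: nbhs_infty_ger.
  - move=> n x; rewrite indicE; case: (_ \in _); rewrite ?mulr1 ?mulr0 ?subrr ?normr0 ?subr0//.
    by rewrite ger0_norm.
have [N _ /(_ N (leqnn N)) hN] := (cvgrPdist_le _ _).1 cv _ e0.
exists N.+1%:R => //; apply: le_trans hN; by rewrite sub0r normrN ler_norm.
Unshelve. all: by end_near. Qed.

(** On a large ball mu is finite and the quotient is the difference of the measure
    mu / h and its image by id + h sigma; outside the ball, a 1-Lipschitz
    function contributes at most the integral of |sigma|. *)
Lemma Dh_AE (sigma : V -> V) (h : R) : 0 < h -> L1vec mu sigma -> AE (Dh mu sigma h).
Proof.
move=> h0 Ls; have ms := L1vec_mvec Ls; split; first exact: Dh_linear.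
move=> e e0; have e2 : 0 < e / 2 by rewrite divr_gt0.
have Le := L1vec_enorm Ls.
have [r r0 hr] := @tail_small (fun x => enorm (sigma x)) _ Le (fun x => enorm_ge0 _) e2.
have mE : measurable (eball r : set B) by exact: eball_borel.
(* kap is mu / h restricted to the ball of radius r *)
pose hi : {nonneg R} := NngNum (ltW (divr_gt0 ltr01 h0)).
have [|kap kapE] := @finite_measure_of _ _ _ (mscale hi (mrestr mu mE)).
  rewrite /mscale; apply: lte_mul_pinfty => //.
  rewrite -[X in (X < _)%E]/(mu (setT `&` eball r)) setTI; exact: eball_fin.
have Ik (f : V -> R) : measurable_fun setT (f : B -> R) -> L1 (fun x => f x * \1_(eball r : set B) x) ->
    kap.-integrable setT (EFin \o f) /\ \int[kap]_x f x = h^-1 * \int[mu]_x (f x * \1_(eball r : set B) x).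
  move=> mf Lf; have [L1r er] := Int_mrestr mE mf Lf.
  have [L2r e2r] := Int_mscale hi L1r.
  split; first by apply: (L1_measure_le _ L2r) => S mS; rewrite le_eqVlt; apply/orP; left; apply/eqP; exact: kapE.
  rewrite -er -[h^-1]mul1r -[1 / h]/(hi%:num) -e2r /Rintegral; congr fine.
  by apply: eq_measure_integral => A _ _; exact: kapE.
pose F (x : V) := x + h *: sigma x.
have mvF : mvec F by apply: mvecD; [exact: mvec_id|exact: mvecZ].
have mF : measurable_fun setT (F : B -> B) by exact: measurable_rV.
have [n1 [n1E In1]] := pushforward_finite kap mF.
have L0 k (u : V -> R) : 0 <= k -> k_lipschitz k u -> L1 (fun x => u x * \1_(eball r : set B) x).
  move=> k0 ku; have := @L1_ball k u sigma 0 r k0 ku Ls.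
  by under eq_fun do rewrite scale0r addr0.
have Iu k (u : V -> R) : 0 <= k -> k_lipschitz k u ->
   [/\ n1.-integrable setT (EFin \o u), kap.-integrable setT (EFin \o u),
   \int[n1]_x u x = h^-1 * \int[mu]_x (u (F x) * \1_(eball r : set B) x) &
   \int[kap]_x u x = h^-1 * \int[mu]_x (u x * \1_(eball r : set B) x)].
  move=> k0 ku; have cu := k_lipschitz_continuous ku.
  have [La ea] := Ik u (continuous_borel cu) (L0 _ _ k0 ku).
  have [Lb eb] := Ik (u \o F) (mvec_comp mvF cu) (@L1_ball k u sigma h r k0 ku Ls).
  have [Lc ec] := In1 u (continuous_borel cu) Lb.
  by split => //; rewrite ec.
have ken : k_lipschitz 1 (@enorm R d) by move=> x y; rewrite mul1r enorm_dist.
have [Len1 Lekap _ _] := Iu _ _ ler01 ken.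
have [|m hm] := M01_diff _ Len1 Lekap; first by rewrite n1E preimage_setT.
exists m; apply: (@le_lt_trans _ _ (e / 2)%:E); last by rewrite lte_fin; lra.
apply: KRdist_le => u ku; rewrite lee_fin hm.
have [_ _ -> ->] := Iu _ _ ler01 ku.
have La := @L1_ball 1 u sigma h r ler01 ku Ls; have Lb := L0 _ _ ler01 ku.
rewrite -mulrBr -IntB// -IntZ; last exact: L1B.
have Lq := L1_quot h ku (@mvec_id _ _) Ls.
rewrite /Dh -IntB//; last by apply: L1Z; exact: L1B.
apply: le_trans hr; apply: le_Int.
- by apply: L1B => //; apply: L1Z; exact: L1B.
- apply: L1B => //; apply: (L1_dom _ _ Le).
    by apply: measurable_funM; [exact: measurable_enorm|exact: measurable_indic].
  move=> x; rewrite indicE; case: (_ \in _); rewrite ?mulr1 ?mulr0 ?normr0 ?(ger0_norm (enorm_ge0 _)) ?enorm_ge0//.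
move=> x; rewrite indicE; case: (_ \in _); first by rewrite !mulr1 subrr mulrC subrr.
rewrite !mulr0 !subr0 mulr0 subr0; apply: le_trans (ler_norm _) _.
by have := quot_le x (sigma x) h ku; rewrite mul1r.
Qed.

End Dh_in_AE.

(** * Smoothing along a flow *)

Section flow_smoothing.
Context (R : realType) (d : nat).
Local Notation V := 'rV[R]_d.
Local Notation B := (borel R d).
Variable mu : {measure set B -> \bar R}.
Hypothesis mu_radon : radon mu.
Local Notation L1 := (L1 mu).
Implicit Types (u v : V -> R) (sigma tau : V -> V).

(** The form Dh, on functions that do not carry a Lipschitz constant. *)
Definition quotI sigma h u := \int[mu]_x ((u (x + h *: sigma x) - u x) / h).

Lemma test_field_bounds tau : (forall i, test_function (fun x => tau x 0 i)) ->
  exists M L, [/\ 0 < M, 0 < L, forall x, enorm (tau x) <= M &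
    forall x y, enorm (tau x - tau y) <= L * enorm (x - y)].
Proof.
move=> tt.
have /choice[M hM] : forall i, exists M, 0 < M /\ forall x, `|tau x 0 i| <= M.
  by move=> i; have [M ? ?] := test_bounded (tt i); exists M.
have /choice[L hL] : forall i, exists L, 0 < L /\ k_lipschitz L (fun x => tau x 0 i).
  by move=> i; have [L ? ?] := test_lipschitz (tt i); exists L.
have M0 : 0 <= \sum_i M i by apply: sumr_ge0 => i _; rewrite ltW//; case: (hM i).
have L0 : 0 <= \sum_i L i by apply: sumr_ge0 => i _; rewrite ltW//; case: (hL i).
exists (1 + \sum_i M i), (1 + \sum_i L i); split; try by rewrite ltr_pwDl.
- move=> x; apply: le_trans (enorm_le_sum _) _; apply: ler_wpDl => //.
  by apply: ler_sum => i _; case: (hM i) => _; apply.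
- move=> x y; apply: le_trans (enorm_le_sum _) _.
  rewrite mulrDl mul1r; apply: ler_wpDl; first exact: enorm_ge0.
  by rewrite mulr_suml; apply: ler_sum => i _; rewrite !mxE; case: (hL i) => _; apply.
Qed.

Lemma test_flow u tau s C M L : test_function u -> (forall i, test_function (fun x => tau x 0 i)) ->
  0 <= s -> 0 <= C -> k_lipschitz C u -> 
  (forall x, enorm (tau x) <= M) ->
  (forall x y, enorm (tau x - tau y) <= L * enorm (x - y)) ->
  [/\ test_function (fun x => u (x + s *: tau x)),
    k_lipschitz (C * (1 + s * L)) (fun x => u (x + s *: tau x)) &
    forall x, `|u (x + s *: tau x) - u x| <= C * s * M].
Proof.
move=> tu tt s0 C0 Cu hM hL.
have /test_functionP[su [r r0 hr]] := tu.
split.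
- apply/test_functionP; split.
    apply: (smoothP _).2 => n.
    rewrite (_ : (fun x => _) = (fun x : V => u (\row_j (x 0 j + s * tau x 0 j)))); last first.
      by apply/funext => x; congr u; apply/rowP => j; rewrite !mxE.
    apply: (@Cn_comp _ _ n u (fun j (x : V) => x 0 j + s * tau x 0 j)); first exact: ((smoothP _).1 su).
    move=> j; apply: CnD; first exact: Cn_coord.
    by apply: CnZ; have [sj _] := tt j; exact: ((smoothP _).1 sj).
  exists (r + s * `|M|); first by rewrite ltr_pwDl// mulr_ge0.
  move=> x rx; apply: hr.
  have h1 : enorm x <= enorm (x + s *: tau x) + s * `|M|.
    rewrite -{1}(addrK (s *: tau x) x); apply: le_trans (enormB _ _) _.
    rewrite lerD2l enormZ (ger0_norm s0) ler_wpM2l//.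
    by apply: le_trans (hM x) (ler_norm _).
  by rewrite -(ltrD2r (s * `|M|)); apply: lt_le_trans rx h1.
- move=> x y; apply: le_trans (Cu _ _) _; rewrite -mulrA ler_wpM2l//.
  have -> : x + s *: tau x - (y + s *: tau y) = (x - y) + s *: (tau x - tau y).
    by rewrite scalerBr opprD addrACA.
  apply: le_trans (enormD _ _) _; rewrite mulrDl mul1r lerD2l enormZ (ger0_norm s0).
  by rewrite -mulrA ler_wpM2l.
- move=> x; apply: le_trans (Cu _ _) _; rewrite addrAC subrr add0r enormZ (ger0_norm s0) -mulrA.
  by rewrite ler_wpM2l// ler_wpM2l.
Qed.

(** Increments of u (x + s tau x) in the direction tau x, and of u at x + s tau x,
    differ by the displacement s (tau (x + t tau x) - tau x), of order s t L. *)
Lemma grad_flow u tau s C M L x : test_function u -> (forall i, test_function (fun x => tau x 0 i)) ->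
  0 <= s -> 0 <= C -> 0 <= L -> k_lipschitz C u ->
  (forall x, enorm (tau x) <= M) ->
  (forall x y, enorm (tau x - tau y) <= L * enorm (x - y)) ->
  `|dot (grad (fun x => u (x + s *: tau x)) x) (tau x) - dot (grad u (x + s *: tau x)) (tau x)|
    <= C * s * L * enorm (tau x).
Proof.
move=> tu tt s0 C0 L0 Cu hM hL; pose v x := u (x + s *: tau x).
have [[sv _] _ _] := test_flow tu tt s0 C0 Cu hM hL.
have [su _] := tu.
have c1 := @dirderiv _ _ v x (tau x) (smooth_diff x sv).
have c2 := @dirderiv _ _ u (x + s *: tau x) (tau x) (smooth_diff _ su).
have c : `|(v (x + t *: tau x) - v x) / t - (u (x + s *: tau x + t *: tau x) - u (x + s *: tau x)) / t|
    @[t --> (0:R)^'] --> `|dot (grad v x) (tau x) - dot (grad u (x + s *: tau x)) (tau x)|.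
  apply: cvg_norm; exact: (cvgB c1 c2).
apply: (cvgr_to_le c); near=> t.
have t0 : t != 0 by near: t; exact: nbhs_dnbhs_neq.
rewrite /= /v -mulrBl normrM normfV ler_pdivrMr ?normr_gt0//.
rewrite opprB addrA subrK.
apply: le_trans (Cu _ _) _.
have -> : x + t *: tau x + s *: tau (x + t *: tau x) - (x + s *: tau x + t *: tau x) =
  s *: (tau (x + t *: tau x) - tau x).
  by rewrite scalerBr [x + s *: _ + _]addrAC opprD addrACA subrr add0r.
rewrite enormZ (ger0_norm s0) -!mulrA ler_wpM2l// ler_wpM2l//.
apply: le_trans (hL _ _) _.
by rewrite addrAC subrr add0r enormZ [enorm _ * _]mulrC.
Unshelve. all: by end_near. Qed.

Lemma quotI_diff k u sigma tau h : 0 < h -> k_lipschitz k u ->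
  L1vec mu sigma -> L1vec mu tau ->
  `|quotI sigma h u - quotI tau h u| <= k * vI mu (fun x => sigma x - tau x).
Proof. by move=> h0 ku Ls Lt; exact: (@Dh_diff _ _ mu k (mkLip ku)). Qed.

Lemma test_field_L1 tau : (forall i, test_function (fun x => tau x 0 i)) -> L1vec mu tau.
Proof. by move=> tt i; exact: test_L1 (tt i). Qed.

(** The integral of u (x + s tau x) - u x is differentiable in s. *)
Lemma quotI_mvt u tau h C : 0 < h -> test_function u -> k_lipschitz C u -> L1vec mu tau ->
  exists2 s, 0 < s < h & quotI tau h u = \int[mu]_x dot (grad u (x + s *: tau x)) (tau x).
Proof.
move=> h0 tu Cu Lt; have mt := L1vec_mvec Lt.
have [su _] := tu.
pose F (s : R) := \int[mu]_x (u (x + s *: tau x) - u x).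
have LF s : L1 (fun x => u (x + s *: tau x) - u x).
  have [->|s1] := eqVneq s 0.
    by under eq_fun do rewrite scale0r addr0 subrr; exact: L1_0.
  rewrite (_ : (fun x => _) = (fun x => s * ((u (x + s *: tau x) - u x) / s))).
    by apply: L1Z; exact: (L1_quot s Cu (@mvec_id _ _) Lt).
  by apply/funext => x; rewrite mulrC divfK.
have dF (s : R) : is_derive s 1 F (\int[mu]_x dot (grad u (x + s *: tau x)) (tau x)).
  have mP : mvec (fun x => x + s *: tau x) by apply: mvecD; [exact: mvec_id|exact: mvecZ].
  have cv := @diffquot_cvg _ _ mu C u (fun x => x + s *: tau x) tau Cu (fun x => smooth_diff x su) mP Lt.
  have e : (fun t : R => t^-1 *: ((F \o shift s) (t *: (1 : R)) - F s)) =
      (fun t => \int[mu]_x ((u (x + s *: tau x + t *: tau x) - u (x + s *: tau x)) / t)).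
    apply/funext => t /=; rewrite /F -IntB//.
    rewrite -[LHS]IntZ; last exact: L1B.
    apply: eq_Rintegral => x _; rewrite mulrC; congr (_ / _).
    rewrite [t *: (1:R)]mulr1 (addrC t s) scalerDl addrA.
    by rewrite opprB addrA subrK.
  by apply: DeriveDef; [apply/cvg_ex; eexists; rewrite e; exact: cv|rewrite /derive e; exact: (cvg_lim (@Rhausdorff R) cv)].
have [|s sh] := @MVT R F _ 0 h h0 (fun s _ => dF s).
  by apply: derivable_within_continuous => s _; exact: ex_derive.
rewrite subr0 {2}/F; under eq_Rintegral do rewrite scale0r addr0 subrr.
rewrite [X in _ - X]/Rintegral integral0 subr0 => e.
exists s; first by move: sh; rewrite in_itv.
have -> : quotI tau h u = h^-1 * F h.
  by rewrite /F -IntZ//; apply: eq_Rintegral => x _; rewrite mulrC.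
by rewrite e mulrC mulfK// gt_eqF.
Qed.

(** Let tau be a smooth field close to sigma.  The quotient of u along tau is its
    derivative at an intermediate time s, hence, by grad_flow, it is almost the
    pairing of tau with the gradient of v = u (x + s tau x), which is uniformly
    close to u. *)
Lemma flow_smoothing sigma C e : L1vec mu sigma -> 0 < C -> 0 < e ->
  exists A h0, [/\ 0 < A, 0 < h0 & forall h u, 0 < h < h0 -> test_function u -> k_lipschitz C u ->
    exists v, [/\ test_function v, k_lipschitz (2 * C) v, forall x, `|v x - u x| <= A * h &
      quotI sigma h u <= mdiv mu sigma v + e]].
Proof.
move=> Ls C0 e0.
have e1 : 0 < e / (6 * C) by rewrite divr_gt0// mulr_gt0.
have [tau tt ht] := test_dense_L1vec mu_radon Ls e1.
have Lt := test_field_L1 tt.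
have [M [L [M0 L0 hM hL]]] := test_field_bounds tt.
have v0 : 0 < vI mu tau + 1 by rewrite ltr_wpDl// vI_ge0.
pose h0 := Num.min L^-1 (e / (2 * C * L * (vI mu tau + 1))).
exists (C * M), h0; split; first exact: mulr_gt0.
  by rewrite lt_min invr_gt0 L0 divr_gt0// !mulr_gt0.
move=> h u /andP[hp]; rewrite lt_min => /andP[h1 h2] tu Cu.
have [s /andP[s0 sh] es] := quotI_mvt hp tu Cu Lt.
have C0' := ltW C0; have s0' := ltW s0.
have [tv lv dv] := test_flow tu tt s0' C0' Cu hM hL.
pose v x := u (x + s *: tau x); exists v.
have lv' : k_lipschitz (2 * C) v.
  apply: k_lipschitzW lv; rewrite mulrC ler_pM2r//.
  have : s * L < 1 by rewrite -ltr_pdivlMr// mul1r; exact: lt_trans sh h1.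
  by lra.
split => //.
  move=> x; apply: le_trans (dv x) _; rewrite -mulrA [s * M]mulrC mulrA ler_wpM2l ?mulr_ge0 ?ltW//.
have [su _] := tu; have [sv _] := tv.
have a1 := quotI_diff hp Cu Ls Lt.
have a2 : `|mdiv mu sigma v - mdiv mu tau v| <= 2 * C * vI mu (fun x => sigma x - tau x).
  by apply: mdiv_diff => //; rewrite mulr_ge0.
have mP : mvec (fun x => x + s *: tau x) by apply: mvecD; [exact: mvec_id|apply: mvecZ; exact: L1vec_mvec].
have Lg : L1 (fun x => dot (grad u (x + s *: tau x)) (tau x)).
  apply: (@L1_dot _ _ mu C) => //; first exact: (mvec_gradc su mP).
  by move=> x; apply: lipschitz_grad => //; exact: (smooth_diff _ su).
have Lv : L1 (fun x => dot (grad v x) (tau x)).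
  by apply: (@L1_mdiv _ _ mu (2 * C)) => //; rewrite mulr_ge0.
have a3 : `|mdiv mu tau v - quotI tau h u| <= C * s * L * vI mu tau.
  rewrite es /mdiv -IntB// -IntZ; last exact: L1vec_enorm.
  apply: norm_Int_le; first exact: L1B.
    by apply: L1Z; exact: L1vec_enorm.
  by move=> x; apply: (@grad_flow u tau s C M L x) => //; exact: ltW.
have a4 : C * s * L * vI mu tau <= e / 2.
  apply: (@le_trans _ _ (s * (C * L * (vI mu tau + 1)))).
    rewrite (_ : C * s * L * vI mu tau = s * (C * L * vI mu tau)); last by ring.
    by rewrite ler_wpM2l// ler_wpM2l ?lerDl// mulr_ge0 ?ltW.
  have := lt_trans sh h2; rewrite ltr_pdivlMr ?mulr_gt0//; set X := vI mu tau + 1.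
  by move=> h3; rewrite ler_pdivlMr//; apply: ltW; apply: le_lt_trans h3; rewrite le_eqVlt; apply/orP; left; apply/eqP; ring.
have a5 : C * vI mu (fun x => sigma x - tau x) <= e / 6.
  apply: le_trans (ler_wpM2l C0' ht) _; rewrite le_eqVlt; apply/orP; left; apply/eqP.
  by field; rewrite gt_eqF.
rewrite -mulrA in a2.
move: a1 a2 a3 a4 a5; rewrite !ler_norml.
move: (quotI sigma h u) (quotI tau h u) (mdiv mu sigma v) (mdiv mu tau v) (C * vI mu _) (C * s * L * _).
move=> p q r t c w /andP[_ a1] /andP[a2 _] /andP[a3 _] a4 a5.
lra.
Qed.

End flow_smoothing.

(** * Fields whose divergence is in the Arens-Eells space *)

Section tangency.
Context (R : realType) (d : nat).
Local Notation V := 'rV[R]_d.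
Local Notation B := (borel R d).
Variable mu : {measure set B -> \bar R}.
Hypothesis mu_radon : radon mu.
Local Notation L1 := (L1 mu).
Implicit Types (u v : V -> R) (sigma tau : V -> V).

(** A criterion for -div (sigma mu) to be in AE that only mentions test functions
    (see div_continuousP). *)
Definition div_continuous sigma := forall e, 0 < e -> exists2 dl, 0 < dl &
  forall v, test_function v -> k_lipschitz 1 v -> (forall x, `|v x| <= dl) ->
  mdiv mu sigma v <= e.

Lemma div_continuous_scale sigma C : L1vec mu sigma -> div_continuous sigma -> 0 < C ->
  forall e, 0 < e -> exists2 dl, 0 < dl &
  forall v, test_function v -> k_lipschitz C v -> (forall x, `|v x| <= dl) ->
  `|mdiv mu sigma v| <= e.
Proof.
move=> Ls Q C0 e e0; have [dl dl0 H] := Q _ (divr_gt0 e0 C0).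
exists (C * dl); first exact: mulr_gt0.
have key v : test_function v -> k_lipschitz C v -> (forall x, `|v x| <= C * dl) -> mdiv mu sigma v <= e.
  move=> tv Cv vb; have [sv _] := tv.
  have Cv' : k_lipschitz 1 (fun x => C^-1 * v x).
    by have := k_lipschitz_scale C^-1 Cv; rewrite gtr0_norm ?invr_gt0// mulVf ?gt_eqF.
  have := H _ (test_functionZ C^-1 tv) Cv'.
  rewrite (mdivZ C^-1 (ltW C0) sv Cv Ls) mulrC ler_pM2r ?invr_gt0//; apply => x.
  by rewrite normrM gtr0_norm ?invr_gt0// ler_pdivrMl.
move=> v tv Cv vb; have [sv _] := tv; rewrite ler_norml (key _ tv Cv vb) andbT lerNl.
have := key _ (test_functionZ (-1) tv).
rewrite (mdivZ (-1) (ltW C0) sv Cv Ls) mulN1r; apply.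
  by have := k_lipschitz_scale (-1) Cv; rewrite normrN1 mul1r.
by move=> x; rewrite mulN1r normrN.
Qed.

Lemma AE_div_continuous sigma f : L1vec mu sigma -> AE f -> restricts_to f (mdiv mu sigma) ->
  div_continuous sigma.
Proof.
move=> Ls Af rf e e0; have [dl dl0 H] := AE_small Af ltr01 e0; exists dl => // v tv kv vb.
apply: le_trans (ler_norm _) _; rewrite -[mdiv _ _ _](rf (mkLip kv) tv).
exact: (H (mkLip kv) kv vb).
Qed.

Lemma Dh_cvg_seq C (u_ : nat -> Lip R d) (u : Lip R d) sigma h : 0 <= C -> L1vec mu sigma ->
  (forall n, k_lipschitz C (u_ n)) -> (forall x, u_ n x @[n --> \oo] --> u x) ->
  Dh mu sigma h (u_ n) @[n --> \oo] --> Dh mu sigma h u.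
Proof.
move=> C0 Ls Cu cu; have ms := L1vec_mvec Ls.
apply: (@Int_cvg _ B R mu _ _ (fun x => C * enorm (sigma x))).
- move=> n; apply: measurable_quot => //; [exact: k_lipschitz_continuous (Cu n)|exact: mvec_id].
- by move=> x; apply: cvgMr_tmp; apply: cvgB; exact: cu.
- by apply: L1Z; exact: L1vec_enorm.
- by move=> n x; exact: quot_le.
Qed.

(** By flow_smoothing, the difference of two quotients of u is at most the pairing
    of sigma with the gradient of v + w, where v is close to u and w close to -u;
    and v + w is uniformly small. *)
Lemma div_continuous_cauchy sigma : L1vec mu sigma -> div_continuous sigma -> forall e, 0 < e ->
  exists2 h0, 0 < h0 & forall h h', 0 < h < h0 -> 0 < h' < h0 -> forall u : Lip R d,
  k_lipschitz 1 u -> Dh mu sigma h u - Dh mu sigma h' u <= e.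
Proof.
move=> Ls Q e e0; have [C C1 dens] := test_dense R d.
have C0 : 0 < C by exact: lt_le_trans C1.
have e3 : 0 < e / 3 by rewrite divr_gt0.
have C4 : 0 < 4 * C by rewrite mulr_gt0.
have [dl dl0 H] := div_continuous_scale Ls Q C4 e3.
have [A [h0 [A0 h00 flow]]] := flow_smoothing mu_radon Ls C0 e3.
exists (Num.min h0 (dl / (2 * A))).
  by rewrite lt_min h00 divr_gt0// mulr_gt0.
move=> h h' /andP[hp]; rewrite lt_min => /andP[h1 h2].
move=> /andP[hp']; rewrite lt_min => /andP[h1' h2'].
have key u (Cu : k_lipschitz C u) : test_function u -> Dh mu sigma h (mkLip Cu) - Dh mu sigma h' (mkLip Cu) <= e.
  move=> tu.
  have [v [tv lv dv qv]] := flow h u ltac:(by rewrite hp h1) tu Cu.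
  have Cu' : k_lipschitz C (fun x => -1 * u x).
    by have := k_lipschitz_scale (-1) Cu; rewrite normrN1 mul1r.
  have [w [tw lw dw qw]] := flow h' _ ltac:(by rewrite hp' h1') (test_functionZ (-1) tu) Cu'.
  have e1 : quotI mu sigma h' (fun x => -1 * u x) = - Dh mu sigma h' (mkLip Cu).
    have lin := Dh_linear h' Ls.
    rewrite -[LHS]/(Dh mu sigma h' (mkLip Cu')) (@linZ _ _ _ (-1) (mkLip Cu) (mkLip Cu') lin)//.
    by rewrite mulN1r.
  have [sv _] := tv; have [sw _] := tw.
  have C2 : 0 <= 2 * C by rewrite mulr_ge0// ltW.
  have e2 := mdivD C2 sv sw lv lw Ls.
  have : `|mdiv mu sigma (fun x => v x + w x)| <= e / 3.
    apply: H.
    - exact: test_functionD.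
    - have := k_lipschitzD lv lw; congr (k_lipschitz _ _); ring.
    - move=> x; have -> : v x + w x = (v x - u x) + (w x - -1 * u x) by ring.
      apply: le_trans (ler_normD _ _) _; apply: le_trans (lerD (dv x) (dw x)) _.
      have A2 : 0 < 2 * A by rewrite mulr_gt0.
      move: h2 h2'; rewrite !ltr_pdivlMr//; clear; lra.
  rewrite e2 e1 in qw *; rewrite -[Dh mu sigma h (mkLip Cu)]/(quotI mu sigma h u).
  rewrite ler_norml => /andP[_ h3]; move: qv qw h3.
  move: (quotI _ _ _ _) (Dh _ _ _ _) (mdiv _ _ v) (mdiv _ _ w); clear => p q r t; lra.
move=> u ku; have [v [tv Cv cv bv]] := dens _ ku.
have Cu : k_lipschitz C u by exact: k_lipschitzW ku.
have c1 := @Dh_cvg_seq C (fun n => mkLip (Cv n)) u sigma h (ltW C0) Ls Cv cv.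
have c2 := @Dh_cvg_seq C (fun n => mkLip (Cv n)) u sigma h' (ltW C0) Ls Cv cv.
apply: (cvgr_to_le (cvgB c1 c2)); near=> n; exact: key.
Unshelve. all: by end_near. Qed.

Lemma ereal_cvg_real (T : Type) (F : set_system T) {FF : Filter F} (f : T -> \bar R) (a : R) :
  (forall e, 0 < e -> \forall h \near F, ((a - e)%:E <= f h <= (a + e)%:E)%E) ->
  f h @[h --> F] --> a%:E.
Proof.
move=> H; apply/fine_cvgP; split.
  apply: filterS (H 1 ltr01) => h /andP[h1 h2].
  by case: (f h) h1 h2.
apply/cvgrPdist_le => e e0; apply: filterS (H e e0) => h /andP[].
rewrite /comp; case: (f h) => [r| |] //=; rewrite !lee_fin => h1 h2.
by rewrite ler_norml; apply/andP; split; lra.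
Qed.

Lemma cauchy_near (s : nat -> R) :
  (forall e, 0 < e -> exists N : nat, forall n, (N <= n)%N -> `|s N - s n| < e) -> cvg (s @ \oo).
Proof.
move=> H; apply/cauchy_cvgP; apply: cauchy_exP => e e0.
by have [N HN] := H _ e0; exists (s N), N.
Qed.

Lemma right_near0 (P : R -> Prop) : (exists2 h0, 0 < h0 & forall h, 0 < h < h0 -> P h) ->
  \forall h \near (0:R)^'+, P h.
Proof.
move=> [h0 h00 H]; near=> h; apply: H; apply/andP; split.
  near: h; exact: nbhs_right_gt.
near: h; exact: nbhs_right_lt.
Unshelve. all: by end_near. Qed.

(** A Cauchy family for the KR distance converges pointwise, and the limit stays in
    AE since the quotients are in AE. *)
Lemma div_continuous_limit sigma : L1vec mu sigma -> div_continuous sigma ->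
  exists f, [/\ AE f, restricts_to f (mdiv mu sigma) &
    forall e, 0 < e -> exists2 h0, 0 < h0 & forall h, 0 < h < h0 -> (KRdist (Dh mu sigma h) f <= e%:E)%E].
Proof.
move=> Ls Q; have cau := div_continuous_cauchy Ls Q.
pose hn (n : nat) : R := n.+1%:R^-1.
have hn0 n : 0 < hn n by rewrite invr_gt0.
have hnlt h0 : 0 < h0 -> \forall n \near \oo, 0 < hn n < h0.
  move=> h00; near=> n; rewrite hn0 /=; near: n; exact: (near_infty_natSinv_lt (PosNum h00)).
have lin h := Dh_linear h Ls.
have cvgu (u : Lip R d) : cvg (Dh mu sigma (hn n) u @[n --> \oo]).
  case: (lip_funP u) => k ku.
  have K0 : 0 < `|k| + 1 by rewrite ltr_wpDl.
  have Ku : k_lipschitz (`|k| + 1) u.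
    by apply: k_lipschitzW ku; apply: le_trans (ler_norm _) _; rewrite lerDl.
  apply: cauchy_near => e e0.
  have e2 : 0 < e / (2 * (`|k| + 1)) by rewrite divr_gt0// mulr_gt0.
  have [h0 h00 H] := cau _ e2; have [N _ HN] := hnlt _ h00.
  exists N => n Nn.
  have := KR_scale (lin (hn N)) (lin (hn n)) K0 (H _ _ (HN N (leqnn N)) (HN n Nn)) Ku.
  have -> : (`|k| + 1) * (e / (2 * (`|k| + 1))) = e / 2 by field; rewrite gt_eqF.
  by move=> /le_lt_trans; apply; rewrite ltr_pdivrMr//; lra.
pose f (u : Lip R d) := lim (Dh mu sigma (hn n) u @[n --> \oo]).
have cf (u : Lip R d) : Dh mu sigma (hn n) u @[n --> \oo] --> f u by exact: cvgu.
have lf : linear_form f.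
  move=> a b u v w e; apply: cvg_lim => //.
  rewrite (_ : (fun n => _) = (fun n => a * Dh mu sigma (hn n) u + b * Dh mu sigma (hn n) v)).
    by apply: cvgD; apply: cvgMl_tmp; exact: cf.
  by apply/funext => n; rewrite (lin (hn n) _ _ _ _ _ e).
have cl e : 0 < e -> exists2 h0, 0 < h0 & forall h, 0 < h < h0 ->
    forall u : Lip R d, k_lipschitz 1 u -> Dh mu sigma h u - f u <= e /\ f u - Dh mu sigma h u <= e.
  move=> e0; have [h0 h00 H] := cau _ e0; exists h0 => // h hh u ku; split.
    rewrite lerBlDl -lerBlDr; apply: (cvgr_to_ge (cf u)).
    by apply: filterS (hnlt _ h00) => n hn'; rewrite lerBlDr -lerBlDl; exact: H.
  rewrite lerBlDr; apply: (cvgr_to_le (cf u)).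
  by apply: filterS (hnlt _ h00) => n hn'; rewrite -lerBlDr; exact: H.
have Af : AE f.
  apply: AE_limit => // e e0; have [h0 h00 H] := cl _ e0.
  exists (Dh mu sigma (h0 / 2)); first by apply: Dh_AE => //; rewrite divr_gt0.
  by move=> u ku; have [] := H (h0 / 2) ltac:(by apply/andP; split; lra) u ku.
exists f; split => //.
  move=> u tu; have [k k0 ku] := test_lipschitz tu; have [su _] := tu.
  have c1 := Dh_cvg ku (fun x => smooth_diff x su) Ls.
  have c2 : Dh mu sigma (hn n) u @[n --> \oo] --> mdiv mu sigma u.
    move/cvg_at_rightP : c1; apply; split => //.
    apply/cvgrPdist_le => e e0; near=> n.
    rewrite sub0r normrN gtr0_norm//.
    by near: n; apply: filterS (near_infty_natSinv_lt (PosNum e0)) => m /ltW.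
  by apply: cvg_lim => //.
move=> e e0; have [h0 h00 H] := cl _ e0; exists h0 => // h hh.
by apply: KRdist_le => u ku; rewrite lee_fin; case: (H h hh u ku).
Unshelve. all: by end_near. Qed.

(** By AE_unique, f is the limit given by div_continuous_limit. *)
Lemma Dh_cvg_AE sigma f : L1vec mu sigma -> AE f -> restricts_to f (mdiv mu sigma) ->
  forall e, 0 < e -> exists2 h0, 0 < h0 & forall h, 0 < h < h0 -> (KRdist (Dh mu sigma h) f <= e%:E)%E.
Proof.
move=> Ls Af rf; have [g [Ag rg H]] := div_continuous_limit Ls (AE_div_continuous Ls Af rf).
by rewrite (@AE_unique _ _ f g)// => u tu; rewrite rf// rg.
Qed.

Lemma div_continuousP sigma : L1vec mu sigma -> MKfields mu sigma <-> div_continuous sigma.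
Proof.
move=> Ls; split=> [[_ [f Af rf]]|Q]; first exact: AE_div_continuous Ls Af rf.
by split => //; have [f [Af rf _]] := div_continuous_limit Ls Q; exists f.
Qed.

Lemma AE_of_distrP (L : (V -> R) -> R) : distr_in_AE L ->
  AE (AE_of_distr L) /\ restricts_to (AE_of_distr L) L.
Proof.
move=> [f Af rf].
exact: (@xgetPex _ (fun=> 0) [set f | AE f /\ restricts_to f L] (ex_intro _ f (conj Af rf))).
Qed.

End tangency.

(** * Completeness of L1 *)

Section riesz_fischer.
Context d0 (T : measurableType d0) (R : realType) (mu : {measure set T -> \bar R}).
Local Notation L1 := (L1 mu).

(** Riesz-Fischer: the sum of the absolute values of the increments is integrable,
    hence finite almost everywhere, and it dominates the sequence. *)
Lemma L1_complete (f : nat -> T -> R) (C : R) : (forall n, L1 (f n)) ->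
  (forall n, \int[mu]_x `|f n.+1 x - f n x| <= C / 2 ^+ n) ->
  exists2 g, L1 g & \int[mu]_x `|f n x - g x| @[n --> \oo] --> (0 : R).
Proof.
move=> Lf hf.
pose s n x : R := \sum_(i < n) `|f i.+1 x - f i x|.
have Ls n : L1 (s n).
  by apply: L1_sum => i; apply: L1_norm; exact: L1B.
have s0 n x : 0 <= s n x by apply: sumr_ge0.
have C0 : 0 <= C.
  by have := hf 0%N; rewrite expr0 divr1; apply: le_trans; exact: Int_ge0.
have Is n : \int[mu]_x s n x <= 2 * C.
  suff : \int[mu]_x s n x <= 2 * C - 2 * C / 2 ^+ n.
    by move=> /le_trans; apply; rewrite gerBl divr_ge0 ?mulr_ge0// exprn_ge0.
  elim: n => [|m IH].
    rewrite /s; under eq_Rintegral do rewrite big_ord0.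
    by rewrite /Rintegral integral0 expr0 divr1 subrr.
  rewrite /s; under eq_Rintegral do rewrite big_ord_recr.
  rewrite (IntD (Ls m) (L1_norm (L1B (Lf m.+1) (Lf m)))).
  apply: le_trans (lerD IH (hf m)) _; rewrite exprS.
  have ? : (2 : R) ^+ m != 0 by rewrite expf_neq0.
  rewrite le_eqVlt; apply/orP; left; apply/eqP; field.
  by rewrite ?mulf_neq0.

have nds x : nondecreasing_seq (s^~ x).
  by apply/nondecreasing_seqP => n; rewrite /s big_ord_recr/= lerDl.
pose S x := limn (fun n => (s n x)%:E).
have ndS x : nondecreasing_seq (fun n => (s n x)%:E) by move=> a b ab; rewrite lee_fin; exact: nds.
have cS x : (s n x)%:E @[n --> \oo] --> S x by exact: ereal_nondecreasing_is_cvgn.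
have mE n : measurable_fun setT (fun x => (s n x)%:E) by apply/measurable_EFinP; exact: L1_measurable.
have mS : measurable_fun setT S.
  by apply: (emeasurable_fun_cvg (fun n x => (s n x)%:E)) => // x _; exact: cS.
have sS n x : ((s n x)%:E <= S x)%E.
  rewrite /S (cvg_lim (@ereal_hausdorff R) (ereal_nondecreasing_cvgn (ndS x))).
  by apply: ereal_sup_ubound; exists n.
have S0 x : (0 <= S x)%E by apply: le_trans (sS 0%N x); rewrite lee_fin.
have IS : (\int[mu]_x S x <= (2 * C)%:E)%E.
  have Is' n : (\int[mu]_x (s n x)%:E <= (2 * C)%:E)%E by rewrite (EFin_Int (Ls n)) lee_fin; exact: Is.
  rewrite (_ : (\int[mu]_x S x)%E = limn (fun n => (\int[mu]_x (s n x)%:E)%E)); last first.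
    by apply: (@monotone_convergence _ _ _ mu setT measurableT (fun n x => (s n x)%:E)) => // n x _; rewrite lee_fin.
  apply: lime_le; last exact: nearW Is'.
  apply: ereal_nondecreasing_is_cvgn => a b ab; apply: ge0_le_integral => //.
    by move=> x _; rewrite lee_fin.
  by move=> x _; exact: ndS.
have iS : mu.-integrable setT S.
  apply/integrableP; split => //; under eq_integral do rewrite gee0_abs//.
  by apply: le_lt_trans IS _; rewrite ltry.
have Lfi : L1 (fun x => fine (S x)).
  apply: (le_integrable measurableT _ _ iS).
    by apply/measurable_EFinP; apply: measurableT_comp => //; exact: fine_measurable.
  by move=> x _ /=; move: (S0 x); case: (S x) => [r| |] //= _; rewrite normr0 ?leey.
pose A := [set x | S x \is a fin_num].
have mA : measurable A by rewrite -[A]setTI; exact: emeasurable_fin_num.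
have aeA : {ae mu, forall x, A x}.
  by have := integrable_ae measurableT iS; apply: filterS => x; apply.
have bs n x : A x -> s n x <= fine (S x).
  by move=> Ax; rewrite -lee_fin fineK// sS.
have tele n x : f n x = f 0%N x + \sum_(i < n) (f i.+1 x - f i x).
  elim: n => [|n IH]; first by rewrite big_ord0 addr0.
  by rewrite big_ord_recr/= addrA -IH addrC subrK.
have bf n x : A x -> `|f n x| <= `|f 0%N x| + fine (S x).
  move=> Ax; rewrite tele; apply: le_trans (ler_normD _ _) _; rewrite lerD2l.
  by apply: le_trans (ler_norm_sum _ _ _) _; exact: bs.
have cf x : A x -> cvg (f n x @[n --> \oo]).
  move=> Ax; rewrite (_ : (fun n => f n x) = (fun n => f 0%N x + series (fun i => f i.+1 x - f i x) n)); last first.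
    by apply/funext => n; rewrite tele /series/= big_mkord.
  apply: is_cvgD; first exact: is_cvg_cst.
  apply: normed_cvg.
  suff : cvg (s^~ x n @[n --> \oo]).
    have -> // : s^~ x = (fun n => series (fun i => `|f i.+1 x - f i x|) n).
    by apply/funext => n; rewrite /series/= big_mkord.
  apply: nondecreasing_is_cvgn; first exact: nds.
  by exists (fine (S x)) => _ [n _ <-]; exact: bs.
pose h n x := f n x * \1_A x.
have ch x : cvg (h n x @[n --> \oo]).
  rewrite /h indicE; have [Ax|Ax] := pselect (A x).
    by rewrite mem_set//; under eq_fun do rewrite mulr1; exact: cf.
  by rewrite memNset//; under eq_fun do rewrite mulr0; exact: is_cvg_cst.
pose g x := limn (h^~ x).
have mh n : measurable_fun setT (h n).
  by apply: measurable_funM; [exact: L1_measurable|exact: measurable_indic].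
have mg : measurable_fun setT g by apply: (measurable_fun_cvg mh) => x _; exact: ch.
have fS0 x : 0 <= fine (S x) by exact: fine_ge0.
have bh n x : `|h n x| <= `|f 0%N x| + fine (S x).
  rewrite /h indicE; have [Ax|Ax] := pselect (A x).
    by rewrite mem_set// mulr1; exact: bf.
  by rewrite memNset// mulr0 normr0 addr_ge0.
have bg x : `|g x| <= `|f 0%N x| + fine (S x).
  apply: (cvgr_to_le (cvg_norm (ch x))); near=> n; exact: bh.
have LG : L1 (fun x => `|f 0%N x| + fine (S x)) by apply: L1D => //; exact: L1_norm.
have Lg : L1 g by apply: L1_dom LG.
exists g => //.
have -> : (fun n => \int[mu]_x `|f n x - g x|) = (fun n => \int[mu]_x `|h n x - g x|).
  apply/funext => n; apply: ae_eq_Rintegral; apply: filterS aeA => x Ax.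
  by rewrite /h indicE mem_set// mulr1.
rewrite [X in _ --> X](_ : _ = \int[mu]_x (fun=> 0) x); last first.
  by rewrite /Rintegral integral0.
apply: (@Int_cvg _ T R mu _ _ (fun x => 2 * (`|f 0%N x| + fine (S x)))).
- by move=> n; apply: measurableT_comp => //; exact: measurable_funB.
- move=> x; rewrite -[X in _ --> X](@normr0 R R^o) -(subrr (g x)).
  apply: cvg_norm; apply: cvgB; [exact: ch|exact: cvg_cst].
- exact: L1Z.
- move=> n x; rewrite normr_id; apply: le_trans (ler_normB _ _) _.
  by have := bh n x; have := bg x; lra.
Unshelve. all: by end_near. Qed.

End riesz_fischer.

(** * A quadratic misfit and its almost minimizers *)

Section quadratic.
Context (R : realType) (d : nat).
Local Notation V := 'rV[R]_d.
Local Notation B := (borel R d).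
Variable mu : {measure set B -> \bar R}.
Hypothesis mu_radon : radon mu.
Local Notation L1 := (L1 mu).
Variable r : R.
Implicit Types (u v w : V -> R) (F G H : V -> V).
Local Notation E := (eball r : set B).

Definition bounded_field F := mvec F /\ exists2 M, 0 <= M & forall x, enorm (F x) <= M.

Lemma bounded_fieldZ a F : bounded_field F -> bounded_field (fun x => a *: F x).
Proof.
move=> [mF [M M0 hM]]; split; first exact: mvecZ.
exists (`|a| * M); first exact: mulr_ge0.
by move=> x; rewrite enormZ ler_wpM2l.
Qed.

Lemma bounded_fieldB F G : bounded_field F -> bounded_field G -> bounded_field (fun x => F x - G x).
Proof.
move=> [mF [M M0 hM]] [mG [N N0 hN]]; split; first exact: mvecB.
exists (M + N); first exact: addr_ge0.
by move=> x; apply: le_trans (enormB _ _) _; exact: lerD.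
Qed.

Lemma bounded_field_grad v : test_function v -> bounded_field (grad v).
Proof.
move=> tv; have [sv _] := tv; split; first exact: mvec_grad.
have [k k0 kv] := test_lipschitz tv; exists k; first exact: ltW.
by move=> x; apply: lipschitz_grad kv; [exact: ltW|exact: smooth_diff].
Qed.

Lemma L1_eball : L1 (\1_E : B -> R).
Proof. by apply: L1_indic; [exact: eball_borel|exact: eball_fin]. Qed.

Definition muE : R := \int[mu]_x (\1_E x : R).
(** The inner product of L2 on the ball; it is used on bounded fields, where it is
    finite. *)
Definition ip F G : R := \int[mu]_x (dot (F x) (G x) * \1_E x).
Local Notation q F := (ip F F).

Lemma L1_ip F G : bounded_field F -> bounded_field G -> L1 (fun x => dot (F x) (G x) * \1_E x).
Proof.
move=> [mF [M M0 hM]] [mG [N N0 hN]].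
apply: (@L1_dom _ _ _ _ _ (fun x => M * N * \1_E x)).
- by apply: measurable_funM; [exact: measurable_dot|apply: measurable_indic; exact: eball_borel].
- move=> x; rewrite normrM [`|\1_E x|]ger0_norm// ler_wpM2r//.
  by apply: le_trans (norm_dot_le _ _) _; apply: ler_pM; rewrite ?enorm_ge0 ?hM ?hN.
- by apply: L1Z; exact: L1_eball.
Qed.

Lemma ipC F G : ip F G = ip G F.
Proof. by apply: eq_Rintegral => x _; rewrite dotC. Qed.

Lemma ipBl F G H : bounded_field F -> bounded_field G -> bounded_field H ->
  ip (fun x => F x - G x) H = ip F H - ip G H.
Proof.
move=> bF bG bH; rewrite -IntB; [|exact: L1_ip|exact: L1_ip].
by apply: eq_Rintegral => x _; rewrite dotBl mulrBl.
Qed.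

Lemma ipBr F G H : bounded_field F -> bounded_field G -> bounded_field H ->
  ip H (fun x => F x - G x) = ip H F - ip H G.
Proof. by move=> bF bG bH; rewrite ipC ipBl// !(ipC H). Qed.

Lemma ip_ge0 F : 0 <= q F.
Proof. by apply: Int_ge0 => x; rewrite mulr_ge0// dot_ge0. Qed.

Lemma ip_subC F G : q (fun x => F x - G x) = q (fun x => G x - F x).
Proof. by apply: eq_Rintegral => x _; rewrite -opprB dotNl dotC dotNl opprK. Qed.

Lemma q_le2 F G : bounded_field F -> bounded_field G ->
  q F <= 2 * q (fun x => F x - G x) + 2 * q G.
Proof.
move=> bF bG; have bFG := bounded_fieldB bF bG.
rewrite -!IntZ -?IntD; try by [exact: L1_ip|apply: L1Z; exact: L1_ip].
apply: le_Int => [||x]; [exact: L1_ip|by apply: L1D; apply: L1Z; exact: L1_ip|].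
rewrite !mulrA -mulrDl ler_wpM2r//.
have := dot_ge0 (F x - 2 *: G x).
rewrite !(dotBl, dotBr, dotZl, dotZr) (dotC (G x) (F x)).
lra.
Qed.

Lemma q_triangle F G H : bounded_field F -> bounded_field G -> bounded_field H ->
  q (fun x => F x - H x) <= 2 * q (fun x => F x - G x) + 2 * q (fun x => G x - H x).
Proof.
move=> bF bG bH; have b1 := bounded_fieldB bF bG; have b2 := bounded_fieldB bG bH.
apply: le_trans (q_le2 (bounded_fieldB bF bH) b2) _; rewrite lerD2r ler_wpM2l//.
apply: le_Int => [||x]; [|exact: L1_ip|by rewrite opprB addrA subrK].
by apply: L1_ip; apply: bounded_fieldB => //; exact: bounded_fieldB.
Qed.

Lemma q_measure F : bounded_field F -> (forall x, enorm (F x) <= 1) -> q F <= muE.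
Proof.
move=> bF F1; apply: le_Int => [||x]; [exact: L1_ip|exact: L1_eball|].
by rewrite -sqr_enorm ler_piMl ?exprn_ile1 ?enorm_ge0 ?F1.
Qed.

Lemma Int_comb (a b c : R) (f g h k : B -> R) : L1 f -> L1 g -> L1 h ->
  (forall x, k x = a * f x + b * g x + c * h x) ->
  \int[mu]_x k x = a * \int[mu]_x f x + b * \int[mu]_x g x + c * \int[mu]_x h x.
Proof.
move=> Lf Lg Lh e; rewrite (_ : k = (fun x => a * f x + b * g x + c * h x)).
  by rewrite (IntD (L1D (L1Z a Lf) (L1Z b Lg)) (L1Z c Lh)) (IntD (L1Z a Lf) (L1Z b Lg)) !IntZ.
by apply/funext.
Qed.

Section fix_xi.
Variable xi : V -> V.
Hypothesis bxi : bounded_field xi.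

Definition small_lip (k dl : R) v := [/\ test_function v, k_lipschitz k v & forall x, `|v x| <= dl].

Lemma small_lipW k k' dl dl' v : k <= k' -> dl <= dl' -> small_lip k dl v -> small_lip k' dl' v.
Proof.
move=> kk dd [tv kv bv]; split => //; first exact: k_lipschitzW kv.
by move=> x; exact: le_trans (bv x) dd.
Qed.

Lemma small_lipZ a k dl v : small_lip k dl v -> small_lip (`|a| * k) (`|a| * dl) (fun x => a * v x).
Proof.
move=> [tv kv bv]; split; [exact: test_functionZ|exact: k_lipschitz_scale|].
by move=> x; rewrite normrM ler_wpM2l.
Qed.

Lemma small_lipD k l dl dl' v w : small_lip k dl v -> small_lip l dl' w ->
  small_lip (k + l) (dl + dl') (fun x => v x + w x).
Proof.
move=> [tv kv bv] [tw kw bw]; split; [exact: test_functionD|exact: k_lipschitzD|].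
by move=> x; apply: le_trans (ler_normD _ _) _; exact: lerD.
Qed.

Definition misfit v := q (fun x => grad v x - xi x).
Local Notation J := misfit.

Lemma misfit_ge0 v : 0 <= J v. Proof. exact: ip_ge0. Qed.

Lemma misfit0 : J (fun=> 0) = q xi.
Proof.
by apply: eq_Rintegral => x _; rewrite grad_cst sub0r dotNl (dotC (xi x)) dotNl opprK.
Qed.

Lemma bounded_misfit v : test_function v -> bounded_field (fun x => grad v x - xi x).
Proof. by move=> tv; apply: bounded_fieldB => //; exact: bounded_field_grad. Qed.

Lemma misfit_line v w t : test_function v -> test_function w ->
  J (fun x => v x + t * w x) = J v + 2 * t * ip (fun x => grad v x - xi x) (grad w)
    + t ^+ 2 * q (grad w).
Proof.
move=> tv tw; have [sv _] := tv; have [sw _] := tw.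
have b1 := bounded_misfit tv; have b2 := bounded_field_grad tw.
have L1v := L1_ip b1 b1; have L1w := L1_ip b2 b2; have L1m := L1_ip b1 b2.
rewrite -[J v]mul1r; apply: (Int_comb L1v L1m L1w) => x.
rewrite gradD ?gradZ; try by [exact: smooth_diff|apply: smooth_diff; exact: smoothZ].
move: (grad v x) (grad w x) (xi x) (\1__ _) => a b c e.
rewrite !(dotBl, dotBr, dotDl, dotDr, dotZl, dotZr) (dotC b a) (dotC b c) (dotC a c).
move: (dot _ _) (dot _ _) (dot _ _) (dot _ _) (dot _ _) (dot _ _) => a1 a2 a3 a4 a5 a6.
by clear; ring.
Qed.

(** The parallelogram identity. *)
Lemma misfit_mid v w : test_function v -> test_function w ->
  q (fun x => grad v x - grad w x) = 2 * J v + 2 * J w - 4 * J (fun x => 2^-1 * v x + 2^-1 * w x).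
Proof.
move=> tv tw; have [sv _] := tv; have [sw _] := tw.
have b1 := bounded_misfit tv; have b2 := bounded_misfit tw.
have b3 : bounded_field (fun x => grad (fun x => 2^-1 * v x + 2^-1 * w x) x - xi x).
  by apply: bounded_misfit; apply: test_functionD; exact: test_functionZ.
have L1v := L1_ip b1 b1; have L1w := L1_ip b2 b2; have L1m := L1_ip b3 b3.
rewrite -mulNr; apply: (Int_comb L1v L1w L1m) => x.
rewrite gradD ?gradZ; try by [exact: smooth_diff|apply: smooth_diff; exact: smoothZ].
move: (grad v x) (grad w x) (xi x) (\1__ _) => a b c e.
rewrite !(dotBl, dotBr, dotDl, dotDr, dotZl, dotZr) (dotC b a) (dotC b c) (dotC a c).
move: (dot _ _) (dot _ _) (dot _ _) (dot _ _) (dot _ _) (dot _ _) => a1 a2 a3 a4 a5 a6.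
by clear; field.
Qed.

(** The midpoint is a competitor, so its misfit is at least c - e: conclude with
    the parallelogram identity. *)
Lemma almost_minimizers_close k dl c e v w : 
  (forall z, small_lip k dl z -> c - e <= J z) ->
  small_lip k dl v -> J v <= c + e -> small_lip k dl w -> J w <= c + e ->
  q (fun x => grad v x - grad w x) <= 8 * e.
Proof.
move=> hz Wv Jv Ww Jw; rewrite misfit_mid; [|by case: Wv|by case: Ww].
have /hz : small_lip k dl (fun x => 2^-1 * v x + 2^-1 * w x).
  apply: small_lipW (small_lipD (small_lipZ 2^-1 Wv) (small_lipZ 2^-1 Ww));
  by rewrite ger0_norm ?invr_ge0// -mulrDl (_ : 2^-1 + 2^-1 = 1 :> R) ?mul1r//; field.
move: Jv Jw; move: (J v) (J w) (J _) => a b m; clear hz Wv Ww; lra.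
Qed.

(** Compare with v + s w and v - s w: after division by the step s, the tolerance
    s ^+ 2 and the second order term are both of order s. *)
Lemma almost_minimizer_variation c s v w : 0 < s ->
  (forall t, `|t| = s -> c - s ^+ 2 <= J (fun x => v x + t * w x)) -> J v <= c + s ^+ 2 ->
  test_function v -> test_function w ->
  `|ip (fun x => grad v x - xi x) (grad w)| <= s * (1 + q (grad w)).
Proof.
move=> s0 h Jv tv tw.
have h1 := h s (gtr0_norm s0).
have h2 := h (- s) ltac:(by rewrite normrN gtr0_norm).
rewrite !misfit_line// sqrrN in h1 h2.
have q0 := ip_ge0 (grad w).
move: (ip _ _) (ip (grad w) _) (J v) h1 h2 Jv q0 => x y z h1 h2 Jv q0.
rewrite ler_norml -(ler_pM2l s0) -[X in _ && X](ler_pM2l s0).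
apply/andP; split; nra.
Qed.

End fix_xi.
End quadratic.

(** * The limit misfit *)

Lemma le_double1 (R : realFieldType) (k : R) : 0 < k -> k <= 2 * k + 1. Proof. lra. Qed.
Lemma le_double (R : realFieldType) (k : R) : 0 < k -> k <= 2 * k. Proof. lra. Qed.

Section minimisation.
Context (R : realType) (d : nat).
Local Notation V := 'rV[R]_d.
Local Notation B := (borel R d).
Variable mu : {measure set B -> \bar R}.
Hypothesis mu_radon : radon mu.
Local Opaque dot ip misfit.
Local Notation L1 := (L1 mu).
Variable (r : R) (xi : V -> V).
Local Notation E := (eball r : set B).
Local Notation bounded_field := (@bounded_field R d).
Hypothesis bxi : bounded_field xi.
Local Notation ip := (ip mu r).
Local Notation q F := (ip F F).
Local Notation J := (misfit mu r xi).
Local Notation muE := (muE mu r).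

Definition reach (c : R) := exists2 k : R, 0 < k & forall dl, 0 < dl -> exists2 v, small_lip k dl v & J v < c.

Lemma reach_ub : reach (q xi + 1).
Proof.
exists 1 => // dl dl0; exists (fun=> 0).
  split; [exact: test_function0| |by move=> x; rewrite normr0 ltW].
  by move=> x y; rewrite subrr normr0 mul1r enorm_ge0.
by rewrite misfit0 ltrDl.
Qed.

Lemma reach_gt0 c : reach c -> 0 < c.
Proof.
move=> [k _ /(_ 1 ltr01)[v _ Jv]]; exact: le_lt_trans (misfit_ge0 mu r xi v) Jv.
Qed.

(** The infimum of the limits of the misfit along equi-Lipschitz sequences that tend
    uniformly to 0. *)
Definition limit_misfit : R := inf [set c | reach c].
Local Notation I := limit_misfit.

Lemma has_inf_reach : has_inf [set c | reach c].
Proof.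
split; first by exists (q xi + 1); exact: reach_ub.
by exists 0 => c /= /reach_gt0 /ltW.
Qed.

Lemma reach_above e : 0 < e -> reach (I + e).
Proof.
move=> e0; have [c [k k0 H] ci] := inf_adherent e0 has_inf_reach.
exists k => // dl dl0; have [v Wv Jv] := H dl dl0; exists v => //; exact: lt_trans Jv ci.
Qed.

Lemma reach_inf c : reach c -> I <= c.
Proof. by move=> rc; apply: ge_inf => //; case: has_inf_reach. Qed.

Local Opaque limit_misfit.

Lemma reach_below e k : 0 < e -> 0 < k -> exists2 dl, 0 < dl & forall z, small_lip k dl z -> I - e <= J z.
Proof.
move=> e0 k0; apply: contrapT => H.
have : reach (I - e).
  exists k => // dl dl0; apply: contrapT => H'; apply: H; exists dl => // z Wz.
  by rewrite leNgt; apply/negP => Jz; apply: H'; exists z.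
move=> re; have : I <= I - e by exact: reach_inf.
by rewrite lerBrDr gerDl leNgt e0.
Qed.

(** Almost minimizers that are still almost minimal among functions of twice
    their size, which leaves room for variations; moreover their Lipschitz constant
    admits almost minimizers that are arbitrarily small. *)
Definition good (e k dl : R) v := [/\ 0 < k, 0 < dl,
  forall dl', 0 < dl' -> exists2 u, small_lip k dl' u & J u <= I + e,
  forall z, small_lip (2 * k + 1) (2 * dl) z -> I - e <= J z & small_lip k dl v /\ J v <= I + e].

Lemma exists_good e : 0 < e -> exists k dl v, good e k dl v.
Proof.
move=> e0; have [k k0 H] := reach_above e0.
have k10 : 0 < 2 * k + 1 by rewrite addr_gt0// mulr_gt0.
have [dl dl0 Hd] := reach_below e0 k10.
have d20 : 0 < dl / 2 by rewrite divr_gt0.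
have [v Wv Jv] := H _ d20; exists k, (dl / 2), v; split => //.
- by move=> dl' dl'0; have [u Wu Ju] := H _ dl'0; exact: (ex_intro2 _ _ u Wu (ltW Ju)).
- by move=> z; rewrite [2 * (dl / 2)]mulrC divfK//; exact: Hd.
- by split; [exact: Wv|exact: ltW Jv].
Qed.

(** Pass through an almost minimizer u that is k-Lipschitz and as small as both v
    and v': it competes with v, and with v' when k <= k'. *)
Lemma good_close e e' k dl v k' dl' v' : 0 < e -> 0 < e' -> good e k dl v -> good e' k' dl' v' ->
  q (fun x => grad v x - grad v' x) <= 32 * (e + e').
Proof.
wlog kk : e e' k dl v k' dl' v' / k <= k'.
  move=> H e0 e'0 g g'; have [kk|kk] := leP k k'; first exact: H kk e0 e'0 g g'.
  have := H _ _ _ _ _ _ _ _ (ltW kk) e'0 e0 g' g; rewrite [e' + e]addrC; apply: le_trans.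
  by rewrite ip_subC.
move=> e0 e'0 [k0 dl0 near low [Wv Jv]] [k'0 dl'0 near' low' [Wv' Jv']].
have m0 : 0 < Num.min dl dl' by rewrite lt_min dl0.
have [u Wu Ju] := near _ m0.
have bg w k1 dl1 : small_lip k1 dl1 w -> bounded_field (grad w).
  by case=> tw _ _; exact: bounded_field_grad.
have h1 : q (fun x => grad v x - grad u x) <= 8 * e.
  have lz z : small_lip k dl z -> I - e <= J z.
    by move=> Wz; apply: low; exact: (small_lipW (le_double1 k0) (le_double dl0) Wz).
  have Wu1 : small_lip k dl u by apply: (small_lipW (lexx k) _ Wu); rewrite ge_min lexx.
  exact: (almost_minimizers_close mu_radon bxi lz Wv Jv Wu1 Ju).
have h2 : q (fun x => grad u x - grad v' x) <= 8 * (e + e').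
  have lz z : small_lip k' dl' z -> I - (e + e') <= J z.
    move=> Wz; apply: le_trans (low' z _).
      by rewrite lerD2l lerN2 lerDr ltW.
    exact: (small_lipW (le_double1 k'0) (le_double dl'0) Wz).
  have Wu1 : small_lip k' dl' u by apply: (small_lipW kk _ Wu); rewrite ge_min lexx orbT.
  have Ju1 : J u <= I + (e + e') by apply: (le_trans Ju); rewrite lerD2l lerDl ltW.
  have Jv1 : J v' <= I + (e + e') by apply: (le_trans Jv'); rewrite lerD2l lerDr ltW.
  exact: (almost_minimizers_close mu_radon bxi lz Wu1 Ju1 Wv' Jv1).
have := q_triangle mu_radon r (bg _ _ _ Wv) (bg _ _ _ Wu) (bg _ _ _ Wv').
move: h1 h2 e0 e'0; move: (ip _ _) (ip _ _) (ip _ _) => a b c h1 h2 e0 e'0 h3; clear -h1 h2 e0 e'0 h3 mu; lra.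
Qed.

Lemma good_variation s k dl v w : 0 < s <= 1 -> good (s ^+ 2) k dl v -> small_lip (k + 1) dl w ->
  `|ip (fun x => grad v x - xi x) (grad w)| <= s * (1 + q (grad w)).
Proof.
move=> /andP[s0 s1] [k0 dl0 _ low [Wv Jv]] Ww.
have [tv _ _] := Wv; have [tw _ _] := Ww.
have lz t : `|t| = s -> I - s ^+ 2 <= J (fun x => v x + t * w x).
  move=> ts; apply: low; apply: (small_lipW _ _ (small_lipD Wv (small_lipZ t Ww))); rewrite ts.
    have : s * (k + 1) <= 1 * (k + 1) by rewrite ler_wpM2r// addr_ge0// ltW.
    by move=> h; apply: (@le_trans _ _ (k + 1 * (k + 1))); [rewrite lerD2l|rewrite mul1r addrA mulr_natl mulr2n].
  have : s * dl <= 1 * dl by rewrite ler_wpM2r// ltW.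
  by move=> h; apply: (@le_trans _ _ (dl + 1 * dl)); [rewrite lerD2l|rewrite mul1r mulr_natl mulr2n].
exact: (almost_minimizer_variation mu_radon bxi s0 lz Jv tv tw).
Qed.

(** Young's inequality: a bound in L2 gives one in L1 on the ball. *)
Lemma Int_coord_le F i c : bounded_field F -> 0 < c ->
  \int[mu]_x `|F x 0 i * \1_E x| <= c * muE + c^-1 * q F.
Proof.
move=> bF c0; have L1q := L1_ip mu_radon r bF bF; have L1e := L1_eball mu_radon r.
rewrite -(IntZ c L1e) -(IntZ c^-1 L1q) -(IntD (L1Z c L1e) (L1Z c^-1 L1q)).
have pt x : `|F x 0 i * \1_E x| <= c * \1_E x + c^-1 * (dot (F x) (F x) * \1_E x).
  rewrite normrM [`|\1_E x|]ger0_norm// mulrA -mulrDl ler_wpM2r//.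
  apply: le_trans (coord_le_enorm _ _) _; rewrite -sqr_enorm -(ler_pM2l c0) mulrDr mulVKf ?gt_eqF//.
  have := enorm_ge0 (F x); move: (enorm _) => a a0.
  have : 0 <= (c - a) ^+ 2 by exact: sqr_ge0.
  nra.
apply: le_Int => //.
- apply: L1_norm; apply: (@L1_dom _ _ _ mu _ (fun x => c * \1_E x + c^-1 * (dot (F x) (F x) * \1_E x))) => //.
    case: bF => mF _; apply: measurable_funM; first exact: mF.
    by apply: measurable_indic; exact: eball_borel.
  by apply: L1D; exact: L1Z.
- by apply: L1D; exact: L1Z.
Qed.

End minimisation.

(** * Normal fields are limits of gradients of small functions *)

Lemma cvg_sum0 (R : realType) (T : Type) (t : seq T) (f : T -> nat -> R) :
  (forall i, f i j @[j --> \oo] --> (0 : R)) -> \sum_(i <- t) f i j @[j --> \oo] --> (0 : R).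
Proof.
move=> h; elim: t => [|i t IH].
  by under eq_fun do rewrite big_nil; exact: cvg_cst.
under eq_fun do rewrite big_cons.
have : f i j + \sum_(i <- t) f i j @[j --> \oo] --> (0 + 0 : R) by exact: (cvgD (h i) IH).
by rewrite addr0.
Qed.

Lemma lt_half (R : realFieldType) (a b c e : R) : e < c -> c <= a + b -> b <= e / 2 -> e / 2 < a.
Proof. lra. Qed.

Lemma eighth_le (R : realFieldType) (n e e' : R) : e' <= n * e ^+ 2 / 32 -> 8 * e' <= (e / 2) ^+ 2 * n.
Proof.
have -> : (e / 2) ^+ 2 * n = n * e ^+ 2 / 4 by field.
lra.
Qed.

Lemma eighth_le3 (R : realFieldType) (i e e' : R) : 0 < e -> i <= e ^+ 3 / 16 -> e' <= e ^+ 3 / 16 ->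
  i + e' <= (e / 2) ^+ 2 * e.
Proof.
move=> e0; have -> : (e / 2) ^+ 2 * e = e ^+ 3 / 4 by field.
have : 0 < e ^+ 3 by rewrite exprn_gt0.
lra.
Qed.

Section normal_fields.
Context (R : realType) (d : nat).
Local Notation V := 'rV[R]_d.
Local Notation B := (borel R d).
Variable mu : {measure set B -> \bar R}.
Hypothesis mu_radon : radon mu.
Local Notation L1 := (L1 mu).
Variable (r : R).
Local Notation E := (eball r : set B).
Local Notation bounded_field := (@bounded_field R d).
Local Notation ip := (ip mu r).
Local Notation q F := (ip F F).
Local Notation muE := (muE mu r).

Definition L1gap (F eta : V -> V) := \sum_i \int[mu]_x `|F x 0 i * \1_E x - eta x 0 i|.

Lemma L1_coord F i : bounded_field F -> L1 (fun x : B => F x 0 i * \1_E x).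
Proof.
move=> [mF [M M0 hM]]; apply: (@L1_dom _ _ _ mu _ (fun x => M * \1_E x)).
- apply: measurable_funM; first exact: mF.
  by apply: measurable_indic; exact: eball_borel.
- move=> x; rewrite normrM [`|\1_E x|]ger0_norm// ler_wpM2r//.
  exact: le_trans (coord_le_enorm _ _) (hM x).
- by apply: L1Z; exact: L1_eball.
Qed.

(** On the ball, where mu is finite, a sequence with L2 increments of order 2 ^- j
    has L1 increments of order 2 ^- j: take c = 2 ^- j in Int_coord_le. *)
Lemma fields_complete (F : nat -> V -> V) (C : R) : (forall j, bounded_field (F j)) ->
  (forall j, q (fun x => F j.+1 x - F j x) <= C * (2 ^- j) ^+ 2) ->
  exists2 eta, L1vec mu eta & L1gap (F j) eta @[j --> \oo] --> (0 : R).
Proof.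
move=> bF qF.
have key i : exists2 g : B -> R, L1 g &
    \int[mu]_x `|F j x 0 i * \1_E x - g x| @[j --> \oo] --> (0 : R).
  apply: (@L1_complete _ B R mu (fun j x => F j x 0 i * \1_E x) (muE + C)).
    by move=> j; exact: L1_coord.
  move=> j; have c0 : 0 < (2 : R) ^- j by rewrite invr_gt0 exprn_gt0.
  have := Int_coord_le mu_radon r i (bounded_fieldB (bF j.+1) (bF j)) c0.
  rewrite (_ : \int[mu]_x _ = \int[mu]_x `|F j.+1 x 0 i * \1_E x - F j x 0 i * \1_E x|); last first.
    by apply: eq_Rintegral => x _; rewrite !mxE mulrBl.
  move=> /le_trans; apply.
  rewrite [X in _ <= X]mulrDl [X in X + _]mulrC lerD2l ler_pdivrMl//.
  apply: le_trans (qF j) _; rewrite expr2 mulrA mulrC; exact: lexx.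
have /choice[g hg] : forall i, exists g : B -> R, L1 g /\
    \int[mu]_x `|F j x 0 i * \1_E x - g x| @[j --> \oo] --> (0 : R).
  by move=> i; have [g Lg cg] := key i; exists g.
exists (fun x => \row_i g i x).
  move=> i; have [Lg _] := hg i.
  by rewrite /L1vec (_ : (fun x => _) = EFin \o g i)//; apply/funext => x; rewrite mxE.
rewrite /L1gap; apply: cvg_sum0 => i.
by under eq_fun do under eq_Rintegral do rewrite mxE; have [_] := hg i.
Qed.

Lemma ip_gap F eta G M : bounded_field F -> L1vec mu eta -> mvec G -> (forall x, enorm (G x) <= M) ->
  0 <= M -> `|ip F G - \int[mu]_x dot (eta x) (G x)| <= M * L1gap F eta.
Proof.
move=> bF Le mG GM M0.
have bG : bounded_field G by split => //; exists M.
have Lc i : L1 (fun x : B => `|F x 0 i * \1_E x - eta x 0 i|).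
  by apply: L1_norm; apply: L1B; [exact: L1_coord|exact: Le].
have Ld : L1 (fun x => dot (eta x) (G x)).
  rewrite (_ : (fun x => _) = (fun x => dot (G x) (eta x))); first exact: L1_dot GM Le.
  by apply/funext => x; rewrite dotC.
rewrite /ip -IntB; [|exact: L1_ip|exact: Ld].
have Is : \int[mu]_x (\sum_i `|F x 0 i * \1_E x - eta x 0 i|) = L1gap F eta.
  rewrite /L1gap; elim: (index_enum _) => [|i s IH].
    rewrite big_nil; under eq_Rintegral do rewrite big_nil; by rewrite /Rintegral integral0.
  rewrite big_cons -IH -IntD//; last exact: L1_sum.
  by apply: eq_Rintegral => x _; rewrite big_cons.
rewrite -Is -IntZ; last exact: L1_sum.
apply: norm_Int_le.
- by apply: L1B; [exact: L1_ip|exact: Ld].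
- by apply: L1Z; exact: L1_sum.
move=> x; rewrite (_ : _ - _ = dot (\1_E x *: F x - eta x) (G x)); last first.
  by rewrite dotBl dotZl mulrC.
apply: le_trans (norm_dot_le _ _) _; rewrite mulrC; apply: ler_pM; [exact: enorm_ge0|exact: enorm_ge0|exact: GM|].
apply: le_trans (enorm_le_sum _) _; apply: ler_sum => i _.
by rewrite !mxE mulrC.
Qed.

Variable xi : V -> V.
Hypothesis bxi : bounded_field xi.
Hypothesis xi_normal : forall eta, L1vec mu eta -> div_continuous mu eta ->
  \int[mu]_x dot (eta x) (xi x) = 0.
Local Notation J := (misfit mu r xi).
Local Notation I := (limit_misfit mu r xi).

(** The fields xi - grad v, for almost minimizers v, converge in L1 to some eta.
    Since first variations are small, eta pairs to almost 0 with small gradients: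
    it satisfies div_continuous, hence is orthogonal to xi.  As the first variation
    in the direction of v is small too, the misfit of v tends to 0. *)
Lemma limit_misfit_le0 : I <= 0.
Proof.
pose s j : R := 2 ^- j.
have s0 j : 0 < s j by rewrite invr_gt0 exprn_gt0.
have s1 j : s j <= 1 by rewrite invf_le1 ?exprn_gt0// exprn_ege1// ler1n.
have ss j : 0 < s j <= 1 by rewrite s0 s1.
have /choice[p hp] : forall j, exists p : R * R * (V -> R), good mu r xi (s j ^+ 2) p.1.1 p.1.2 p.2.
  move=> j; have e0 : 0 < s j ^+ 2 by rewrite exprn_gt0.
  by have [k [dl [v gv]]] := exists_good mu r xi e0; exists (k, dl, v).
pose v j := (p j).2; pose k j := (p j).1.1; pose dl j := (p j).1.2.
have g j : good mu r xi (s j ^+ 2) (k j) (dl j) (v j) := hp j.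
have tv j : test_function (v j) by case: (g j) => _ _ _ _ [[h _ _] _]; exact: h.
pose F j x := xi x - grad (v j) x.
have bv j : bounded_field (grad (v j)) by exact: bounded_field_grad.
have bF j : bounded_field (F j) by exact: bounded_fieldB.
have s20 j : 0 < s j ^+ 2 by rewrite exprn_gt0.
have qF j : q (fun x => F j.+1 x - F j x) <= 64 * (2 ^- j) ^+ 2.
  have -> : q (fun x => F j.+1 x - F j x) = q (fun x => grad (v j) x - grad (v j.+1) x).
    apply: eq_Rintegral => x _; rewrite (_ : F j.+1 x - F j x = grad (v j) x - grad (v j.+1) x)//.
    by rewrite /F opprB addrC subrKA.
  apply: le_trans (good_close mu_radon bxi (s20 j) (s20 j.+1) (g j) (g j.+1)) _.
  rewrite -[2 ^- j]/(s j) (_ : 64 = 32 * 2) -?mulrA ?ler_wpM2l//; last by rewrite -natrM.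
  rewrite mulr_natl mulr2n lerD2l; apply: lerXn2r; rewrite ?nnegrE ?(ltW (s0 _))//.
  by rewrite /s lef_pV2 ?posrE ?exprn_gt0// ler_weXn2l ?ler1n.
have [eta Le ceta] := fields_complete bF qF.
have cs : s j @[j --> \oo] --> (0 : R).
  rewrite (_ : s = (fun j => 2^-1 ^+ j)); last by apply/funext => j; rewrite /s exprVn.
  by apply: cvg_expr; rewrite ger0_norm ?invf_lt1 ?ltr1n.
have cu a b : s j * a + b * L1gap (F j) eta @[j --> \oo] --> (0 : R).
  have : s j * a + b * L1gap (F j) eta @[j --> \oo] --> (0 * a + b * 0 : R).
    by apply: cvgD; [exact: cvgMr_tmp cs|exact: cvgMl_tmp ceta].
  by rewrite mul0r mulr0 addr0.
have var j w : small_lip (k j + 1) (dl j) w -> `|ip (F j) (grad w)| <= s j * (1 + q (grad w)).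
  move=> Ww; have := good_variation mu_radon bxi (ss j) (g j) Ww.
  have [tw _ _] := Ww; have bw := bounded_field_grad tw.
  by rewrite (ipBl mu_radon r (bv j) bxi bw) (ipBl mu_radon r bxi (bv j) bw) distrC.
have De : div_continuous mu eta.
  move=> e e0; have [N _ HN] := (cvgrPdist_le _ _).1 (cu (1 + muE) 1) _ e0.
  have {HN} := HN N (leqnn N); rewrite sub0r normrN => /(le_trans (ler_norm _)) he.
  have [k0 dl0 _ _ _] := g N; exists (dl N); first exact: dl0.
  move=> w tw kw bw.
  have Ww : small_lip (k N + 1) (dl N) w.
    by split => //; apply: k_lipschitzW kw; rewrite lerDr ltW.
  have := var _ _ Ww.
  have gw x : enorm (grad w x) <= 1.
    by apply: lipschitz_grad kw => //; apply: smooth_diff; case: tw.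
  have [mw _] := bounded_field_grad tw.
  have := ip_gap (bF N) Le mw gw ler01.
  have -> : mdiv mu eta w = \int[mu]_x dot (eta x) (grad w x).
    by apply: eq_Rintegral => x _; rewrite dotC.
  have := q_measure mu_radon r (bounded_field_grad tw) gw.
  have := s0 N; move: he.
  move: (s N) (q (grad w)) (ip (F N) (grad w)) (\int[mu]_x dot (eta x) (grad w x)) (L1gap (F N) eta) => a b c t f.
  clear -e; rewrite !ler_norml => h1 a0 h2 /andP[h3 h4] /andP[h5 h6].
  have : a * b <= a * muE by rewrite ler_wpM2l// ltW.
  lra.
have [mxi [M M0 hM]] := bxi.
have JI j : I <= s j * (2 + (2 * (I + 1) + 2 * q xi)) + M * L1gap (F j) eta.
  have [k0 dl0 _ low [Wv Jv]] := g j.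
  have Wv1 : small_lip (k j + 1) (dl j) (v j) by apply: small_lipW Wv => //; rewrite lerDl.
  have h1 := var _ _ Wv1.
  have h2 := ip_gap (bF j) Le mxi hM M0; rewrite xi_normal// subr0 in h2.
  have h3 := q_le2 mu_radon r (bv j) bxi; rewrite -/(J (v j)) in h3.
  have h4 := low _ (small_lipW (le_double1 k0) (le_double dl0) Wv).
  have h5 : J (v j) = ip (F j) xi - ip (F j) (grad (v j)).
    rewrite -(ipBr mu_radon r bxi (bv j) (bF j)) /misfit ip_subC.
    by [].
  have := s0 j; have := s1 j; move: h1 h2 h3 h4 h5 Jv.
  move: (s j) (q (grad (v j))) (ip (F j) (grad (v j))) (ip (F j) xi) (J (v j)) (L1gap (F j) eta) (q xi) => a b c e f t u.
  clear -a; rewrite !ler_norml => /andP[h1 h1'] /andP[h2 h2'] h3 h4 h5 h6 h7 h8.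
  have a2 : a ^+ 2 <= a by rewrite expr2 ler_piMr// ltW.
  have : a * b <= a * (2 * (I + 1) + 2 * u).
    by rewrite ler_wpM2l ?(ltW h8)//; lra.
  lra.
by apply: (cvgr_to_ge (cu _ _)); apply: nearW; exact: JI.
Qed.

(** Chebyshev's inequality. *)
Lemma measure_deviation_le F (A : set B) a : measurable A -> 0 < a -> bounded_field F ->
  (forall x, A x -> E x /\ a < enorm (F x)) -> \int[mu]_x (\1_A x : R) <= a ^- 2 * q F.
Proof.
move=> mA a0 bF hA; have LF := L1_ip mu_radon r bF bF.
have a20 : 0 < a ^+ 2 by rewrite exprn_gt0.
have pt x : \1_A x <= a ^- 2 * (dot (F x) (F x) * \1_E x).
  rewrite !indicE; have [Ax|Ax] := pselect (A x).
    have [Ex aF] := hA _ Ax; rewrite !mem_set//= mulr1 ler_pdivlMl// mulr1 -sqr_enorm.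
    by rewrite lerXn2r ?nnegrE ?enorm_ge0 ?ltW.
  by rewrite memNset//= mulr_ge0 ?invr_ge0 ?(ltW a20)// mulr_ge0 ?dot_ge0.
rewrite -(IntZ _ LF); apply: le_Int => //; last exact: L1Z.
apply: (@L1_dom _ _ _ mu _ _ _ _ (L1Z (a ^- 2) LF)) => //.
by move=> x; rewrite ger0_norm.
Qed.

(** The order of quantifiers is essential: the number of functions to be averaged
    depends on k and e, and n has to be small compared with its inverse.  Outside A,
    one almost minimizer v0 at Lipschitz constant k has a gradient far from xi; on A,
    the other ones at the same k have gradients close to that of v0, by the
    parallelogram identity, with an error independent of e. *)
Lemma approx_by_small_gradients e : 0 < e -> exists2 k, 0 < k & forall n, 0 < n ->
  exists A : set B, [/\ measurable A, A `<=` E, \int[mu]_x (\1_(E `\` A) x : R) <= e &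
    forall dl, 0 < dl -> exists2 v, small_lip k dl v &
      \int[mu]_x (\1_(A `&` [set x | e < enorm (grad v x - xi x)]) x : R) <= n].
Proof.
move=> e0; have e1 : 0 < e ^+ 3 / 16 by rewrite divr_gt0// exprn_gt0.
have [k k0 hk] := reach_above mu r xi e1; exists k => // n n0.
pose rk := [set c | forall dl, 0 < dl -> exists2 v, small_lip k dl v & J v < c].
have rk0 : rk (I + e ^+ 3 / 16) by exact: hk.
have rkinf : has_inf rk.
  split; first by exists (I + e ^+ 3 / 16).
  exists 0 => c /(_ 1 ltr01)[v _ Jv]; exact: le_trans (misfit_ge0 mu r xi v) (ltW Jv).
pose e' := Num.min (e ^+ 3 / 16) (n * e ^+ 2 / 32).
have e'0 : 0 < e' by rewrite lt_min e1 divr_gt0// mulr_gt0// exprn_gt0.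
have e'1 : e' <= e ^+ 3 / 16 by rewrite ge_min lexx.
have e'2 : e' <= n * e ^+ 2 / 32 by rewrite ge_min lexx orbT.
have infle c : rk c -> inf rk <= c by move=> rc; apply: ge_inf => //; case: rkinf.
have Ile : inf rk <= e ^+ 3 / 16.
  by apply: le_trans (infle _ rk0) _; rewrite gerDr; exact: limit_misfit_le0.
have [dl0 dl00 low] : exists2 dl, 0 < dl & forall z, small_lip k dl z -> inf rk - e' <= J z.
  apply: contrapT => H.
  have : rk (inf rk - e').
    move=> dl dl0; apply: contrapT => H'; apply: H; exists dl => // z Wz.
    by rewrite leNgt; apply/negP => Jz; apply: H'; exists z.
  by move=> /infle; rewrite lerBrDr gerDl leNgt e'0.
have near dl : 0 < dl -> exists2 v, small_lip k dl v & J v <= inf rk + e'.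
  move=> dlp; have [c rc ci] := inf_adherent e'0 rkinf.
  by have [v Wv Jv] := rc _ dlp; exists v => //; apply: ltW; exact: lt_trans Jv ci.
have [v0 W0 J0] := near _ dl00; have [t0 _ _] := W0.
have b0 := bounded_field_grad t0; have b0' := bounded_misfit bxi t0.
have e20 : 0 < e / 2 by rewrite divr_gt0.
have msub a w : test_function w -> measurable [set x : B | a < enorm (grad w x - xi x)].
  move=> tw; have [mw _] := bounded_misfit bxi tw.
  rewrite -[X in measurable X]setTI; have := measurable_enorm mw.
  by move=> /(_ measurableT `]a, +oo[%classic); rewrite preimage_itvoy; apply.
pose D := [set x : B | e / 2 < enorm (grad v0 x - xi x)].
have mD : measurable D by exact: msub.
have mE : measurable E by exact: eball_borel.
exists (E `\` D); split.
- exact: measurableD.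
- by move=> x [].
- apply: le_trans (measure_deviation_le _ e20 b0' _) _.
  + by apply: measurableD => //; exact: measurableD.
  + by move=> x [Ex nD]; split => //; apply: contrapT => h; apply: nD.
  rewrite -/(J v0) ler_pdivrMl ?exprn_gt0//.
  apply: le_trans J0 _; exact: eighth_le3 e0 Ile e'1.
move=> dl dl0p; have mp : 0 < Num.min dl dl0 by rewrite lt_min dl0p.
have [v Wv Jv] := near _ mp; have [tv _ _] := Wv.
have Wv1 : small_lip k dl v by apply: (small_lipW (lexx k) _ Wv); rewrite ge_min lexx.
have Wv2 : small_lip k dl0 v by apply: (small_lipW (lexx k) _ Wv); rewrite ge_min lexx orbT.
exists v; first exact: Wv1.
have bv := bounded_field_grad tv.
apply: le_trans (measure_deviation_le _ e20 (bounded_fieldB bv b0) _) _.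
- by apply: measurableI; [exact: measurableD|exact: msub].
- move=> x [[Ex nD] h]; split; first exact: Ex.
  apply: lt_half h (enorm_triangle (grad v x) (grad v0 x) (xi x)) _.
  by rewrite leNgt; apply/negP.
have := almost_minimizers_close mu_radon bxi low Wv2 Jv W0 J0.
move: (q _) => a ha; rewrite ler_pdivrMl ?exprn_gt0//.
apply: le_trans ha _; exact: eighth_le e'2.
Qed.

End normal_fields.

(** * Averaging small functions *)

Lemma running_step_bound (R : realFieldType) (m e a b : R) : a <= m * (1 + 4 * e) -> b <= 1 + 3 * e ->
  a + b + e <= (m + 1) * (1 + 4 * e).
Proof. by move=> h1 h2; rewrite mulrDl mul1r; lra. Qed.

Lemma convex_bound (R : realFieldType) (p e a b : R) : 0 <= e -> 0 <= p -> p <= 1 -> a <= 1 + 3 * e -> b <= 1 ->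
  p * a + (1 - p) * b <= 1 + 3 * e.
Proof.
move=> e0 p0 p1 ha hb.
have h1 : p * a <= p * (1 + 3 * e) by rewrite ler_wpM2l.
have h2 : (1 - p) * b <= (1 - p) * (1 + 3 * e).
  by rewrite ler_wpM2l ?subr_ge0//; lra.
by apply: le_trans (lerD h1 h2) _; rewrite -mulrDl addrCA subrr addr0 mul1r.
Qed.

Lemma stopped_step_bound (R : realFieldType) (m e a b k : R) : 0 < e -> a <= m * (1 + 4 * e) + k -> b <= 1 ->
  a + b + e <= (m + 1) * (1 + 4 * e) + k.
Proof. by move=> e0 h1 h2; rewrite mulrDl mul1r; lra. Qed.

Lemma stopping_step_bound (R : realFieldType) (m e a b k : R) : 0 < e -> a <= m * (1 + 4 * e) -> b <= k + 1 ->
  a + b + e <= (m + 1) * (1 + 4 * e) + k.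
Proof. by move=> e0 h1 h2; rewrite mulrDl mul1r; lra. Qed.

Lemma good_step_bound (R : realFieldType) (m e a b : R) : a <= m * (2 * e) -> b <= e ->
  a + b + e <= (m + 1) * (2 * e).
Proof. by move=> h1 h2; rewrite mulrDl mul1r; lra. Qed.

Lemma good_cut_bound (R : realFieldType) (e a b : R) : 0 < e -> a <= e -> b <= 1 -> a + b <= 1 + 2 * e.
Proof. by move=> e0 h1 h2; lra. Qed.

Lemma indic_subU (R : realType) (T : Type) (S S1 S2 : set T) : S `<=` S1 `|` S2 ->
  forall x, (\1_S x : R) <= \1_S1 x + \1_S2 x.
Proof.
move=> h x; rewrite !indicE; have [Sx|Sx] := pselect (S x); last by rewrite (memNset Sx) addr_ge0.
by case: (h x Sx) => Sx'; rewrite (mem_set Sx) (mem_set Sx') ?lerDl ?lerDr.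
Qed.

Section averaging.
Context (R : realType) (d : nat).
Local Notation V := 'rV[R]_d.
Local Notation B := (borel R d).
Implicit Types (u v z psi : V -> R) (F : V -> V).

(** A function of the square of the norm of F, in order to be smooth at zeros of F. *)
Definition norm_cutoff (e : R) (F : V -> V) (x : V) : R :=
  sstep (((1 + 3 * e) ^+ 2 - dot (F x) (F x)) / ((1 + 3 * e) ^+ 2 - (1 + 2 * e) ^+ 2)).

Lemma norm_cutoff_den (e : R) : 0 < e -> 0 < (1 + 3 * e) ^+ 2 - (1 + 2 * e) ^+ 2.
Proof. by move=> e0; nra. Qed.

Lemma norm_cutoff_eq1 e F x : 0 < e -> enorm (F x) <= 1 + 2 * e -> norm_cutoff e F x = 1.
Proof.
move=> e0 Fx; apply: sstep_ge1; rewrite ler_pdivlMr ?norm_cutoff_den// mul1r -sqr_enorm.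
by rewrite lerD2l lerN2 lerXn2r ?nnegrE ?enorm_ge0//; lra.
Qed.

Lemma norm_cutoff_eq0 e F x : 0 < e -> norm_cutoff e F x != 0 -> enorm (F x) <= 1 + 3 * e.
Proof.
move=> e0; apply: contraR; rewrite -ltNge => Fx; apply/eqP; apply: sstep_le0.
apply: mulr_le0_ge0; last by rewrite invr_ge0 ltW ?norm_cutoff_den.
by rewrite subr_le0 -sqr_enorm lerXn2r ?nnegrE ?enorm_ge0 ?ltW//; lra.
Qed.

Lemma norm_cutoff_smooth e F : (forall n i, Cn n (fun x => F x 0 i)) -> smooth (norm_cutoff e F).
Proof.
move=> sF; apply/smoothP => n; apply: Cn_sstep; apply: CnM; last exact: Cn_cst.
by apply: CnB; [exact: Cn_cst|apply: Cn_dot => i; exact: sF].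
Qed.

Lemma norm_cutoff_test e u v t : 0 < e -> test_function u -> test_function v ->
  test_function (fun x => norm_cutoff e (fun x => grad v x + t *: grad u x) x - 1).
Proof.
move=> e0 tu tv; have [su [a a0 ua]] := (test_functionP _).1 tu.
have [sv [b b0 vb]] := (test_functionP _).1 tv.
apply/test_functionP; split.
  apply/smoothP => n; apply: CnB; last exact: Cn_cst.
  move: n; apply/smoothP; apply: norm_cutoff_smooth => n i.
  rewrite (_ : (fun x => _) = (fun x => grad v x 0 i + t * grad u x 0 i)); last first.
    by apply/funext => x; rewrite !mxE.
  by apply: CnD; [|apply: CnZ]; apply: Cn_grad; exact: (smoothP _).1.
exists (Num.max a b); first by rewrite lt_max a0.
move=> x; rewrite gt_max => /andP[xa xb].
rewrite norm_cutoff_eq1 ?subrr// (supp_grad ua xa) (supp_grad vb xb) scaler0 addr0 enorm0.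
by lra.
Qed.

Lemma norm_cutoff_ge0 e F x : 0 <= norm_cutoff e F x. Proof. exact: sstep_ge0. Qed.
Lemma norm_cutoff_le1 e F x : norm_cutoff e F x <= 1. Proof. exact: sstep_le1. Qed.

Variable mu : {measure set B -> \bar R}.
Hypothesis mu_radon : radon mu.
Local Notation L1 := (L1 mu).
Variables (xi : V -> V) (u0 : V -> R) (t e dl k n r : R) (A : set B).
Hypothesis mxi : mvec xi.
Hypotheses (tu0 : test_function u0) (ku0 : k_lipschitz 1 u0) (t01 : 0 <= t <= 1).
Hypothesis xiu : forall x, enorm (xi x + t *: grad u0 x) <= 1.
Hypotheses (e0 : 0 < e) (dl0 : 0 < dl) (k0 : 0 < k).
Hypotheses (mA : measurable A) (AE : A `<=` (eball r : set B)).
Hypothesis approx : forall dl', 0 < dl' -> exists2 v, small_lip k dl' v &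
  \int[mu]_x (\1_(A `&` [set x | e < enorm (grad v x - xi x)]) x : R) <= n.

(** State of the iteration after m steps: z is a sum of m small functions, each one
    multiplied by the factor 1 + psi of its time, which vanishes where one of the
    preceding functions had a large gradient; G is the set where all gradients are
    close to xi.  While 1 + psi is nonzero no large gradient has been met; in
    general at most one has, which costs k. *)
Definition averaging_state (m : nat) (z psi : V -> R) (G : set B) :=
  [/\ [/\ test_function z, test_function psi & forall x, 0 <= 1 + psi x <= 1],
    [/\ forall x, `|z x| <= m%:R * dl,
      forall x, 1 + psi x != 0 -> enorm (m%:R *: (t *: grad u0 x) + grad z x) <= m%:R * (1 + 4 * e) &
      forall x, enorm (m%:R *: (t *: grad u0 x) + grad z x) <= m%:R * (1 + 4 * e) + k] &
    [/\ measurable G, forall x, G x -> 1 + psi x = 1,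
      forall x, G x -> enorm (grad z x - m%:R *: xi x) <= m%:R * (2 * e) &
      \int[mu]_x (\1_(A `\` G) x : R) <= m%:R * n]].

Lemma L1_sub_eball (S : set B) : measurable S -> S `<=` A -> L1 (\1_S : B -> R).
Proof.
move=> mS SA; apply: L1_indic => //; apply: le_lt_trans (eball_fin mu_radon r).
by apply: le_measure; rewrite ?inE//; [exact: eball_borel|exact: subset_trans AE].
Qed.

Lemma tgrad_le1 x : enorm (t *: grad u0 x) <= 1.
Proof.
have [t0 t1] := andP t01.
rewrite enormZ ger0_norm// -[leRHS]mulr1; apply: ler_pM => //; first exact: enorm_ge0.
by apply: lipschitz_grad ku0 => //; apply: smooth_diff; case: tu0.
Qed.

Lemma averaging_init : averaging_state 0 (fun=> 0) (fun=> 0) setT.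
Proof.
have t0 := test_function0 R d.
split; first by split => // x; rewrite addr0 ler01 lexx.
  split => x; first by rewrite normr0 mul0r.
    by move=> _; rewrite scale0r grad_cst addr0 enorm0 mul0r.
  by rewrite scale0r grad_cst addr0 enorm0 mul0r add0r ltW.
split => // [x _|x _|]; first by rewrite addr0.
  by rewrite grad_cst scale0r subr0 enorm0 mul0r.
by rewrite setDT mul0r; under eq_Rintegral do rewrite indic0; rewrite /Rintegral integral0.
Qed.

(** The function v is chosen after psi, so small that v grad psi is at most e.  Where
    1 + psi is nonzero, the increment of the gradient is a convex combination of
    grad v + t grad u0 and t grad u0, up to this error; the first one is almost
    bounded by 1 where the new factor is nonzero. *)
Lemma averaging_step m z psi G : averaging_state m z psi G ->
  exists z' psi' G', averaging_state m.+1 z' psi' G'.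
Proof.
move=> [[tz tpsi psi01] [zb gz1 gz2] [mG G1 Gz GA]].
have [L L0 psiL] := test_lipschitz tpsi.
(* |v| <= e / L makes v grad psi at most e *)
have dl'0 : 0 < Num.min dl (e / L) by rewrite lt_min dl0 divr_gt0.
have [v [tv kv vb] vA] := approx dl'0.
have [sz _] := tz; have [spsi _] := tpsi; have [sv _] := tv; have [su _] := tu0.
pose F x := grad v x + t *: grad u0 x.
pose psi' x := psi x + ((norm_cutoff e F x - 1) + psi x * (norm_cutoff e F x - 1)).
have tc : test_function (fun x => norm_cutoff e F x - 1) by exact: norm_cutoff_test.
have psi'E x : 1 + psi' x = (1 + psi x) * norm_cutoff e F x by rewrite /psi'; ring.
pose Phi x := 1 + psi x.
have sPhi : smooth Phi by apply: smoothD => //; apply/smoothP => i; exact: Cn_cst.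
pose z' x := z x + Phi x * v x.
have gz' x : grad z' x = grad z x + (Phi x *: grad v x + v x *: grad psi x).
  have dPhi : differentiable Phi x by exact: smooth_diff.
  have dv : differentiable v x by exact: smooth_diff.
  have dPv : differentiable (fun x => Phi x * v x) x by apply: smooth_diff; exact: smoothM.
  rewrite (gradD (smooth_diff x sz) dPv) (gradM dPhi dv).
  suff -> : grad Phi x = grad psi x by [].
  have d1 : differentiable (fun _ : V => 1 : R) x by apply: (@Cn_diff _ _ 1); exact: Cn_cst.
  by rewrite (gradD d1 (smooth_diff x spsi)) grad_cst add0r.
have small x : enorm (v x *: grad psi x) <= e.
  rewrite enormZ.
  have gp : enorm (grad psi x) <= L by apply: lipschitz_grad psiL; [exact: ltW|exact: smooth_diff].
  have vx : `|v x| <= e / L by apply: le_trans (vb x) _; rewrite ge_min lexx orbT.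
  apply: le_trans (ler_pM _ _ vx gp) _; rewrite ?enorm_ge0//.
  by rewrite divfK// gt_eqF.
have gv x : enorm (grad v x) <= k.
  by apply: lipschitz_grad kv; [exact: ltW|exact: smooth_diff].
have tg := tgrad_le1.
have Phi01 x : 0 <= Phi x <= 1 by exact: psi01.
pose T0 x := m%:R *: (t *: grad u0 x) + grad z x.
have decomp x : m.+1%:R *: (t *: grad u0 x) + grad z' x =
   T0 x + (Phi x *: F x + (1 - Phi x) *: (t *: grad u0 x)) + v x *: grad psi x.
  rewrite gz' /T0 /F -natr1.
  by apply/rowP => i; rewrite !mxE; ring.
have decomp2 x : m.+1%:R *: (t *: grad u0 x) + grad z' x =
   T0 x + (Phi x *: grad v x + t *: grad u0 x) + v x *: grad psi x.
  by rewrite gz' /T0 -natr1; apply/rowP => i; rewrite !mxE; ring.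
have mGd : measurable [set x : B | enorm (grad v x - xi x) <= e].
  rewrite -[X in measurable X]setTI; have := measurable_enorm (mvecB (mvec_grad sv) mxi).
  by move=> /(_ measurableT `]-oo, e]%classic); rewrite preimage_itvNyc; apply.
exists z', psi', (G `&` [set x | enorm (grad v x - xi x) <= e]); split.
- split.
  + by apply: test_functionD => //; exact: test_functionMl.
  + by apply: test_functionD => //; apply: test_functionD => //; exact: test_functionMl.
  + move=> x; rewrite psi'E; have /andP[p0 p1] := psi01 x.
    by rewrite mulr_ge0 ?norm_cutoff_ge0//= mulr_ile1 ?norm_cutoff_ge0 ?norm_cutoff_le1.
- split => x.
  + apply: le_trans (ler_normD _ _) _.
    have -> : m.+1%:R * dl = m%:R * dl + dl by rewrite -natr1 mulrDl mul1r.
    apply: lerD; first exact: zb.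
    have /andP[p0 p1] := Phi01 x; rewrite normrM ger0_norm//.
    apply: le_trans (ler_piMl _ p1) _ => //.
    by apply: le_trans (vb x) _; rewrite ge_min lexx.
  + rewrite psi'E mulf_eq0 negb_or => /andP[p0 /(norm_cutoff_eq0 e0) hF].
    rewrite decomp; apply: le_trans (enormD _ _) _; apply: le_trans (lerD (enormD _ _) (small x)) _.
    rewrite -natr1; apply: running_step_bound (gz1 x p0) _.
    have /andP[q0 q1] := Phi01 x.
    apply: le_trans (enormD _ _) _; rewrite (enormZ (Phi x)) (enormZ (1 - Phi x)).
    rewrite (ger0_norm q0) (@ger0_norm _ (1 - Phi x)) ?subr_ge0//.
    exact: convex_bound (ltW e0) q0 q1 hF (tg x).
  + rewrite decomp2; apply: le_trans (enormD _ _) _; apply: le_trans (lerD (enormD _ _) (small x)) _.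
    have /andP[q0 q1] := Phi01 x.
    have gk : enorm (Phi x *: grad v x) <= Phi x * k by rewrite enormZ ger0_norm// ler_wpM2l.
    have gs : enorm (Phi x *: grad v x + t *: grad u0 x) <= Phi x * k + 1.
      by apply: le_trans (enormD _ _) _; exact: lerD.
    have [p0|p0] := eqVneq (Phi x) 0.
      have gs1 := le_trans gs (_ : Phi x * k + 1 <= 1); rewrite p0 mul0r add0r lexx in gs1.
      by rewrite -natr1 p0; exact: stopped_step_bound e0 (gz2 x) (gs1 isT).
    have gs' : enorm (Phi x *: grad v x + t *: grad u0 x) <= k + 1.
      by apply: le_trans gs _; rewrite lerD2r ler_piMl// ltW.
    rewrite -natr1; exact: stopping_step_bound e0 (gz1 x p0) gs'.
- have h x : enorm (grad v x - xi x) <= e -> norm_cutoff e F x = 1.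
    move=> h; apply: norm_cutoff_eq1 => //.
    rewrite /F -[grad v x](subrK (xi x)) -addrA; apply: le_trans (enormD _ _) _.
    exact: good_cut_bound e0 h (xiu x).
  split.
  + exact: measurableI.
  + by move=> x [Gx hx]; rewrite psi'E G1// h// mulr1.
  + move=> x [Gx hx]; rewrite gz' /Phi G1// scale1r.
    rewrite (_ : _ - _ = (grad z x - m%:R *: xi x) + (grad v x - xi x) + v x *: grad psi x); last first.
      by rewrite -natr1; apply/rowP => i; rewrite !mxE; ring.
    apply: le_trans (enormD _ _) _; apply: le_trans (lerD (enormD _ _) (small x)) _.
    rewrite -natr1; exact: good_step_bound (Gz x Gx) hx.
  + rewrite -natr1 mulrDl mul1r; apply: le_trans (lerD GA vA).
    have mS : measurable (A `&` [set x : B | e < enorm (grad v x - xi x)]).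
      apply: measurableI => //; rewrite (_ : [set x | _] = ~` [set x : B | enorm (grad v x - xi x) <= e]).
        exact: measurableC.
      by apply/seteqP; split => x /=; rewrite ltNge => /negP.
    have L1a := L1_sub_eball (measurableD mA mG) (@subDsetl _ A G).
    have L1b := L1_sub_eball mS (@subIsetl _ A _).
    have L1c := L1_sub_eball (measurableD mA (measurableI _ _ mG mGd)) (@subDsetl _ A _).
    rewrite -(IntD L1a L1b); apply: (le_Int L1c (L1D L1a L1b)).
    apply: indic_subU => x [Ax nG].
    have [Gx|Gx] := pselect (G x); last by left.
    right; split; first exact: Ax.
    by rewrite /= ltNge; apply/negP => hx; apply: nG.
Qed.

Lemma averaging_iter m : exists z psi G, averaging_state m z psi G.
Proof.
elim: m => [|m [z [psi [G H]]]]; first by exists (fun=> 0), (fun=> 0), setT; exact: averaging_init.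
exact: averaging_step H.
Qed.

End averaging.

(** * Correctors *)

Lemma corrector_error_bound (R : realFieldType) (e e' M a b c f : R) : f <= e / 28 -> b <= e / 28 -> c <= M * (2 * e') ->
  e' * (56 * (M + a)) <= e -> 0 < e' -> 0 <= a -> 0 < M -> 
  2 * e' * a + 7 * (b + c) + 7 * f <= e.
Proof.
move=> h1 h2 h3 h4 e0 a0 M0.
have : 0 <= e' * a by rewrite mulr_ge0// ltW.
have : 0 < e' * M by rewrite mulr_gt0.
nra.
Qed.

Section corrector.
Context (R : realType) (d : nat).
Local Notation V := 'rV[R]_d.
Local Notation B := (borel R d).
Variable mu : {measure set B -> \bar R}.
Hypothesis mu_radon : radon mu.
Local Notation L1 := (L1 mu).

Definition corrector (r : R) (zeta : V -> V) (t : R) (u0 : V -> R) (e : R) (z : V -> R) :=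
  [/\ test_function z, forall x, `|z x| <= e,
    forall x, enorm (t *: grad u0 x + grad z x) <= 1 + 5 * e &
    exists G : set B, [/\ measurable G,
      forall x, G x -> enorm (t *: grad u0 x + grad z x - zeta x) <= 2 * e &
      \int[mu]_x (\1_((eball r : set B) `\` G) x : R) <= 2 * e]].

(** The mean of N functions, for N > k / e: the large gradient that each point may
    meet contributes k / N < e. *)
Lemma corrector_exists r xi u0 t e : bounded_field xi ->
  (forall eta, L1vec mu eta -> div_continuous mu eta -> \int[mu]_x dot (eta x) (xi x) = 0) ->
  test_function u0 -> k_lipschitz 1 u0 -> 0 <= t <= 1 ->
  (forall x, enorm (xi x + t *: grad u0 x) <= 1) -> 0 < e ->
  exists z, corrector r (fun x => xi x + t *: grad u0 x) t u0 e z.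
Proof.
move=> bxi xiN tu0 ku0 t01 xiu e0.
have [k k0 approx] := approx_by_small_gradients mu_radon r bxi xiN e0.
pose N := Num.bound (k / e).
have kN : k / e < N%:R by apply: archi_boundP; rewrite divr_ge0// ltW.
have N0 : 0 < N%:R :> R by apply: lt_trans kN; rewrite divr_gt0.
have n0 : 0 < e / N%:R by rewrite divr_gt0.
have [A [mA sA EA hA]] := approx _ n0.
have [mxi _] := bxi.
have [z [psi [G [[tz _ _] [zb _ gz] [mG _ Gz GA]]]]] :=
  averaging_iter mu_radon mxi tu0 ku0 t01 xiu e0 e0 k0 mA sA hA N.
have [sz _] := tz; have dz x := smooth_diff x sz.
have gE x : t *: grad u0 x + grad (fun x => N%:R^-1 * z x) x =
    N%:R^-1 *: (N%:R *: (t *: grad u0 x) + grad z x).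
  by rewrite gradZ//; apply/rowP => i; rewrite !mxE; field; rewrite gt_eqF.
exists (fun x => N%:R^-1 * z x); split.
- exact: test_functionZ.
- by move=> x; rewrite normrM gtr0_norm ?invr_gt0// ler_pdivrMl.
- move=> x; rewrite gE enormZ gtr0_norm ?invr_gt0// ler_pdivrMl//.
  apply: le_trans (gz x) _; move: kN; rewrite ltr_pdivrMr// => /ltW.
  move=> h; have -> : N%:R * (1 + 5 * e) = N%:R * (1 + 4 * e) + N%:R * e by ring.
  by rewrite lerD2l.
exists (A `&` G); split; first exact: measurableI.
  move=> x [_ Gx]; rewrite gE.
  rewrite (_ : _ - _ = N%:R^-1 *: (grad z x - N%:R *: xi x)); last first.
    by apply/rowP => i; rewrite !mxE; field; rewrite gt_eqF.
  by rewrite enormZ gtr0_norm ?invr_gt0// ler_pdivrMl// Gz.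
have mE : measurable (eball r : set B) by exact: eball_borel.
have L1S (S : set B) : measurable S -> S `<=` eball r -> L1 (\1_S : B -> R).
  move=> mS SE; apply: L1_indic => //; apply: le_lt_trans (eball_fin mu_radon r).
  by apply: le_measure; rewrite ?inE.
have L1a := L1S _ (measurableD mE mA) (@subDsetl _ _ _).
have L1b := L1S _ (measurableD mA mG) (subset_trans (@subDsetl _ _ _) sA).
have L1c := L1S _ (measurableD mE (measurableI _ _ mA mG)) (@subDsetl _ _ _).
apply: (@le_trans _ _ (\int[mu]_x (\1_((eball r : set B) `\` A) x + \1_(A `\` G) x : R))).
  apply: (le_Int L1c (L1D L1a L1b)); apply: indic_subU => x [Ex nAG].
  have [Ax|Ax] := pselect (A x); last by left.
  by right; split => // Gx; apply: nAG.
rewrite (IntD L1a L1b) mulr_natl mulr2n; apply: lerD => //.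
by apply: le_trans GA _; rewrite mulrC divfK// gt_eqF.
Qed.

(** The integral of |nu| is small outside a large ball, and on sets of small measure
    by approximation of |nu| by a bounded function phi. *)
Lemma corrector_pairing nu zeta t u0 e : L1vec mu nu -> mvec zeta -> (forall x, enorm (zeta x) <= 1) ->
  test_function u0 -> 0 < e ->
  exists r e1, 0 < e1 /\ forall e' z, 0 < e' <= e1 -> corrector r zeta t u0 e' z ->
    \int[mu]_x dot (zeta x) (nu x) - e <= \int[mu]_x dot (t *: grad u0 x + grad z x) (nu x).
Proof.
move=> Ln mz z1 tu0 e0; have L1n := L1vec_enorm Ln.
have e28 : 0 < e / 28 by rewrite divr_gt0.
have [r r0 tail] := tail_small L1n (fun x => enorm_ge0 (nu x)) e28.
have [phi tphi hphi] := test_dense_L1 mu_radon L1n e28.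
have [M M0 phiM] := test_bounded tphi.
have v0 : 0 <= vI mu nu by exact: vI_ge0.
have D0 : 0 < 56 * (M + vI mu nu) by rewrite mulr_gt0// ltr_wpDr.
exists r, (Num.min 1 (e / (56 * (M + vI mu nu)))); split.
  by rewrite lt_min ltr01 divr_gt0.
move=> e' z /andP[e'0]; rewrite le_min => /andP[e'1 e'2] [tz _ gz [G [mG Gz EG]]].
rewrite ler_pdivlMr// in e'2.
have mE : measurable (eball r : set B) by exact: eball_borel.
have mEG := measurableD mE mG.
pose W x := t *: grad u0 x + grad z x.
have mW : mvec W by apply: mvecD; [apply: mvecZ|]; apply: mvec_grad; [case: tu0|case: tz].
have LW : L1 (fun x => dot (W x) (nu x)) by exact: L1_dot gz Ln.
have Lz : L1 (fun x => dot (zeta x) (nu x)) by exact: L1_dot z1 Ln.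
have LEG : L1 (\1_((eball r : set B) `\` G) : B -> R).
  by apply: L1_indic => //; apply: le_lt_trans (eball_fin mu_radon r); apply: le_measure; rewrite ?inE.
have LnE : L1 (fun x => enorm (nu x) - enorm (nu x) * \1_(eball r : set B) x).
  apply: (L1_dom _ _ L1n) => [|x].
    apply: measurable_funB; first exact: (L1_measurable L1n).
    by apply: measurable_funM; [exact: (L1_measurable L1n)|exact: measurable_indic].
  rewrite indicE; case: (_ \in _); rewrite /= ?mulr1 ?mulr0 ?subrr ?subr0 ?normr0 ?enorm_ge0//.
  by rewrite ger0_norm ?enorm_ge0.
have Lphi : L1 (fun x => `|enorm (nu x) - phi x|).
  by apply: L1_norm; apply: L1B => //; exact: test_L1.
rewrite lerBlDr -lerBlDl -(IntB Lz LW).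
(* on G the error is at most 2 e' |nu|, elsewhere at most 7 |nu|; in the ball |nu|
   is replaced by phi, which is bounded by M *)
pose bnd x := 2 * e' * enorm (nu x) + 7 * (`|enorm (nu x) - phi x| + M * \1_((eball r : set B) `\` G) x)
  + 7 * (enorm (nu x) - enorm (nu x) * \1_(eball r : set B) x).
have pt x : dot (zeta x) (nu x) - dot (W x) (nu x) <= bnd x.
  rewrite -dotBl; apply: le_trans (dot_le_enorm _ _) _.
  have n0 := enorm_ge0 (nu x).
  have a1 : enorm (zeta x - W x) <= 7.
    by apply: le_trans (enormB _ _) _; have := z1 x; have := gz x; rewrite -/(W x); lra.
  have p0 : 0 <= `|enorm (nu x) - phi x| by [].
  rewrite /bnd !indicE; have [Ex|Ex] := pselect (eball r x); last first.
    rewrite (memNset Ex) memNset; last by case.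
    rewrite /= !mulr0 addr0 subr0.
    have h7 : enorm (zeta x - W x) * enorm (nu x) <= 7 * enorm (nu x) by rewrite ler_wpM2r.
    apply: (le_trans h7); rewrite lerDr; apply: addr_ge0; apply: mulr_ge0 => //.
    by rewrite mulr_ge0// ltW.
  rewrite (mem_set Ex) /= mulr1 subrr mulr0 addr0.
  have [Gx|Gx] := pselect (G x).
    have : enorm (zeta x - W x) * enorm (nu x) <= 2 * e' * enorm (nu x).
      by rewrite ler_wpM2r// enormBC; exact: Gz.
    rewrite memNset; last by case.
    rewrite /= mulr0 addr0 => /le_trans; apply; rewrite lerDl mulr_ge0//.
  rewrite mem_set; last by split.
  rewrite /= mulr1.
  have h1 : enorm (nu x) <= `|enorm (nu x) - phi x| + M.
    rewrite -[leLHS](subrK (phi x)); apply: lerD; first exact: ler_norm.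
    exact: le_trans (ler_norm _) (phiM x).
  have : enorm (zeta x - W x) * enorm (nu x) <= 7 * (`|enorm (nu x) - phi x| + M) by exact: ler_pM (enorm_ge0 _) n0 a1 h1.
  by move=> /le_trans; apply; rewrite lerDr mulr_ge0// mulr_ge0// ltW.
have LMG := L1D Lphi (L1Z M LEG).
have Lb := L1D (L1D (L1Z (2 * e') L1n) (L1Z 7 LMG)) (L1Z 7 LnE).
apply: le_trans (le_Int (L1B Lz LW) Lb pt) _.
rewrite (IntD (L1D (L1Z (2 * e') L1n) (L1Z 7 LMG)) (L1Z 7 LnE)) (IntD (L1Z (2 * e') L1n) (L1Z 7 LMG)).
rewrite (IntZ _ L1n) (IntZ _ LMG) (IntZ _ LnE) (IntD Lphi (L1Z M LEG)) (IntZ M LEG) -/(vI mu nu).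
have hM : M * \int[mu]_x (\1_((eball r : set B) `\` G) x : R) <= M * (2 * e') by rewrite ler_wpM2l// ltW.
move: tail hphi hM e'2 e'0 v0 M0.
exact: corrector_error_bound.
Qed.
End corrector.

(** * A Borel version of the tangent bundle *)

Section bundle.
Context (R : realType) (d : nat).
Local Notation V := 'rV[R]_d.
Local Notation B := (borel R d).
Local Notation Lip := (Lip R d).

Variable mu : {measure set B -> \bar R}.
Hypothesis mu_radon : radon mu.
Local Notation L1 := (L1 mu).

(** Set the bundle to 0 on a null set outside which its projections agree with Borel
    functions. *)
Lemma borel_bundle (T : V -> 'M[R]_d) : mu_measurable_subspaces mu T ->
  exists T' : V -> 'M[R]_d, {ae mu, forall x, T' x = T x} /\
    forall i j, measurable_fun setT (fun x : B => orthoproj (T' x) i j).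
Proof.
move=> mT.
have /choice[g hg] : forall p : 'I_d * 'I_d, exists g : B -> R, measurable_fun setT g /\
    {ae mu, forall x, orthoproj (T x) p.1 p.2 = g x}.
  by move=> p; have [g mg eg] := mT p.1 p.2; exists g.
have [N [mN N0 hN]] : {ae mu, forall x, forall p, orthoproj (T x) p.1 p.2 = g p x}.
  by apply: filter_forall => p; case: (hg p).
exists (fun x => if x \in N then 0 else T x); split.
  by exists N; split => // x /= h; apply: contrapT => Nx; apply: h; rewrite memNset.
move=> i j; have [mg _] := hg (i, j).
rewrite (_ : (fun x => _) = (fun x : B => g (i, j) x * \1_(~` N) x)).
  by apply: measurable_funM => //; apply: measurable_indic; exact: measurableC.
apply/funext => x; rewrite indicE; have [Nx|Nx] := pselect (N x).
  rewrite (mem_set Nx) orthoproj0 mxE memNset ?mulr0//; exact.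
rewrite (memNset Nx) mem_set// mulr1.
have : forall p, orthoproj (T x) p.1 p.2 = g p x by apply: contrapT => h; apply: Nx; exact: hN.
by move=> /(_ (i, j)).
Qed.

Variable P : V -> 'M[R]_d.
Hypothesis mP : forall i j, measurable_fun setT (fun x : B => orthoproj (P x) i j).

Lemma mvec_proj F : mvec F -> mvec (fun x => F x *m orthoproj (P x)).
Proof.
move=> mF i; rewrite (_ : (fun x => _) = (fun x : B => \sum_j F x 0 j * orthoproj (P x) j i)).
  by apply: measurable_sum => j; apply: measurable_funM; [exact: mF|exact: mP].
by apply/funext => x; rewrite mxE.
Qed.

Lemma L1vec_proj F : L1vec mu F -> L1vec mu (fun x => F x *m orthoproj (P x)).
Proof.
move=> LF; apply: (L1vec_dom _ _ (L1vec_enorm LF)); first exact: mvec_proj (L1vec_mvec LF).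
by move=> x; exact: enorm_orthoproj.
Qed.

(** The exponential form of F / |F| is visibly measurable, and it is 0 where F is 0. *)
Definition direction (F : V -> V) (x : V) : V := expR (- ln (enorm (F x))) *: F x.

Lemma mvec_direction F : mvec F -> mvec (direction F).
Proof.
move=> mF; apply: mvecMZ => //; apply: measurableT_comp; first exact: measurable_expR.
apply: measurableT_comp => //; apply: measurableT_comp; first exact: measurable_ln.
exact: measurable_enorm.
Qed.

Lemma direction_dot F x : dot (direction F x) (F x) = enorm (F x).
Proof.
rewrite dotZl -sqr_enorm; have [->|F0] := eqVneq (enorm (F x)) 0; first by rewrite expr0n mulr0.
have Fp : 0 < enorm (F x) by rewrite lt0r F0 enorm_ge0.
by rewrite expRN lnK ?posrE// expr2 mulKf.
Qed.

Lemma direction_sqr_le1 F x : dot (direction F x) (direction F x) <= 1.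
Proof.
rewrite /direction dotZr -/(direction F x) direction_dot.
have [->|F0] := eqVneq (enorm (F x)) 0; first by rewrite mulr0.
have Fp : 0 < enorm (F x) by rewrite lt0r F0 enorm_ge0.
by rewrite expRN lnK ?posrE// mulVf.
Qed.

End bundle.

(** * The test functions of the lower bound *)

Lemma damped_ge (R : realFieldType) (y e e' : R) : 0 < e' -> 10 * (`|y| + 1) * e' <= e ->
  y - e / 2 <= (1 + 5 * e')^-1 * y.
Proof.
move=> e0 h; have p : 0 < 1 + 5 * e' by lra.
rewrite -(ler_pM2l p) mulVKf ?gt_eqF//.
have y0 : 0 <= `|y| by [].
have h1 : y <= `|y| := ler_norm y.
have h2 : 5 * e' * y <= 5 * e' * `|y| by rewrite ler_wpM2l// mulr_ge0// ltW.
have h3 : 0 <= e by apply: le_trans h; rewrite mulr_ge0 ?mulr_ge0 ?addr_ge0// ltW.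
have h4 : 0 <= 5 * e' * (e / 2) by rewrite mulr_ge0 ?divr_ge0 ?mulr_ge0// ltW.
have -> : (1 + 5 * e') * (y - e / 2) = y + 5 * e' * y - e / 2 - 5 * e' * (e / 2) by ring.
lra.
Qed.

Lemma witness_error_bound (R : realFieldType) (i j e t a b c d : R) : i - e / 4 <= j -> - (e / 8) <= c -> d <= e / 8 ->
  i + t * (a - b) - e / 2 <= t * a + c + j - (t * b + d).
Proof. by rewrite mulrBr => h1 h2 h3; lra. Qed.

Section lower_bound.
Context (R : realType) (d : nat).
Local Notation V := 'rV[R]_d.
Local Notation B := (borel R d).
Local Notation Lip := (Lip R d).
Variable mu : {measure set B -> \bar R}.
Hypothesis mu_radon : radon mu.
Local Notation L1 := (L1 mu).
Variables (T P : V -> 'M[R]_d) (sigma : V -> V).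
Hypothesis T_tangent : forall eta, L1vec mu eta ->
  (MKfields mu eta <-> {ae mu, forall x, (eta x <= T x)%MS}).
Hypothesis PT : {ae mu, forall x, P x = T x}.
Hypothesis mP : forall i j, measurable_fun setT (fun x : B => orthoproj (P x) i j).
Hypothesis Ls : L1vec mu sigma.

Definition tangential (F : V -> V) x := F x *m orthoproj (P x).
Local Notation tau := (tangential sigma).
Definition normal x := sigma x - tau x.
Local Notation nu := normal.

Lemma tangential_MK : MKfields mu tau.
Proof.
apply/(T_tangent (L1vec_proj mP Ls)).
by apply: (@filterS _ _ (ae_filter_ringOfSetsType mu) _ _ _ PT) => x <-; exact: orthoproj_sub.
Qed.

Lemma L1vec_normal : L1vec mu nu.
Proof. by apply: L1vecB => //; exact: L1vec_proj. Qed.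

(** By div_continuousP, such a field eta is tangent. *)
Lemma normal_orth xi eta : (forall x w, (w <= P x)%MS -> dot (xi x) w = 0) ->
  L1vec mu eta -> div_continuous mu eta -> \int[mu]_x dot (eta x) (xi x) = 0.
Proof.
move=> xiP Le /(div_continuousP mu_radon Le)/(T_tangent Le) hT.
rewrite (_ : \int[mu]_x _ = \int[mu]_(x in setT) (fun=> 0) x); first by rewrite /Rintegral integral0.
apply: ae_eq_Rintegral; near=> x.
have Px : P x = T x by near: x; exact: PT.
by rewrite dotC; apply: xiP; rewrite Px; near: x; exact: hT.
Unshelve. all: by end_near. 
Qed.

Lemma normal_dot x w : (w <= P x)%MS -> dot (nu x) w = 0.
Proof. exact: orthoproj_orth. Qed.

(** The gradient aimed at in the lower bound: its norm is at most 1 when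
    s ^+ 2 + t ^+ 2 <= 1, and its product with the normal part is s |nu|. *)
Definition ideal (s t : R) (u0 : V -> R) (x : V) : V :=
  s *: direction nu x + t *: tangential (grad u0) x.

(** What remains of the ideal gradient after subtraction of t grad u0 is normal to
    the bundle, hence can be produced by small functions. *)
Definition ideal_corr (s t : R) (u0 : V -> R) (x : V) : V :=
  s *: direction nu x - t *: (grad u0 x - tangential (grad u0) x).

Lemma ideal_corrE s t u0 x : ideal_corr s t u0 x + t *: grad u0 x = ideal s t u0 x.
Proof. by apply/rowP => i; rewrite !mxE; ring. Qed.

Section witness.
Variables (u0 : V -> R) (s t : R).
Hypotheses (tu0 : test_function u0) (ku0 : k_lipschitz 1 u0).
Hypotheses (t0 : 0 <= t) (st : s ^+ 2 + t ^+ 2 <= 1).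

Lemma t_le1 : t <= 1.
Proof.
rewrite -(@expr_le1 _ 2)//; apply: le_trans st; rewrite lerDr; exact: sqr_ge0.
Qed.

Lemma grad_u0_le1 x : enorm (grad u0 x) <= 1.
Proof. by apply: lipschitz_grad ku0 => //; apply: smooth_diff; case: tu0. Qed.

Lemma mvec_gradu0 : mvec (grad u0).
Proof. by apply: mvec_grad; case: tu0. Qed.

Lemma mvec_nu_dir : mvec (direction nu).
Proof. by apply: mvec_direction; exact: L1vec_mvec L1vec_normal. Qed.

Lemma direction_enorm_le1 x : enorm (direction nu x) <= 1.
Proof.
rewrite -(@expr_le1 _ 2) ?enorm_ge0// sqr_enorm; exact: direction_sqr_le1.
Qed.

Lemma ideal_le1 x : enorm (ideal s t u0 x) <= 1.
Proof.
rewrite -(@expr_le1 _ 2) ?enorm_ge0// sqr_enorm /ideal.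
have h : dot (direction nu x) (tangential (grad u0) x) = 0.
  by rewrite dotZl normal_dot ?mulr0//; exact: orthoproj_sub.
have h1 : dot (tangential (grad u0) x) (tangential (grad u0) x) <= 1.
  rewrite -sqr_enorm expr_le1 ?enorm_ge0//.
  exact: le_trans (enorm_orthoproj _ _) (grad_u0_le1 x).
have h2 := direction_sqr_le1 nu x.
move: (direction nu x) (tangential _ x) h h1 h2 => D G h h1 h2.
rewrite !(dotDl, dotDr, dotZl, dotZr) (dotC G D) h !mulr0 addr0 add0r.
apply: le_trans st; rewrite !mulrA -!expr2; apply: lerD; apply: ler_piMr => //; exact: sqr_ge0.
Qed.

Lemma ideal_dot x : dot (ideal s t u0 x) (nu x) = s * enorm (nu x).
Proof.
rewrite dotDl (dotZl s) (dotZl t) direction_dot (dotC (tangential _ _)) normal_dot ?mulr0 ?addr0//.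
exact: orthoproj_sub.
Qed.

Lemma bounded_corr : bounded_field (ideal_corr s t u0).
Proof.
apply: bounded_fieldB; apply: bounded_fieldZ.
  split; first exact: mvec_nu_dir.
  by exists 1 => // x; exact: direction_enorm_le1.
have mg := mvec_gradu0.
apply: bounded_fieldB; split => //; try exact: mvec_proj.
  by exists 1 => // x; exact: grad_u0_le1.
exists 1 => // x; exact: le_trans (enorm_orthoproj _ _) (grad_u0_le1 x).
Qed.

Lemma corr_orth x w : (w <= P x)%MS -> dot (ideal_corr s t u0 x) w = 0.
Proof.
move=> wP; rewrite dotBl (dotZl s) (dotZl t) [X in s * X]dotZl normal_dot//.
by rewrite /tangential (orthoproj_orth _ wP) !mulr0 subrr.
Qed.

(** Take w proportional to t u0 + z, for a corrector z.  The tangential part of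
    sigma and g are in AE, so they only see t u0; the normal part sees the ideal
    gradient. *)
Lemma lower_witness (f g : Lip -> R) (e : R) : AE f -> restricts_to f (mdiv mu tau) -> AE g -> 0 < e ->
  exists w : Lip, [/\ k_lipschitz 1 w, test_function w &
    s * vI mu nu + t * (f (mkLip ku0) - g (mkLip ku0)) - e <= mdiv mu sigma w - g w].
Proof.
move=> Af rf Ag e0.
have [lf _] := Af; have [lg _] := Ag.
have Lt := L1vec_proj mP Ls; have Ln := L1vec_normal.
have t1 := t_le1.
have e8 : 0 < e / 8 by rewrite divr_gt0.
have c7 : 0 < 7 :> R by [].
have [dl1 dl10 f7] := AE_small Af c7 e8.
have [dl2 dl20 g7] := AE_small Ag c7 e8.
have mI : mvec (ideal s t u0).
  have [mc _] := bounded_corr.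
  have -> : ideal s t u0 = (fun x => ideal_corr s t u0 x + t *: grad u0 x).
    by apply/funext => x; rewrite ideal_corrE.
  by apply: mvecD => //; apply: mvecZ; exact: mvec_gradu0.
have e4 : 0 < e / 4 by rewrite divr_gt0.
have [r [e1 [e10 hr]]] := @corrector_pairing _ _ _ mu_radon _ _ t _ _ Ln mI ideal_le1 tu0 e4.
pose Y := s * vI mu nu + t * (f (mkLip ku0) - g (mkLip ku0)) - e / 2.
have Y0 : 0 < 10 * (`|Y| + 1) by rewrite mulr_gt0// ltr_wpDl.
pose e' := Num.min (Num.min 1 e1) (Num.min (Num.min dl1 dl2) (e / (10 * (`|Y| + 1)))).
have e'0 : 0 < e' by rewrite !lt_min ltr01 e10 dl10 dl20 divr_gt0.
have /andP[/andP[e'1 e'e1] /andP[/andP[e'd1 e'd2] e'Y]] :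
    ((e' <= 1) && (e' <= e1)) && (((e' <= dl1) && (e' <= dl2)) && (e' <= e / (10 * (`|Y| + 1)))).
  by rewrite -!le_min.
have tt : 0 <= t <= 1 by rewrite t0 t1.
have xiu x : enorm (ideal_corr s t u0 x + t *: grad u0 x) <= 1 by rewrite ideal_corrE ideal_le1.
have [z] := @corrector_exists _ _ _ mu_radon r _ _ _ _ bounded_corr (fun eta => @normal_orth _ eta (fun x w => @corr_orth x w)) tu0 ku0 tt xiu e'0.
have -> : (fun x => ideal_corr s t u0 x + t *: grad u0 x) = ideal s t u0.
  by apply/funext => x; rewrite ideal_corrE.
move=> cz; have [tz zb gz _] := cz.
have hp := hr e' z ltac:(by rewrite e'0 e'e1) cz.
have [su0 _] := tu0; have [sz _] := tz.
pose w0 x := t * u0 x + z x.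
have tw0 : test_function w0 by apply: test_functionD => //; exact: test_functionZ.
have [sw0 _] := tw0.
have gw0 x : grad w0 x = t *: grad u0 x + grad z x.
  rewrite gradD ?gradZ//; try exact: smooth_diff.
  by apply: smooth_diff; exact: smoothZ.
have L0 : 0 < 1 + 5 * e' by rewrite addr_gt0// mulr_gt0.
have kw0 : k_lipschitz (1 + 5 * e') w0.
  by apply: grad_lipschitz => x; [exact: smooth_diff|rewrite gw0].
have kz : k_lipschitz 7 z.
  have -> : z = (fun x => w0 x + - t * u0 x).
    by apply/funext => x; rewrite /w0; ring.
  have := k_lipschitzD kw0 (k_lipschitz_scale (- t) ku0).
  apply: k_lipschitzW; rewrite normrN (ger0_norm t0) mulr1.
  by apply: (@le_trans _ _ (1 + 5 * 1 + 1)); [by rewrite !lerD// ler_wpM2l|rewrite (_ : 1 + 5 * 1 + 1 = 7)//; ring].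
have fz := f7 (mkLip kz) kz (fun x => le_trans (zb x) e'd1).
have gz' := g7 (mkLip kz) kz (fun x => le_trans (zb x) e'd2).
have kw : k_lipschitz 1 (fun x => (1 + 5 * e')^-1 * w0 x).
  have := k_lipschitz_scale (1 + 5 * e')^-1 kw0.
  by rewrite gtr0_norm ?invr_gt0// mulVf ?gt_eqF.
exists (mkLip kw); split => //; first exact: test_functionZ.
have lin h : linear_form h -> h (mkLip kw0) = t * h (mkLip ku0) + h (mkLip kz).
  by move=> lh; rewrite (lh t 1 (mkLip ku0) (mkLip kz)) ?mul1r// => x; rewrite mul1r.
have gE : g (mkLip kw) = (1 + 5 * e')^-1 * g (mkLip kw0) by exact: (linZ lg).
have mE : mdiv mu sigma (mkLip kw) = (1 + 5 * e')^-1 * mdiv mu sigma w0.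
  exact: (mdivZ _ (ltW L0) sw0 kw0 Ls).
rewrite mE gE -(mulrBr (1 + 5 * e')^-1).
have sE : mdiv mu sigma w0 = f (mkLip kw0) + \int[mu]_x dot (t *: grad u0 x + grad z x) (nu x).
  rewrite rf// /mdiv.
  have L1a := L1_mdiv (ltW L0) sw0 kw0 Lt; have L1b := L1_mdiv (ltW L0) sw0 kw0 Ln.
  have -> : \int[mu]_x dot (t *: grad u0 x + grad z x) (nu x) = \int[mu]_x dot (grad w0 x) (nu x).
    by apply: eq_Rintegral => x _; rewrite gw0.
  rewrite -(IntD L1a L1b); apply: eq_Rintegral => x _.
  by rewrite -dotDr /normal addrC subrK.
have YE : Y <= mdiv mu sigma w0 - g (mkLip kw0).
  rewrite sE !lin//; move: hp fz gz'.
  have -> : \int[mu]_x dot (ideal s t u0 x) (nu x) = s * vI mu nu.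
    by rewrite /vI -(IntZ s (L1vec_enorm Ln)); apply: eq_Rintegral => x _; rewrite ideal_dot.
  rewrite /Y !ler_norml => h1 /andP[h2 _] /andP[_ h3].
  exact: witness_error_bound h1 h2 h3.
have e'Y' : 10 * (`|Y| + 1) * e' <= e by rewrite mulrC -ler_pdivlMr.
apply: (@le_trans _ _ ((1 + 5 * e')^-1 * Y)); last by rewrite ler_wpM2l// invr_ge0 ltW.
apply: le_trans (damped_ge e'0 e'Y'); rewrite /Y.
by move: (s * _ + t * _) => X; rewrite -[X - e / 2 - e / 2]addrA -opprD -splitr.
Qed.

End witness.
End lower_bound.

(** * Asymptotic radius and center *)

Section limsup.
Context (R : realType) (f : R -> \bar R).
Local Open Scope ereal_scope.

Lemma limf_esup_ge (a : \bar R) : (\forall h \near (0:R)^'+, a <= f h) -> a <= limf_esup f 0^'+.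
Proof.
move=> H; apply: le_ereal_inf_tmp => _ [A FA <-].
have AH : \forall h \near (0:R)^'+, A h /\ a <= f h by apply: filterI.
have [h [Ah ah]] := filter_ex AH.
by apply: le_trans ah _; apply: ereal_sup_ubound; exists h.
Qed.

Lemma limf_esup_le (a : \bar R) : (\forall h \near (0:R)^'+, f h <= a) -> limf_esup f 0^'+ <= a.
Proof.
move=> H; apply: (@le_trans _ _ (ereal_sup [set f h | h in [set h | f h <= a]])).
  by apply: ereal_inf_lbound; exists [set h | f h <= a].
by apply: ge_ereal_sup => _ [h ha <-].
Qed.

End limsup.

(** The right-hand side has derivative a > 0 at t = 0. *)
Lemma parabola_gt (R : realFieldType) (r a : R) : 0 <= r -> 0 < a ->
  exists2 t, 0 <= t <= 1 & r < (1 - t ^+ 2) * r + t * a.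
Proof.
move=> r0 a0; have p : 0 < 2 * (a + r) by rewrite mulr_gt0// ltr_wpDr.
have t0 : 0 < a / (2 * (a + r)) by rewrite divr_gt0.
exists (a / (2 * (a + r))).
  by rewrite ltW//= ler_pdivrMr// mul1r; lra.
set t := a / _ in t0 *; have tE : t * (2 * (a + r)) = a by rewrite /t divfK// gt_eqF.
have h : 0 < t * (a - t * r).
  rewrite mulr_gt0// subr_gt0 -[X in _ < X]tE ltr_pM2l//; lra.
lra.
Qed.

Lemma circle_le1 (R : realFieldType) (t : R) : 0 <= t <= 1 -> (1 - t ^+ 2) ^+ 2 + t ^+ 2 <= 1.
Proof.
move=> /andP[t0 t1]; have h : t ^+ 2 <= 1 by rewrite expr_le1.
have h0 : 0 <= t ^+ 2 by exact: sqr_ge0.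
have : t ^+ 2 * (t ^+ 2) <= 1 * t ^+ 2 by rewrite ler_wpM2r.
rewrite mul1r (expr2 (1 - _)) mulrBr mulr1 mulrBl mul1r; lra.
Qed.

Lemma KRdist_refl (R : realType) (d : nat) (f : Lip R d -> R) : KRdist f f = 0%E.
Proof.
apply/eqP; rewrite eq_le; apply/andP; split.
  by apply: KRdist_le => u _; rewrite subrr.
have k0 : k_lipschitz 1 (lip0 R d) by move=> x y; rewrite subrr normr0 mul1r enorm_ge0.
by have := @KRdist_ge _ _ f f _ k0; rewrite subrr.
Qed.

Section asymptotics.
Context (R : realType) (d : nat).
Local Notation V := 'rV[R]_d.
Local Notation B := (borel R d).
Local Notation Lip := (Lip R d).
Variable mu : {measure set B -> \bar R}.
Hypothesis mu_radon : radon mu.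
Local Notation L1 := (L1 mu).
Variables (T P : V -> 'M[R]_d) (sigma : V -> V).
Hypothesis T_tangent : forall eta, L1vec mu eta ->
  (MKfields mu eta <-> {ae mu, forall x, (eta x <= T x)%MS}).
Hypothesis PT : {ae mu, forall x, P x = T x}.
Hypothesis mP : forall i j, measurable_fun setT (fun x : B => orthoproj (P x) i j).
Hypothesis Ls : L1vec mu sigma.
Local Notation tau := (tangential P sigma).
Local Notation nu := (normal P sigma).
Local Notation r := (vI mu nu).
Variable f : Lip -> R.
Hypotheses (Af : AE f) (rf : restricts_to f (mdiv mu tau)).

Lemma L1vec_tangential : L1vec mu tau. Proof. exact: L1vec_proj. Qed.

(** Test with the fixed function given by lower_witness and let h tend to 0. *)
Lemma KR_lower (g : Lip -> R) (u0 : V -> R) (ku0 : k_lipschitz 1 u0) (s t e : R) :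
  AE g -> test_function u0 -> 0 <= t -> s ^+ 2 + t ^+ 2 <= 1 -> 0 < e ->
  \forall h \near (0:R)^'+,
   ((s * r + t * (f (mkLip ku0) - g (mkLip ku0)) - e)%:E <= KRdist (Dh mu sigma h) g)%E.
Proof.
move=> Ag tu0 t0 st e0; have e2 : 0 < e / 2 by rewrite divr_gt0.
have [w [kw tw hw]] := lower_witness mu_radon T_tangent PT mP Ls tu0 ku0 t0 st Af rf Ag e2.
have cD := Dh_cvg kw (fun x => smooth_diff x tw.1) Ls.
near=> h.
have : `|mdiv mu sigma w - Dh mu sigma h w| <= e / 2.
  by near: h; exact: ((cvgrPdist_le _ _).1 cD _ e2).
rewrite ler_norml => /andP[_ h1].
apply: le_trans (KRdist_ge (Dh mu sigma h) g kw); rewrite lee_fin.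
by move: h1 hw; move: (mdiv _ _ _) (Dh _ _ _ _) (g w) (s * _ + _) => a b c i; lra.
Unshelve. all: by end_near. Qed.

Lemma KR_lower0 (g : Lip -> R) e : AE g -> 0 < e ->
  \forall h \near (0:R)^'+, ((r - e)%:E <= KRdist (Dh mu sigma h) g)%E.
Proof.
move=> Ag e0.
have k0 : k_lipschitz 1 (fun _ : V => 0 : R) by move=> x y; rewrite subrr normr0 mul1r enorm_ge0.
have st : 1 ^+ 2 + 0 ^+ 2 <= 1 :> R by rewrite expr1n expr0n/= addr0.
have := KR_lower k0 Ag (test_function0 R d) (lexx 0) st e0.
by rewrite mul1r mul0r addr0.
Qed.

(** Replacing sigma by its tangential part costs at most r, and the quotients of
    that part converge to f. *)
Lemma KR_upper (g : Lip -> R) e : AE g -> 0 < e ->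
  \forall h \near (0:R)^'+, (KRdist (Dh mu sigma h) g <= (r + e)%:E + KRdist g f)%E.
Proof.
move=> Ag e0; have [lf _] := Af; have [lg _] := Ag.
have [h0 h00 H] := Dh_cvg_AE mu_radon L1vec_tangential Af rf e0.
apply: right_near0; exists h0 => // h hh; have [hp _] := andP hh.
apply: le_trans (KRdist_triangle _ f _) _; rewrite (KRdistC lf lg); apply: leeD => //.
apply: le_trans (KRdist_triangle _ (Dh mu tau h) _) _; rewrite EFinD; apply: leeD; last exact: H.
apply: KRdist_le => u ku; rewrite lee_fin; apply: le_trans (ler_norm _) _.
by have := Dh_diff hp ku Ls L1vec_tangential; rewrite mul1r.
Qed.

Lemma Hsup_ge (g : Lip -> R) : AE g -> (r%:E <= Hsup mu sigma g)%E.
Proof.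
move=> Ag; apply/lee_addgt0Pr => e e0.
rewrite -leeBlDr//; apply: limf_esup_ge; exact: KR_lower0.
Qed.

Lemma Hsup_le (g : Lip -> R) : AE g -> (Hsup mu sigma g <= r%:E + KRdist g f)%E.
Proof.
move=> Ag; apply/lee_addgt0Pr => e e0; rewrite -addeA [(_ + e%:E)%E]addeC addeA -EFinD.
by apply: limf_esup_le; exact: KR_upper.
Qed.

Lemma Hsup_center : Hsup mu sigma f = r%:E.
Proof.
apply/eqP; rewrite eq_le Hsup_ge// andbT.
by apply: le_trans (Hsup_le Af) _; rewrite KRdist_refl adde0.
Qed.

Lemma radius_eq : asymptotic_radius mu sigma = r%:E.
Proof.
apply/eqP; rewrite eq_le; apply/andP; split.
  by apply: ereal_inf_lbound; exists f => //; exact: Hsup_center.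
by apply: le_ereal_inf_tmp => _ [g Ag <-]; exact: Hsup_ge.
Qed.

Lemma separating_test (g : Lip -> R) : AE g -> g <> f ->
  exists (u0 : V -> R) (ku0 : k_lipschitz 1 u0), test_function u0 /\ 0 < f (mkLip ku0) - g (mkLip ku0).
Proof.
move=> Ag gf; have [lf _] := Af; have [lg _] := Ag.
have [u [tu fgu]] : exists u : Lip, test_function u /\ f u - g u != 0.
  apply: contrapT => H; apply: gf; apply: AE_unique => // u tu.
  by apply/esym/eqP; rewrite -subr_eq0; apply/negPn/negP => h; apply: H; exists u.
have [k k0 ku] := test_lipschitz tu.
pose a : R := Num.sg (f u - g u) / k.
have ka : k_lipschitz 1 (fun x => a * u x).
  have := k_lipschitz_scale a ku; apply: k_lipschitzW.
  by rewrite /a normrM normr_sg fgu mul1r gtr0_norm ?invr_gt0// mulVf ?gt_eqF.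
exists (fun x => a * u x), ka; split; first exact: test_functionZ.
rewrite (linZ (a := a) (u := u) lf)// (linZ (a := a) (u := u) lg)// -mulrBr /a mulrAC.
by rewrite -normrEsg divr_gt0// normr_gt0.
Qed.

(** If a test function u0 separates f from g, moving from s = 1 and t = 0 along
    s = 1 - t ^+ 2 gains a term of order t and loses one of order t ^+ 2. *)
Lemma center_eq : asymptotic_center mu sigma = [set f].
Proof.
apply/seteqP; split => [g [Ag]|_ -> /=]; last by split => //; rewrite radius_eq Hsup_center.
rewrite radius_eq => Hg /=; apply: contrapT => gf.
have [u0 [ku0 [tu0 a0]]] := separating_test Ag gf.
have [t t01 ht] := parabola_gt (vI_ge0 mu nu) a0.
have st := circle_le1 t01; have [t0 _] := andP t01.
(* the excess of the lower bound over r, half of which is left for the error *)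
pose e := (1 - t ^+ 2) * r + t * (f (mkLip ku0) - g (mkLip ku0)) - r.
have e0 : 0 < e / 2 by rewrite divr_gt0// subr_gt0.
have := limf_esup_ge (KR_lower ku0 Ag tu0 t0 st e0).
rewrite -/(Hsup mu sigma g) Hg lee_fin leNgt => /negP; apply.
rewrite ltrBrDr -ltrBrDl -/e ltr_pdivrMr// mulr_natr mulr2n ltrDl.
by move: e0; rewrite pmulr_lgt0.
Qed.

Lemma KR_cvg : KRdist (Dh mu sigma h) f @[h --> 0^'+] --> r%:E.
Proof.
apply: ereal_cvg_real => e e0.
apply: filterS2 (KR_lower0 Af e0) (KR_upper Af e0) => h h1.
by rewrite KRdist_refl adde0 h1 => ->.
Qed.

Lemma normal0_MK : r = 0 -> MKfields mu sigma.
Proof.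
move=> r0; suff : {ae mu, forall x, (sigma x <= T x)%MS} by move=> /(T_tangent Ls).
have Ln := L1vec_enorm (L1vec_normal mP Ls).
have : {ae mu, forall x, (enorm (nu x))%:E = 0%E}.
  have : (\int[mu]_x `|(enorm (nu x))%:E| = 0)%E.
    by under eq_integral do rewrite gee0_abs ?lee_fin ?enorm_ge0//; rewrite EFin_Int//; congr EFin.
  move/(ae_eq_integral_abs mu measurableT (measurable_int mu Ln)).
  by move=> H; apply: (@filterS _ _ (ae_filter_ringOfSetsType mu) _ _ _ H) => x; apply.
move=> h; have FF : Filter (nbhs (almost_everywhere mu)) by exact: (ae_filter_ringOfSetsType mu).
near=> x; have Px : P x = T x by near: x; exact: PT.
have : (enorm (nu x))%:E = 0%E by near: x.
move=> [] /enorm_eq0 /eqP; rewrite /normal subr_eq0 => /eqP ->.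
by rewrite -Px; exact: orthoproj_sub.
Unshelve. all: by end_near. Qed.

(** A Cauchy family is eventually close to one of its members, which is in AE; hence
    r is bounded by their asymptotic distance. *)
Lemma cauchy_normal0 : Dh_cauchy mu sigma -> r = 0.
Proof.
move=> C; apply/eqP; rewrite eq_le vI_ge0 andbT; apply/ler_addgt0Pr => e e0; rewrite add0r.
have [[A1 A2] /= [n1 n2] hA] := C e e0.
have hp : \forall h \near (0:R)^'+, 0 < h by exact: nbhs_right_gt.
have AH : \forall h \near (0:R)^'+, A2 h /\ 0 < h by apply: filterI.
have [h1 [Ah1 h10]] := filter_ex AH.
rewrite -lee_fin; apply: le_trans (Hsup_ge (Dh_AE mu_radon h10 Ls)) _.
apply: limf_esup_le; apply: filterS n1 => h Ah; apply: ltW.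
exact: (hA (h, h1) (conj Ah Ah1)).
Qed.

End asymptotics.

Section cauchy.
Context (R : realType) (d : nat) (mu : {measure set (borel R d) -> \bar R}).
Hypothesis mu_radon : radon mu.
Variable sigma : 'rV[R]_d -> 'rV[R]_d.
Hypothesis Ls : L1vec mu sigma.
Variable f : Lip R d -> R.
Hypotheses (Af : AE f) (rf : restricts_to f (mdiv mu sigma)).

Lemma Dh_cauchy_of_limit : Dh_cauchy mu sigma.
Proof.
move=> e e0; have e4 : 0 < e / 4 by rewrite divr_gt0.
have [h0 h00 H] := Dh_cvg_AE mu_radon Ls Af rf e4.
have [lf _] := Af.
have n : \forall h \near (0:R)^'+, 0 < h < h0 by apply: right_near0; exists h0.
exists ([set h | 0 < h < h0], [set h | 0 < h < h0]); first by split; exact: n.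
move=> [h h'] /= [hh hh'].
apply: le_lt_trans (KRdist_triangle _ f _) _.
rewrite (KRdistC lf (Dh_linear h' Ls)).
apply: le_lt_trans (leeD (H _ hh) (H _ hh')) _.
rewrite -EFinD lte_fin; lra.
Qed.

Lemma Dh_limit : KRdist (Dh mu sigma h) f @[h --> 0^'+] --> 0%E.
Proof.
have [lf _] := Af; apply: ereal_cvg_real => e e0.
have [h0 h00 H] := Dh_cvg_AE mu_radon Ls Af rf e0.
apply: right_near0; exists h0 => // h hh; rewrite sub0r add0r (H h hh) andbT.
apply: le_trans (KRdist_ge0 (Dh_linear h Ls) lf); rewrite lee_fin oppr_le0; exact: ltW.
Qed.

End cauchy.

Theorem corollary4p6 (R : realType) (d : nat)
    (mu : {measure set (borel R d) -> \bar R}) (mu_radon : radon mu)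
    (T : 'rV[R]_d -> 'M[R]_d) (T_tangent : MK_tangent_bundle mu T)
    (sigma : 'rV[R]_d -> 'rV[R]_d) (sigma_L1 : L1vec mu sigma) :
  let sigmaT := fun x => sigma x *m orthoproj (T x) in
  let sigmaN := fun x => sigma x *m orthoproj (orthc (T x)) in
  let fT := AE_of_distr (mdiv mu sigmaT) in
  let r := (\int[mu]_x (enorm (sigmaN x))%:E)%E in
  [/\ (* (i) *)
      distr_in_AE (mdiv mu sigmaT) /\
      (forall g, AE g ->
        (r <= Hsup mu sigma g)%E /\ (Hsup mu sigma g <= r + KRdist g fT)%E),
      (* (ii) *)
      (Dh_cauchy mu sigma <-> MKfields mu sigma) /\
      (MKfields mu sigma ->
        KRdist (Dh mu sigma h) (AE_of_distr (mdiv mu sigma))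
          @[h --> 0^'+] --> 0%E)
    & (* (iii) *)
      ~ MKfields mu sigma ->
      [/\ (0 < asymptotic_radius mu sigma)%E,
          asymptotic_radius mu sigma = r,
          asymptotic_center mu sigma = [set fT]
        & KRdist (Dh mu sigma h) fT @[h --> 0^'+] --> r]].
Proof.
have [mT TT] := T_tangent; have [P [PT mP]] := borel_bundle mT.
move=> sigmaT sigmaN fT r.
have divE : mdiv mu sigmaT = mdiv mu (tangential P sigma).
  apply/funext => u; apply: ae_eq_Rintegral.
  by apply: (@filterS _ _ (ae_filter_ringOfSetsType mu) _ _ _ PT) => x Px; rewrite /sigmaT /tangential Px.
have rE : r = (vI mu (normal P sigma))%:E.
  rewrite /vI -(EFin_Int (L1vec_enorm (L1vec_normal mP sigma_L1))); apply: ae_eq_integral_nm.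
  apply: (@filterS _ _ (ae_filter_ringOfSetsType mu) _ _ _ PT) => x Px.
  by rewrite /sigmaN orthoproj_orthc /normal /tangential Px.
have [_ dT] := tangential_MK TT PT mP sigma_L1.
have dT' : distr_in_AE (mdiv mu sigmaT) by rewrite divE.
have [Af rf] := AE_of_distrP dT'; rewrite -/fT divE in Af rf.
rewrite rE; split.
- split; [exact: dT'|]; move=> g Ag; split; [exact: (Hsup_ge mu_radon TT PT mP sigma_L1 Af rf)|].
  exact: (Hsup_le mu_radon mP sigma_L1 Af rf).
- split; last first.
    by move=> [_ dS]; have [AS rS] := AE_of_distrP dS; exact: Dh_limit.
  split=> [C|[_ dS]]; last by have [AS rS] := AE_of_distrP dS; exact: Dh_cauchy_of_limit AS rS.
  apply: (normal0_MK TT PT mP sigma_L1).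
  exact: (cauchy_normal0 mu_radon TT PT mP sigma_L1 Af rf).
move=> nS; have radE := radius_eq mu_radon TT PT mP sigma_L1 Af rf.
split.
- rewrite radE lte_fin lt0r vI_ge0 andbT; apply/eqP => r0; apply: nS.
  exact: (normal0_MK TT PT mP sigma_L1 r0).
- exact: radE.
- exact: (center_eq mu_radon TT PT mP sigma_L1 Af rf).
- exact: (KR_cvg mu_radon TT PT mP sigma_L1 Af rf).
Qed.
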